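(* Let $c>0$, let $\{N(t)\}_{t\ge0}$ be a Poisson process with rate function $\lambda(t)\in C^1\bigl((0,\infty),[0,\infty)\bigr)$, let $V_0$ be a random variable independent of $N$ with $$P\{V_0=c\}=\tfrac14,\qquad P\{V_0=0\}=\tfrac12,\qquad P\{V_0=-c\}=\tfrac14,$$ and let $\{V(t)\}_{t\ge0}$ be the velocity process with $V(0)=V_0$ that changes only at the events of $N$, according to $$\begin{cases}P\{V(t+dt)=c\mid V(t)=0,\ N(t,t+dt]=1\}=1/2,\\ P\{V(t+dt)=-c\mid V(t)=0,\ N(t,t+dt]=1\}=1/2,\\ P\{V(t+dt)=0\mid V(t)=\pm c,\ N(t,t+dt]=1\}=1.\end{cases}$$ Let $\{\mathcal{T}(t)\}_{t\ge0}$ be the one-dimensional motion $\mathcal{T}(t)=\int_0^tV(s)\,ds$. Then the transition density $p(x,t)\,dx=P\{\mathcal{T}(t)\in dx\}$ satisfies the third-order partial differential equation $$\frac{\partial^3p}{\partial t^3}+3\lambda(t)\frac{\partial^2p}{\partial t^2}+\bigl(2\lambda^2(t)+\lambda'(t)\bigr)\frac{\partial p}{\partial t}=c^2\frac{\partial^3p}{\partial t\,\partial x^2}+c^2\lambda(t)\frac{\partial^2p}{\partial x^2}.$$ Moreover, if $\int_0^t\lambda(s)\,ds<\infty$, $$P\{\mathcal{T}(t)=ct\}=P\{\mathcal{T}(t)=-ct\}=\frac12P\{\mathcal{T}(t)=0\}=\frac{e^{-\int_0^t\lambda(s)\,ds}}{4}.$$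
   Context: $N(t,t+dt]$ denotes the number of events of $N$ in $(t,t+dt]$. The velocity $V$ is constant between consecutive events of the Poisson process, and its changes at the events are made according to the stated probabilities independently of everything else. Since the law of $\mathcal{T}(t)$ may have atoms at $\pm ct$ and $0$, $p(x,t)$ is the density of its absolutely continuous component.
   Formalization: As p need not have the derivatives in the equation, the equation is proved in the distribution sense in x away from x=0 and x=±ct, and pointwise on open sets where p is C^3; the atom formulas are for t>0; the velocity may not anticipate later events of N. *)

(* Defs.v *)
From HB Require Import structures.
From mathcomp Require Import all_boot all_order all_algebra.
From mathcomp Require Import all_classical all_reals all_analysis.

Set Implicit Arguments.
Unset Strict Implicit.
Unset Printing Implicit Defensive.
Import Order.TTheory GRing.Theory Num.Theory.
Import numFieldNormedType.Exports.
Local Open Scope ring_scope.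
Local Open Scope classical_set_scope.

Section Process.
Context (R : realType) (d : measure_display) (Omega : measurableType d).
Variable P : probability Omega R.
Implicit Types (lam : R -> R) (E : Omega -> set R) (V : R -> {RV P >-> R}).

(* [lam] is only constrained on the open half-line, so that its integral may
   diverge at 0. *)
Definition C1_rate lam : Prop :=
  forall t : R, 0 < t ->
    [/\ 0 <= lam t, derivable lam t 1 & {for t, continuous (derive1 lam)}].

Definition cumulative_rate lam (s t : R) : \bar R :=
  (\int[lebesgue_measure]_(u in `]s, t]) (lam u)%:E)%E.

(* Number of events in (s, t]; [E w] is the set of event times.  The process is
   given by its event times because N(0, t] is almost surely infinite when the
   integral of the rate diverges at 0, so that N(0, t] - N(0, s] is then
   meaningless. *)
Definition N_events E (s t : R) (w : Omega) : \bar R :=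
  counting (E w `&` `]s, t]).

Definition N_eq E (s t : R) (k : nat) : set Omega :=
  [set w | N_events E s t w = k%:R%:E].

Record poisson_process lam E : Prop := {
  poisson_events_pos : forall w, E w `<=` `]0, +oo[ ;
  poisson_locally_finite : forall w (s t : R),
    0 < s -> s <= t -> finite_set (E w `&` `]s, t]) ;
  poisson_measurable : forall (s t : R) k,
    0 <= s -> s <= t -> measurable (N_eq E s t k) ;
  poisson_counts : forall (s t : R) (k : nat),
    0 <= s -> s <= t -> (cumulative_rate lam s t < +oo)%E ->
    let L := fine (cumulative_rate lam s t) in
    P (N_eq E s t k) = (L ^+ k / k`!%:R * expR (- L))%:E ;
  poisson_increments : forall (n : nat) (t : nat -> R) (k : nat -> nat),
    0 <= t 0%N -> (forall i, t i <= t i.+1) ->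
    P (\bigcap_(i in `I_n) N_eq E (t i) (t i.+1) (k i)) =
    (\prod_(i < n) P (N_eq E (t i) (t i.+1) (k i)))%E }.

Definition counts_on E (I : set R) : set (set Omega) :=
  [set A | exists s t (k : nat),
     [/\ I s, I t, s <= t & A = N_eq E s t k]].

Definition rv_events (X : {RV P >-> R}) : set (set Omega) :=
  [set A | exists B : set R, measurable B /\ A = X @^-1` B].

Definition velocities_on V (I : set R) : set (set Omega) :=
  [set A | exists r, I r /\ rv_events (V r) A].

Definition indep_sigma (F G : set (set Omega)) : Prop :=
  forall A B, F A -> G B -> P (A `&` B) = (P A * P B)%E.

(* [history V E s] is the information in the velocity up to time s together with
   the whole Poisson process; conditioning on it expresses that the choices made
   at the events are independent of everything else.  The transition rules are
   written in product form, P(A, V(s) = u, N(s,t] = 1, V(t) = v) =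
   q(u,v) P(A, V(s) = u, N(s,t] = 1), since the conditioning event may be null;
   A = setT gives the conditional probabilities themselves. *)
Definition history V E (s : R) : set (set Omega) :=
  <<s velocities_on V `[0, s] `|` counts_on E `[0, +oo[ >>.

(* [velocity_adapted] follows from the other clauses when the rate is integrable
   at 0.  Otherwise there is no first event, the initial value V(0) and the
   transition rules do not determine V, and this clause excludes velocities that
   anticipate N, e.g. V(t) = 0 iff N(t, 1] is odd for all 0 < t < 1. *)
Record velocity_process (c : R) E (V0 : {RV P >-> R}) V : Prop := {
  velocity_init : forall w, V 0 w = V0 w ;
  velocity_states : forall (t : R) w, 0 <= t ->
    [\/ V t w = c, V t w = 0 | V t w = - c] ;
  velocity_constant : forall (s t : R) w, 0 <= s -> s <= t ->
    E w `&` `]s, t] = set0 -> V t w = V s w ;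
  velocity_from0 : forall (s t : R) A v, 0 <= s -> s < t ->
    history V E s A -> v = c \/ v = - c ->
    let B := A `&` V s @^-1` [set 0] `&` N_eq E s t 1 in
    P (B `&` V t @^-1` [set v]) = ((2^-1)%:E * P B)%E ;
  velocity_to0 : forall (s t : R) A v, 0 <= s -> s < t ->
    history V E s A -> v = c \/ v = - c ->
    let B := A `&` V s @^-1` [set v] `&` N_eq E s t 1 in
    P (B `&` V t @^-1` [set 0]) = P B ;
  velocity_adapted : forall s : R, 0 <= s ->
    indep_sigma <<s velocities_on V `[0, s] `|` counts_on E `[0, s] >>
                <<s counts_on E `[s, +oo[ >> }.

Definition position V (t : R) (w : Omega) : R :=
  \int[lebesgue_measure]_(s in `[0, t]) V s w.

End Process.

Section Density.
Context (R : realType).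
Implicit Types (m : set R -> \bar R) (lam f phi : R -> R) (p q : R -> R -> R).

(* Lebesgue decomposition of m: f(x)dx plus a part carried by the null set Z. *)
Definition ac_density m f : Prop :=
  [/\ measurable_fun setT f, forall x, 0 <= f x &
    exists Z : set R, [/\ measurable Z, lebesgue_measure Z = 0%E &
      forall A : set R, measurable A ->
        m (A `\` Z) = (\int[lebesgue_measure]_(x in A) (f x)%:E)%E]].

Definition partial_x q : R -> R -> R := fun x t => derive1 (q ^~ t) x.
Definition partial_t q : R -> R -> R := fun x t => derive1 (q x) t.

Fixpoint Ck (k : nat) (U : set (R * R)) q : Prop :=
  (forall z, U z -> {for z, continuous (fun y : R * R => q y.1 y.2)}) /\
  if k is k'.+1 then
    [/\ forall z, U z -> derivable (q ^~ z.2) z.1 1 /\ derivable (q z.1) z.2 1,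
        Ck k' U (partial_x q) & Ck k' U (partial_t q)]
  else True.

(* Pointwise form, on the open sets of the half-plane t > 0 where p is regular
   enough for all the derivatives to make sense. *)
Definition classical_solution (c : R) lam p : Prop :=
  forall U : set (R * R), open U -> (forall z, U z -> 0 < z.2) -> Ck 3 U p ->
  forall x t, U (x, t) ->
    partial_t (partial_t (partial_t p)) x t
    + 3 * lam t * partial_t (partial_t p) x t
    + (2 * lam t ^+ 2 + derive1 lam t) * partial_t p x t
    = c ^+ 2 * partial_t (partial_x (partial_x p)) x t
      + c ^+ 2 * lam t * partial_x (partial_x p) x t.

Definition support_of phi : set R := closure [set x | phi x != 0].

Definition test_function phi : Prop :=
  (forall n x, derivable (derive1n n phi) x 1) /\ compact (support_of phi).

Definition pairing p phi (t : R) : R :=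
  \int[lebesgue_measure]_x (phi x * p x t).

(* The equation in the sense of distributions in x, off the lines x = 0 and
   x = +-ct carrying the atoms: d^2p/dx^2 is tested against phi by transposing
   the x-derivatives, while the t-derivatives are taken of the pairing.  When lam
   is merely C^1 the density need not have classical second derivatives: its
   one-event part is e^{-Lambda(t)} (lam(|x|/c) + lam(t - |x|/c)) / (4c).
   Dualising in t as well is no option, as it would require lam''. *)
Definition weak_solution (c : R) lam p : Prop :=
  forall phi (t : R), test_function phi -> 0 < t ->
    ~ support_of phi 0 -> ~ support_of phi (c * t) ->
    ~ support_of phi (- (c * t)) ->
    let u := pairing p phi in
    let uxx := pairing p (derive1n 2 phi) in
    [/\ forall n, (n < 3)%N -> derivable (derive1n n u) t 1,
        derivable uxx t 1 &
        derive1n 3 u t + 3 * lam t * derive1n 2 u t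
        + (2 * lam t ^+ 2 + derive1 lam t) * derive1 u t
        = c ^+ 2 * derive1 uxx t + c ^+ 2 * lam t * uxx t].

End Density.

(* Main.v *)
Require Import Defs.
From HB Require Import structures.
From mathcomp Require Import all_boot all_order all_algebra.
From mathcomp Require Import all_classical all_reals all_analysis.
From mathcomp Require Import measurable_realfun zify ring lra.
From mathcomp Require finmap.
Import Order.TTheory GRing.Theory Num.Theory.
Import numFieldNormedType.Exports.
Local Open Scope ring_scope.
Local Open Scope classical_set_scope.

(** The pair (position, velocity) is Markov, and the equation is a consequence
    of its forward equation.  For a function [g] of the velocity and a smooth
    [psi], let M(g, psi)(t) be the expectation of psi(X(t)) g(V(t)).  In a short
    time there is no event, and the position moves with the current velocity;
    or one event, and the velocity is averaged by the transition rule; or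
    several, with a probability of second order.  Hence, with Q g the mean of
    [g] after a jump,
      M(g, psi)' = M(v g, psi') + lam (M(Q g, psi) - M(g, psi))
    ([moment_increment], [moment_is_derive]).  On the three states v^3 = c^2 v,
    Q v = 0 and Q v^2 = c^2 - v^2, so that m_k(psi) = M(v^k, psi) satisfies
      m_0(psi)' = m_1(psi'),
      m_1(psi)' = m_2(psi') - lam m_1(psi),
      m_2(psi)' = c^2 m_1(psi') + lam (c^2 m_0(psi) - 2 m_2(psi)).
    Eliminating m_1 and m_2 from u = m_0(phi) yields the third-order equation
    for u ([weak_equation]).

    That equation concerns the law of the position, whereas [p] is the density
    of its absolutely continuous part.  The two agree against a test function
    vanishing at 0 and +-ct ([pairing_vmoment]): without events in (0, t] the
    position is V(0) t, and on the remaining event the law is absolutely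
    continuous ([Pr_position_null]).  For the latter, cut (s, t] into small
    pieces and consider the piece of the last event, the final velocity being v.
    Before that piece the velocity differs from v, and Y(r) = X(r) - v r lies
    within a mesh of X(t) - v t.  As one event in the piece costs the small
    factor L with respect to no event, the probability that X(t) lies in [a, b]
    is at most the maximal rate times the expected time during which V differs
    from v and Y lies in a translate of [a, b].  Let Psi be the identity clamped
    to that translate.  The quantity (V - v) Psi(Y) increases at least at the
    rate c^2 during this time, it does not decrease between events, and it jumps
    by O(b - a) at each event; so the expected time is O(b - a)
    ([occupation_bound], [Pr_last_event]).  One may work on (s, t] with s > 0,
    where the rate is bounded even if it is not integrable at 0, because an
    event in (0, t] lies in (s, t] for small s.

    Where [p] is of class C^3 one may differentiate under the integral sign and
    integrate by parts in the weak equation tested against bumps, and conclude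
    by continuity ([tested_equation], [pointwise_of_tested]); the lines x = 0
    and x = +-ct contain no segment of constant time, so bumps avoiding them are
    still supported arbitrarily close to each point.  Finally the atoms come
    from the absence of events, whose probability is exp(-Lambda), and from the
    independence of V(0) and the events ([Pr_atom]). *)

Set Implicit Arguments.
Unset Strict Implicit.
Unset Printing Implicit Defensive.

(** * Bounded measurable functions and their expectations *)
Section BoundedMeasurable.
Context (R : realType) (d : measure_display) (T : measurableType d).
Implicit Types (f g : T -> R) (D : set T).

Definition bounded_by (K : R) f := forall x, `|f x| <= K.

Definition bmeas f := measurable_fun setT f /\ exists K, bounded_by K f.

Lemma bmeas_cst (k : R) : bmeas (cst k).
Proof. by split=> //; exists `|k| => x. Qed.

Lemma bmeas_indic D : measurable D -> bmeas (\1_D : T -> R).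
Proof.
move=> mD; split; first exact: measurable_indic.
by exists 1 => x; rewrite indicE; case: (_ \in _); rewrite ?normr0 ?normr1.
Qed.

Lemma bmeasD f g : bmeas f -> bmeas g -> bmeas (fun x => f x + g x).
Proof.
move=> [mf [K fK]] [mg [L gL]]; split; first exact: measurable_funD.
by exists (K + L) => x; rewrite (le_trans (ler_normD _ _))// lerD.
Qed.

Lemma bmeasM f g : bmeas f -> bmeas g -> bmeas (fun x => f x * g x).
Proof.
move=> [mf [K fK]] [mg [L gL]]; split; first exact: measurable_funM.
by exists (K * L) => x; rewrite normrM ler_pM.
Qed.

Lemma bmeasZ k f : bmeas f -> bmeas (fun x => k * f x).
Proof. by move=> mf; apply: bmeasM => //; exact: bmeas_cst. Qed.

Lemma bmeasN f : bmeas f -> bmeas (fun x => - f x).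
Proof.
by move=> mf; under eq_fun do rewrite -mulN1r; exact: bmeasZ.
Qed.

Lemma bmeasB f g : bmeas f -> bmeas g -> bmeas (fun x => f x - g x).
Proof. by move=> mf mg; apply: bmeasD => //; exact: bmeasN. Qed.

Lemma bmeas_norm f : bmeas f -> bmeas (fun x => `|f x|).
Proof.
move=> [mf [K fK]]; split; first exact: measurableT_comp.
by exists K => x; rewrite normr_id.
Qed.

Lemma bmeas_sum (n : nat) (F : nat -> T -> R) :
  (forall i, bmeas (F i)) -> bmeas (fun x => \sum_(i < n) F i x).
Proof.
move=> mF; elim: n => [|n ih].
  by under eq_fun do rewrite big_ord0; exact: bmeas_cst.
by under eq_fun do rewrite big_ord_recr/=; exact: bmeasD.
Qed.

End BoundedMeasurable.

Lemma bmeas_comp (R : realType) d (T : measurableType d) (f : R -> R)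
    (X : T -> R) :
  bmeas f -> measurable_fun setT X -> bmeas (fun w => f (X w)).
Proof.
move=> [mf [K fK]] mX; split; first exact: measurableT_comp.
by exists K => x; exact: fK.
Qed.

Section BoundedFunctional.
Context (R : realType) (d : measure_display) (T : measurableType d).
Implicit Types (f g : T -> R) (D : set T).

(** The number of positive integers up to [y] is its integral part. *)
Lemma count_le_approx (y : R) (N : nat) : 0 <= y -> y <= N%:R ->
  `|y - \sum_(k < N) (k.+1%:R <= y)%R%:R| <= 1.
Proof.
move=> y0 yN.
suff : forall M : nat, Num.min y M%:R - 1 <= \sum_(k < M) (k.+1%:R <= y)%R%:R
    /\ \sum_(k < M) (k.+1%:R <= y)%R%:R <= Num.min y M%:R :> R.
  move=> /(_ N)[]; rewrite min_l// => a b.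
  by rewrite ler_norml; apply/andP; split; lra.
elim=> [|M [h1 h2]]; first by rewrite big_ord0 min_r//; split; lra.
rewrite big_ord_recr/= -natr1.
move: h1 h2; set S := \sum_(k < M) _ => h1 h2.
have [yM|yM] := leP (M%:R + 1) y.
  have yM' : M%:R <= y by lra.
  by rewrite (min_r yM') in h1 h2; rewrite /=; split; lra.
rewrite /= addr0.
have [yM'|yM'] := leP y M%:R.
  by rewrite (min_l yM') in h1 h2; split; lra.
rewrite (_ : S = M%:R); first by split; lra.
rewrite /S (eq_bigr (fun=> 1)) ?sumr_const ?card_ord// => k _.
by rewrite (le_trans _ (ltW yM'))// ler_nat.
Qed.

(** A bounded measurable function is a uniform limit of combinations of
    indicators of its superlevel sets, so a functional that is linear and
    bounded for the uniform norm is determined by its values on indicators.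
    Applied to a difference of two functionals, it turns identities between
    measures of sets into identities between integrals. *)
Lemma bounded_functional_eq0 (J : (T -> R) -> R) (C : R) :
  (forall f g, bmeas f -> bmeas g -> J (fun x => f x + g x) = J f + J g) ->
  (forall k f, bmeas f -> J (fun x => k * f x) = k * J f) ->
  (forall f K, bmeas f -> bounded_by K f -> `|J f| <= C * K) ->
  (forall D, measurable D -> J (\1_D) = 0) ->
  forall f, bmeas f -> J f = 0.
Proof.
move=> JD JZ JC J1 f bf; have [mf [K fK]] := bf.
have bc k : bmeas (cst k : T -> R) by exact: bmeas_cst.
have J0 : J (cst 0) = 0 by have := J1 _ measurable0; rewrite indic0.
have JK : J (cst K) = 0.
  have := J1 _ measurableT; rewrite indicT => J1T.
  have := JZ K _ (bc 1); rewrite J1T mulr0 => <-.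
  by congr J; apply/funext => x; rewrite /= mulr1.
suff JfK : J (fun x => f x + K) = 0.
  by have := JD f (cst K) bf (bc K); rewrite JfK JK addr0.
have C0 : 0 <= C.
  have := JC (cst 1) 1 (bc 1).
  by rewrite mulr1 => /(_ _)/(le_trans _)-> // x; rewrite /= normr1.
apply/eqP; rewrite -normr_le0; apply/ler_addgt0Pl => e e0; rewrite addr0.
(* Levels at distance 1 / (n + 1); as C / (n + 1) < e, the error is below e. *)
have [n Cn] : exists n : nat, C / e < n.+1%:R.
  exists (Num.truncn (C / e)).
  by rewrite truncnS_gt//.
pose N := (Num.truncn (n.+1%:R * (K + K))).+1.
have bD k : measurable [set x | k%:R <= n.+1%:R * (f x + K)].
  rewrite -[X in measurable X]setTI.
  apply: measurable_fun_le => //; apply: measurable_funM => //.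
  exact: measurable_funD.
pose D k := [set x | k.+1%:R <= n.+1%:R * (f x + K)].
pose g x : R := n.+1%:R^-1 * \sum_(k < N) \1_(D k) x.
have bS m : bmeas (fun x => \sum_(k < m) \1_(D k) x : R).
  by apply: (@bmeas_sum _ _ _ m (fun k => \1_(D k))) => k; exact/bmeas_indic/bD.
have Jg : J g = 0.
  rewrite /g JZ; last exact: bS.
  suff H m : J (fun x => \sum_(k < m) \1_(D k) x) = 0 by rewrite H mulr0.
  elim: m => [|m ih].
    by rewrite -[RHS]J0; congr J; apply/funext => x; rewrite big_ord0.
  under eq_fun do rewrite big_ord_recr/=.
  have H : J (fun x => \1_(D m) x) = 0 := J1 _ (bD _).
  by rewrite JD ?ih ?H ?addr0//; [exact: bS|exact/bmeas_indic/bD].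
have bg : bmeas g.
  by apply: bmeasZ; exact: bS.
rewrite (_ : (fun x => _) = fun x => ((f x + K) + (-1) * g x) + g x); last first.
  by apply/funext => x; lra.
have bfKg : bmeas (fun x => f x + K + (-1) * g x).
  by apply: bmeasD; [apply: bmeasD => //; exact: bc|exact: bmeasZ].
rewrite JD// Jg addr0.
have /JC : bounded_by n.+1%:R^-1 (fun x => f x + K + (-1) * g x).
  move=> x; have nz : n.+1%:R != 0 :> R by rewrite pnatr_eq0.
  have n0 : 0 < n.+1%:R :> R by [].
  rewrite /g (_ : _ + _ = n.+1%:R^-1 * (n.+1%:R * (f x + K) -
    \sum_(k < N) \1_(D k) x)); last by field.
  rewrite normrM ger0_norm ?invr_ge0// ler_piMr ?invr_ge0//.
  rewrite (eq_bigr (fun k : 'I_N => (k.+1%:R <= n.+1%:R * (f x + K))%R%:R)); last first.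
    move=> k _; rewrite indicE /D; congr (_%:R)%R; congr nat_of_bool.
    by apply/idP/idP; rewrite inE.
  have := fK x; rewrite ler_norml => /andP[f1 f2].
  apply: count_le_approx; first by rewrite mulr_ge0//; lra.
  apply: (@le_trans _ _ (n.+1%:R * (K + K))); first by rewrite ler_pM2l//; lra.
  by apply: ltW; exact: truncnS_gt.
move=> /(_ bfKg)/le_trans; apply.
by rewrite ler_pdivrMr// mulrC -ler_pdivrMr// ltW.
Qed.

End BoundedFunctional.

Section Expectation.
Context (R : realType) (d : measure_display) (T : measurableType d).
Variable P : probability T R.
Implicit Types (f g : T -> R) (D : set T).

Definition Ex f : R := \int[P]_w f w.

Definition Pr D : R := fine (P D).

Lemma PrE D : measurable D -> P D = (Pr D)%:E.
Proof. by move=> mD; rewrite /Pr fineK// fin_num_measure. Qed.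

Lemma Pr_ge0 D : 0 <= Pr D.
Proof. by rewrite fine_ge0. Qed.

Lemma le_Pr D D' : measurable D -> measurable D' -> D `<=` D' -> Pr D <= Pr D'.
Proof. by move=> mD mD' DD'; rewrite -lee_fin -!PrE// le_measure ?inE. Qed.

Lemma PrU D D' : measurable D -> measurable D' -> D `&` D' = set0 ->
  Pr (D `|` D') = Pr D + Pr D'.
Proof.
move=> mD mD' DD'; apply: EFin_inj.
by rewrite EFinD -!PrE ?measureU//; exact: measurableU.
Qed.

Lemma bmeas_integrable f : bmeas f -> P.-integrable setT (EFin \o f).
Proof.
move=> [mf [K fK]]; apply: measurable_bounded_integrable => //.
  by rewrite (le_lt_trans (probability_le1 _ _))// ltry.
by exists K; split; rewrite ?num_real// => M KM x _ /=;
  rewrite (le_trans (fK _))// ltW.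
Qed.

Lemma ExD f g : bmeas f -> bmeas g -> Ex (fun w => f w + g w) = Ex f + Ex g.
Proof. by move=> bf bg; rewrite /Ex RintegralD//; exact: bmeas_integrable. Qed.

Lemma ExB f g : bmeas f -> bmeas g -> Ex (fun w => f w - g w) = Ex f - Ex g.
Proof. by move=> bf bg; rewrite /Ex RintegralB//; exact: bmeas_integrable. Qed.

Lemma ExZ k f : bmeas f -> Ex (fun w => k * f w) = k * Ex f.
Proof. by move=> bf; rewrite /Ex RintegralZl//; exact: bmeas_integrable. Qed.

Lemma Ex_cst k : Ex (cst k) = k.
Proof. by rewrite /Ex Rintegral_cst// [X in fine X](_ : _ = 1%E) ?mulr1//; exact: probability_setT. Qed.

Lemma Ex_indic D : measurable D -> Ex \1_D = Pr D.
Proof.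
by move=> mD; rewrite /Ex /Rintegral integral_indic// setIT.
Qed.

Lemma le_Ex f g : bmeas f -> bmeas g -> (forall w, f w <= g w) -> Ex f <= Ex g.
Proof.
by move=> bf bg fg; apply: le_Rintegral => //; exact: bmeas_integrable.
Qed.

Lemma normr_Ex f g : bmeas f -> bmeas g -> (forall w, `|f w| <= g w) ->
  `|Ex f| <= Ex g.
Proof.
move=> bf bg fg; apply: (@le_trans _ _ (Ex (fun w => `|f w|))).
  by apply: le_normr_Rintegral => //; exact: bmeas_integrable.
by apply: le_Ex => //; exact: bmeas_norm.
Qed.

Lemma normr_Ex_cst f K : bmeas f -> bounded_by K f -> `|Ex f| <= K.
Proof.
move=> bf fK; rewrite -(Ex_cst K).
by apply: normr_Ex => //; exact: bmeas_cst.
Qed.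

Lemma normr_Ex_indic f K D : bmeas f -> measurable D ->
  (forall w, `|f w| <= K * \1_D w) -> `|Ex f| <= K * Pr D.
Proof.
move=> bf mD fK; rewrite -Ex_indic// -ExZ; last exact: bmeas_indic.
by apply: normr_Ex => //; apply: bmeasZ; exact: bmeas_indic.
Qed.

Lemma Ex_sum n (F : nat -> T -> R) : (forall i, bmeas (F i)) ->
  Ex (fun w => \sum_(i < n) F i w) = \sum_(i < n) Ex (F i).
Proof.
move=> bF; elim: n => [|n ih].
  rewrite big_ord0 -[RHS](Ex_cst 0); congr Ex; apply/funext => w.
  by rewrite big_ord0.
rewrite big_ord_recr/= -ih -ExD//; last exact: (@bmeas_sum _ _ _ n F).
by congr Ex; apply/funext => w; rewrite big_ord_recr.
Qed.

(** A proportionality known on the events of the sigma-algebra generated by [X]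
    extends to the functions of [X]; this is how the independence of the past
    from the coming events and the transition rules are used. *)
Lemma Ex_transfer (X : T -> R) D D' (k : R) :
  measurable_fun setT X -> measurable D -> measurable D' ->
  (forall B, measurable B -> P (X @^-1` B `&` D') = (k%:E * P (X @^-1` B `&` D))%E) ->
  forall f : R -> R, bmeas f ->
  Ex (fun w => f (X w) * \1_D' w) = k * Ex (fun w => f (X w) * \1_D w).
Proof.
move=> mX mD mD' XD f bf; apply/eqP; rewrite -subr_eq0; apply/eqP.
have bfX (g : R -> R) D0 : bmeas g -> measurable D0 -> bmeas (fun w => g (X w) * \1_D0 w).
  by move=> bg mD0; apply: bmeasM; [exact: bmeas_comp|exact: bmeas_indic].
pose J (g : R -> R) := Ex (fun w => g (X w) * \1_D' w)
                       - k * Ex (fun w => g (X w) * \1_D w).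
rewrite -[LHS]/(J f); apply: (@bounded_functional_eq0 _ _ _ J (1 + `|k|)) => //.
- move=> f1 f2 b1 b2; rewrite /J.
  under [X in Ex X]eq_fun do rewrite mulrDl.
  under [X in _ - _ * Ex X]eq_fun do rewrite mulrDl.
  rewrite !ExD; try exact: bfX; ring.
- move=> l g bg; rewrite /J.
  under [X in Ex X]eq_fun do rewrite -mulrA.
  under [X in _ - _ * Ex X]eq_fun do rewrite -mulrA.
  rewrite !ExZ; try exact: bfX; ring.
- move=> g K bg gK; rewrite /J (le_trans (ler_normB _ _))// mulrDl lerD//.
    rewrite mul1r; apply: normr_Ex_cst; first exact: bfX.
    by move=> w; rewrite normrM indicE -[leRHS]mulr1 ler_pM//; case: (_ \in _);
      rewrite ?normr0 ?normr1.
  rewrite normrM ler_wpM2l//; apply: normr_Ex_cst; first exact: bfX.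
  by move=> w; rewrite normrM indicE -[leRHS]mulr1 ler_pM//; case: (_ \in _);
      rewrite ?normr0 ?normr1.
- move=> B mB; rewrite /J.
  have XB D0 : measurable D0 ->
      Ex (fun w => \1_B (X w) * \1_D0 w) = Pr (X @^-1` B `&` D0).
    move=> mD0; rewrite -Ex_indic.
      by congr Ex; apply/funext => w; rewrite indicI/=; congr (_ * _).
    by apply: measurableI => //; rewrite -[X in measurable X]setTI; exact: mX.
  rewrite !XB//; have mXB D0 : measurable D0 -> measurable (X @^-1` B `&` D0).
    by move=> ?; apply: measurableI => //; rewrite -[X in measurable X]setTI; exact: mX.
  apply/eqP; rewrite subr_eq0; apply/eqP; apply: EFin_inj.
  by rewrite EFinM -!PrE ?XD//; exact: mXB.
Qed.

End Expectation.

(** * Pairing with a density *)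
Section DensityPairing.
Context (R : realType) (d : measure_display) (T : measurableType d).
Variable P : probability T R.
Notation mu := (@lebesgue_measure R).

Lemma density_integrable (X : T -> R) (f : R -> R) :
  measurable_fun setT X -> ac_density (pushforward P X) f ->
  mu.-integrable setT (EFin \o f) /\ \int[mu]_x f x <= 1.
Proof.
move=> mX [mf f0 [Z [mZ Z0 fZ]]].
have mXZ : measurable (X @^-1` (setT `\` Z)).
  by rewrite -[X in measurable X]setTI; apply: mX => //; exact: measurableD.
have fE : (\int[mu]_x (f x)%:E)%E = P (X @^-1` (setT `\` Z)).
  by rewrite -(fZ _ measurableT).
split.
  apply/integrableP; split; first exact/measurable_EFinP.
  under eq_integral do rewrite /= ger0_norm//.
  by rewrite fE (le_lt_trans (probability_le1 _ mXZ))// ltry.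
by rewrite /Rintegral fE -lee_fin -[X in (X <= _)%E]PrE// probability_le1.
Qed.

Lemma density_mul_integrable (f g : R -> R) (A : set R) : measurable A ->
  mu.-integrable setT (EFin \o f) -> bmeas g ->
  mu.-integrable A (EFin \o (fun x => g x * f x)).
Proof.
move=> mA If [mg [K gK]]; apply: (integrableS measurableT) => //.
have := @integrableZl _ _ _ mu setT measurableT K (EFin \o f) If.
apply: le_integrable => //.
  apply/measurable_EFinP; apply: measurable_funM => //.
  by apply/measurable_EFinP; exact: measurable_int If.
move=> x _ /=; rewrite lee_fin !normrM ler_wpM2r//.
by rewrite (le_trans (gK x))// ler_norm.
Qed.

(** Both sides are bounded functionals of [g] that agree on indicators, by the
    definition of the absolutely continuous part. *)
Lemma density_pairing (X : T -> R) (f : R -> R) :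
  measurable_fun setT X -> ac_density (pushforward P X) f ->
  exists Z : set R, [/\ measurable Z, mu Z = 0%E &
    forall g : R -> R, bmeas g ->
      \int[mu]_x (g x * f x) = Ex P (fun w => g (X w) * \1_(X @^-1` ~` Z) w)].
Proof.
move=> mX Xf; have [If If1] := density_integrable mX Xf.
have [mf f0 [Z [mZ Z0 fZ]]] := Xf.
exists Z; split => // g bg.
have mXZ : measurable (X @^-1` ~` Z).
  by rewrite -[X in measurable X]setTI; apply: mX => //; exact: measurableC.
have Igf h : bmeas h -> mu.-integrable setT (EFin \o (fun x => h x * f x)).
  by move=> bh; exact: density_mul_integrable.
have bfX (h : R -> R) : bmeas h -> bmeas (fun w => h (X w) * \1_(X @^-1` ~` Z) w : R).
  by move=> bh; apply: bmeasM; [exact: bmeas_comp|exact: bmeas_indic].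
pose J (g : R -> R) := \int[mu]_x (g x * f x) -
  Ex P (fun w => g (X w) * \1_(X @^-1` ~` Z) w).
apply/eqP; rewrite -subr_eq0; apply/eqP; rewrite -[LHS]/(J g).
apply: (@bounded_functional_eq0 _ _ _ J 2) => //.
- move=> f1 f2 b1 b2; rewrite /J.
  under eq_Rintegral do rewrite mulrDl.
  under [X in _ - Ex _ X]eq_fun do rewrite mulrDl.
  rewrite RintegralD//; try exact: Igf.
  rewrite ExD; try exact: bfX; ring.
- move=> l h bh; rewrite /J.
  under eq_Rintegral do rewrite -mulrA.
  under [X in _ - Ex _ X]eq_fun do rewrite -mulrA.
  rewrite ExZ ?RintegralZl//; try exact: Igf; try exact: bfX; ring.
- move=> h K bh hK; rewrite /J (le_trans (ler_normB _ _))//.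
  have K0 : 0 <= K by rewrite (le_trans _ (hK 0)).
  rewrite mulr_natl mulr2n lerD//.
    apply: (le_trans (le_normr_Rintegral _ _)) => //; first exact: Igf.
    apply: (@le_trans _ _ (\int[mu]_x (K * f x))).
      apply: le_Rintegral => //.
      - by apply: integrable_norm; exact: Igf.
      - by have := Igf _ (bmeas_cst _ K).
      - by move=> x _; rewrite normrM (ger0_norm (f0 x)) ler_wpM2r.
    by rewrite RintegralZl// ler_piMr.
  apply: normr_Ex_cst; first exact: bfX.
  by move=> w; rewrite normrM indicE -[leRHS]mulr1 ler_pM//; case: (_ \in _);
      rewrite ?normr0 ?normr1.
- move=> B mB; rewrite /J; apply/eqP; rewrite subr_eq0; apply/eqP.
  have mXBZ : measurable (X @^-1` (B `\` Z)).
    by rewrite -[X in measurable X]setTI; apply: mX => //; exact: measurableD.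
  transitivity (Pr P (X @^-1` (B `\` Z))).
    rewrite /Pr -[P _]/(pushforward P X (B `\` Z)) fZ// /Rintegral.
    rewrite [in RHS]integral_mkcond; congr fine; apply: eq_integral => x _.
    by rewrite patchE indicE; case: ifPn => _; rewrite ?mul1r ?mul0r.
  rewrite -Ex_indic//; congr Ex; apply/funext => w.
  by rewrite preimage_setI indicI.
Qed.

End DensityPairing.
(** * Derivatives of real functions *)

(** A first-order expansion of forward increments that is uniform in a
    neighbourhood of [x] also gives the left derivative: the coefficients of the
    expansion at [s < x] are close to those at [x].  The term [I s t] stands for
    the integral over (s, t] of a function with value [l] at [x]. *)
Lemma is_derive_of_increments (R : realType) (F A B : R -> R) (I : R -> R -> R) (x r K l : R) :
  0 < r -> 0 <= K ->
  (forall s t, x - r <= s -> s <= t -> t <= x + r ->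
    [/\ `|F t - F s - (t - s) * A s - I s t * B s| <= K * (t - s) ^+ 2,
        `|A t - A s| <= K * (t - s), `|B t - B s| <= K * (t - s) &
        `|I s t| <= K * (t - s)]) ->
  `|B x| <= K ->
  (forall e, 0 < e -> exists2 r', 0 < r' & forall s t,
    x - r' <= s -> s <= t -> t <= x + r' -> `|I s t - l * (t - s)| <= e * (t - s)) ->
  is_derive x 1 F (A x + l * B x).
Proof.
move=> r0 K0 FAB BK Il.
suff H : h^-1 *: ((F \o shift x) (h *: 1) - F x) @[h --> 0^'] --> A x + l * B x.
  by apply: DeriveDef; [apply/cvg_ex; eexists; exact: H|exact/cvg_lim].
apply/cvgrPdist_le => e e0.
(* The difference quotient is within C |h| + K e1 of the derivative. *)
pose e1 := e / (2 * (K + 1)); pose C := 2 * K + K * K + 1.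
have C0 : 0 < C by rewrite /C ltr_wpDl// addr_ge0// mulr_ge0.
have e10 : 0 < e1 by rewrite divr_gt0// mulr_gt0// ltr_wpDl.
have [r' r'0 Ir'] := Il _ e10.
near=> h.
have hn0 : h != 0 by near: h; exact: nbhs_dnbhs_neq.
have hr : `|h| <= r by near: h; apply: dnbhs0_le.
have hr' : `|h| <= r' by near: h; apply: dnbhs0_le.
have hC : `|h| <= e / (2 * C) by near: h; apply: dnbhs0_le; rewrite divr_gt0// mulr_gt0.
have hn : 0 < `|h| by rewrite normr_gt0.
suff H : `|F (x + h) - F x - h * (A x + l * B x)| <= `|h| * (C * `|h| + K * e1).
  rewrite /= scaler1 (addrC h) -normrN opprB.
  have -> : h^-1 *: (F (x + h) - F x) - (A x + l * B x) =
      h^-1 * (F (x + h) - F x - h * (A x + l * B x)).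
    by rewrite mulrBr mulKf.
  rewrite normrM normfV ler_pdivrMl//; apply: le_trans H _.
  rewrite ler_wpM2l// (splitr e); apply: lerD.
    rewrite mulrC -ler_pdivlMr//; apply: le_trans hC _.
    by rewrite le_eqVlt invfM mulrA eqxx.
  have K1 : 0 < K + 1 by rewrite ltr_wpDl.
  rewrite (_ : K * e1 = e / 2 * (K / (K + 1))); last first.
    by rewrite /e1; field; rewrite gt_eqF.
  rewrite ler_piMr ?divr_ge0 ?(ltW e0)// ler_pdivrMr// mul1r; lra.
have [h0|h0] := ltP 0 h.
- rewrite (gtr0_norm h0) in hr hr' *.
  have xr : x - r <= x by rewrite gerBl ltW.
  have xr' : x - r' <= x by rewrite gerBl ltW.
  have xh : x <= x + h by rewrite lerDl ltW.
  have hxr : x + h <= x + r by rewrite lerD2l.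
  have hxr' : x + h <= x + r' by rewrite lerD2l.
  have [F1 _ _ _] := FAB x (x + h) xr xh hxr; have := Ir' x (x + h) xr' xh hxr'.
  have E1 : x + h - x = h by ring.
  rewrite E1 in F1 *; set i := I _ _ in F1 * => F2.
  have -> : F (x + h) - F x - h * (A x + l * B x) =
    (F (x + h) - F x - h * A x - i * B x) + (i - l * h) * B x by ring.
  apply: le_trans (ler_normD _ _) _; rewrite normrM mulrDr; apply: lerD.
    apply: le_trans F1 _; rewrite (_ : K * h ^+ 2 = h * (K * h)); last ring.
    rewrite ler_wpM2l ?(ltW h0)// ler_wpM2r ?(ltW h0)// /C.
    by have := mulr_ge0 K0 K0; lra.
  by rewrite (_ : h * (K * e1) = e1 * h * K); [apply: ler_pM|ring].
- have {}h0 : h < 0 by rewrite lt_neqAle hn0.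
  pose k := - h; have k0 : 0 < k by rewrite oppr_gt0.
  have hk : `|h| = k by rewrite ltr0_norm.
  rewrite hk in hr hr' *.
  have xr : x - r <= x - k by rewrite lerD2l lerN2.
  have xr' : x - r' <= x - k by rewrite lerD2l lerN2.
  have xk : x - k <= x by rewrite gerBl ltW.
  have xxr : x <= x + r by rewrite lerDl ltW.
  have xxr' : x <= x + r' by rewrite lerDl ltW.
  have [F1 F2 F3 F4] := FAB (x - k) x xr xk xxr; have := Ir' (x - k) x xr' xk xxr'.
  have -> : x + h = x - k by rewrite opprK.
  have -> : h = - k by rewrite opprK.
  have E1 : x - (x - k) = k by ring.
  rewrite E1 in F1 F2 F3 F4 *; set i := I _ _ in F1 F4 * => F5.
  have -> : F (x - k) - F x - - k * (A x + l * B x) =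
   - ((F x - F (x - k) - k * A (x - k) - i * B (x - k))
    - k * (A x - A (x - k)) - i * (B x - B (x - k)) + (i - l * k) * B x) by ring.
  rewrite normrN.
  have k0' := ltW k0.
  have G1 : `|k * (A x - A (x - k))| <= K * k ^+ 2.
    by rewrite normrM ger0_norm// expr2 mulrCA ler_wpM2l.
  have G2 : `|i * (B x - B (x - k))| <= K * K * k ^+ 2.
    by rewrite normrM (_ : K * K * k ^+ 2 = (K * k) * (K * k)); [apply: ler_pM|ring].
  have G3 : `|(i - l * k) * B x| <= e1 * k * K by rewrite normrM; apply: ler_pM.
  apply: (@le_trans _ _ (K * k ^+ 2 + K * k ^+ 2 + K * K * k ^+ 2 + e1 * k * K)).
    apply: le_trans (ler_normD _ _) _; apply: lerD => //.
    apply: le_trans (ler_normB _ _) _; apply: lerD => //.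
    by apply: le_trans (ler_normB _ _) _; apply: lerD.
  rewrite -subr_ge0 (_ : _ - _ = k ^+ 2); first exact: exprn_ge0.
  by rewrite /C; ring.
Unshelve. all: end_near. Qed.


(** The consequences of bounds on [psi], [psi'] and [psi''] that the forward
    equation uses, with one constant for all of them. *)
Record C2_bounded (R : realType) (K : R) (psi dpsi : R -> R) : Prop := {
  C2_bmeas : bmeas psi ;
  C2_bmeas_deriv : bmeas dpsi ;
  C2_le : bounded_by K psi ;
  C2_deriv_le : bounded_by K dpsi ;
  C2_lipschitz : forall x y, `|psi y - psi x| <= K * `|y - x| ;
  C2_taylor : forall x y,
    `|psi y - psi x - (y - x) * dpsi x| <= K * (y - x) ^+ 2 }.

Lemma expRN_bounds (R : realType) (l : R) : 0 <= l ->
  `|expR (- l) - 1| <= l /\ `|expR (- l) - 1 + l| <= l ^+ 2.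
Proof.
move=> l0; have h1 := expR_ge1Dx (- l).
have h2 : expR (- l) <= 1 by rewrite expR_le1 oppr_le0.
split; first by rewrite ler_norml; apply/andP; split; lra.
rewrite ger0_norm; last lra.
have h3 := expR_ge1Dx l.
have : expR (- l) * (1 + l) <= 1.
  rewrite -[leRHS](expRxMexpNx_1 l) mulrC ler_wpM2r//; exact: expR_ge0.
have : 0 <= l * (expR (- l) - (1 - l)) by rewrite mulr_ge0//; lra.
have : 0 <= l * (1 - expR (- l)) by rewrite mulr_ge0//; lra.
lra.
Qed.


Section CompactSupport.
Context (R : realType).
Implicit Types (f g : R -> R) (K : set R) (x y z : R).

Lemma mean_value_step f x y : (forall z, derivable f z 1) ->
  exists2 z, `|z - x| <= `|y - x| & f y - f x = (y - x) * derive1 f z.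
Proof.
move=> df; have cf : continuous f.
  by move=> z; apply: differentiable_continuous; exact/derivable1_diffP.
have isf z : is_derive z 1 f (derive1 f z).
  by rewrite derive1E; exact/derivableP.
have [xy|yx] := leP x y.
- have [|z zxy E] := @MVT_segment _ f (derive1 f) _ _ xy (fun z _ => isf z).
    exact: continuous_subspaceT.
  exists z; last by rewrite E mulrC.
  move: zxy; rewrite in_itv/= => /andP[? ?].
  by rewrite !ger0_norm; lra.
- have [|z zxy E] := @MVT_segment _ f (derive1 f) _ _ (ltW yx) (fun z _ => isf z).
    exact: continuous_subspaceT.
  exists z; last by rewrite -opprB E -mulrN opprB mulrC.
  move: zxy; rewrite in_itv/= => /andP[? ?].
  by rewrite !ler0_norm; lra.
Qed.

Lemma derive1_eq0 f (O : set R) x : open O -> (forall y, O y -> f y = 0) -> O x ->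
  derive1 f x = 0.
Proof.
move=> oO f0 Ox; rewrite derive1E.
rewrite (@near_eq_derive _ _ _ f (cst 0) x 1); first exact: derive_cst.
by near=> y; rewrite f0//; near: y; exact: open_nbhs_nbhs.
Unshelve. all: end_near. Qed.

Lemma compact_support_bounded f K : continuous f -> compact K ->
  (forall x, ~ K x -> f x = 0) -> exists C, bounded_by C f.
Proof.
move=> cf cK f0.
have /compact_bounded[M [_ MK]] : compact (f @` K).
  by apply: continuous_compact => //; exact: continuous_subspaceT.
exists (`|M| + 1) => x; have [Kx|/f0 ->] := pselect (K x).
  apply: (MK (`|M| + 1)); last by exists x.
  by rewrite (le_lt_trans (ler_norm M))// ltrDl.
by rewrite normr0 addr_ge0.
Qed.

Lemma C2_bounded_compact f K : compact K -> (forall x, ~ K x -> f x = 0) ->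
  (forall n x, (n < 3)%N -> derivable (derive1n n f) x 1) ->
  exists C, C2_bounded C f (derive1 f).
Proof.
move=> cK f0 df.
have oK : open (~` K) by apply: closed_openC; exact: compact_closed.
have d0 x : derivable f x 1 := df 0%N x isT.
have d1 x : derivable (derive1 f) x 1 := df 1%N x isT.
have d2 x : derivable (derive1 (derive1 f)) x 1 := df 2%N x isT.
have cont g : (forall x, derivable g x 1) -> continuous g.
  by move=> dg z; apply: differentiable_continuous; exact/derivable1_diffP.
have f1 x : ~ K x -> derive1 f x = 0 by move=> Kx; exact: derive1_eq0 oK f0 Kx.
have f2 x : ~ K x -> derive1 (derive1 f) x = 0 by move=> Kx; exact: derive1_eq0 oK f1 Kx.
have [C0 b0] := compact_support_bounded (cont _ d0) cK f0.
have [C1 b1] := compact_support_bounded (cont _ d1) cK f1.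
have [C2 b2] := compact_support_bounded (cont _ d2) cK f2.
pose C := Num.max C0 (Num.max C1 C2).
have C0C : C0 <= C by rewrite le_max lexx.
have C1C : C1 <= C by rewrite !le_max lexx orbT.
have C2C : C2 <= C by rewrite !le_max lexx !orbT.
have m g : (forall x, derivable g x 1) -> measurable_fun setT g.
  by move=> dg; apply: continuous_measurable_fun; exact: cont.
exists C; split.
- by split; [exact: (m _ d0)|exists C0].
- by split; [exact: (m _ d1)|exists C1].
- by move=> x; exact: (le_trans (b0 x) C0C).
- by move=> x; exact: (le_trans (b1 x) C1C).
- move=> x y; have [z _ ->] := mean_value_step x y d0.
  by rewrite normrM mulrC ler_wpM2r// (le_trans (b1 z)).
- move=> x y; have [z zx ->] := mean_value_step x y d0.
  rewrite -mulrBr normrM; have [z' _ ->] := mean_value_step x z d1.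
  rewrite normrM -real_normK ?num_real// (_ : C * _ = `|y - x| * (`|y - x| * C)); last ring.
  rewrite ler_wpM2l// ler_pM//; exact: (le_trans (b2 z') C2C).
Qed.

End CompactSupport.

(** Lets a function known to agree with [g] on an open set only be
    differentiated there, so that the derivatives of a pairing can be computed
    one after the other. *)
Lemma derive_agree (R : realType) (U : set R) (f g dg : R -> R) : open U ->
  (forall s, U s -> f s = g s) -> (forall s, U s -> is_derive s 1 g (dg s)) ->
  forall s, U s -> derivable f s 1 /\ derive1 f s = dg s.
Proof.
move=> oU fg gdg s Us; have [dgs Eg] := gdg s Us.
have near_fg : {near s, g =1 f}.
  by near=> y; rewrite fg//; near: y; exact: open_nbhs_nbhs.
split; first exact: (near_eq_derivable near_fg dgs).
by rewrite derive1E -Eg; exact/esym/near_eq_derive.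
Unshelve. all: end_near. Qed.

Lemma derivable_lt3 (R : realType) (u : R -> R) (t : R) :
  derivable u t 1 -> derivable (derive1 u) t 1 -> derivable (derive1n 2 u) t 1 ->
  forall n, (n < 3)%N -> derivable (derive1n n u) t 1.
Proof.
move=> d0 d1 d2 [_|[_|[_|n n3]]].
- exact d0.
- exact d1.
- exact d2.
- by case: (notF n3).
Qed.

(** * Piecewise constant velocity paths *)
Section Path.
Context (R : realType).
Notation mu := (@lebesgue_measure R).
Implicit Types (c s t : R) (J : set R) (v : R -> R).

(** The points of [J] may accumulate at 0, where the path may have no limit:
    local finiteness is required away from 0 only. *)
Record jump_path (c : R) (J : set R) (v : R -> R) : Prop := {
  jump_finite : forall s t, 0 < s -> s <= t -> finite_set (J `&` `]s, t]) ;
  path_bounded : forall t, 0 <= t -> `|v t| <= c ;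
  path_constant : forall s t, 0 <= s -> s <= t -> J `&` `]s, t] = set0 ->
    v t = v s }.

Lemma finite_right_gap (A : set R) s : finite_set A -> ~ A s ->
  exists2 e, 0 < e & A `&` `]s, s + e] = set0.
Proof.
move=> finA nAs.
have cA : closed A by exact: (accessible_finite_set_closed.1 (@hausdorff_accessible _ (@Rhausdorff R))).
have : nbhs s (~` A) by apply: open_nbhs_nbhs; split => //; exact: closed_openC.
move=> /nbhs_ballP[e /= e0 sA]; exists (e / 2); first by rewrite divr_gt0.
rewrite -subset0 => x [Ax]; rewrite /= in_itv/= => /andP[sx xe].
apply: (sA x) => //=; rewrite /ball/= ltr0_norm; last lra.
by lra.
Qed.

(** The value of the path at the right end of each of the [n.+1] cells of
    [[0, t]].  The right ends are used because the path is continuous from the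
    right, and because they depend on the past of [t] only. *)
Definition right_step (v : R -> R) (t : R) (n : nat) (s : R) : R :=
  \sum_(k < n.+1) v (t * k.+1%:R / n.+1%:R)
     * \1_(`[t * k%:R / n.+1%:R, t * k.+1%:R / n.+1%:R[) s.

Lemma right_stepE v t n s (k : nat) : 0 < t -> (k < n.+1)%N ->
  t * k%:R / n.+1%:R <= s < t * k.+1%:R / n.+1%:R ->
  right_step v t n s = v (t * k.+1%:R / n.+1%:R).
Proof.
move=> t0 kn /andP[s1 s2]; rewrite /right_step (bigD1 (Ordinal kn))//=.
rewrite indicE mem_set ?mulr1/=; last by rewrite in_itv/= s1 s2.
rewrite big1 ?addr0// => i ik.
rewrite indicE memNset ?mulr0//= in_itv/= => /andP[s3 s4].
have n0 : 0 < n.+1%:R :> R by [].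
rewrite !ler_pdivrMr// in s1 s3; rewrite !ltr_pdivlMr// in s2 s4.
have := le_lt_trans s1 s4; have := le_lt_trans s3 s2.
rewrite !ltr_pM2l// !ltr_nat !ltnS => ? ?; move/eqP : ik; apply.
by apply/val_inj/eqP; rewrite eqn_leq/=; apply/andP.
Qed.

Lemma right_step_cell t n s : 0 < s < t ->
  exists2 k : nat, (k < n.+1)%N & t * k%:R / n.+1%:R <= s < t * k.+1%:R / n.+1%:R.
Proof.
move=> /andP[s0 st]; have t0 : 0 < t by lra.
have n0 : 0 < n.+1%:R :> R by [].
exists (Num.truncn (s * n.+1%:R / t)).
  rewrite truncn_lt_nat; last by rewrite !mulr_ge0// ?invr_ge0 ltW.
  by rewrite ltr_pdivrMr// mulrC ltr_pM2l.
have y0 : 0 <= s * n.+1%:R / t by rewrite divr_ge0 ?mulr_ge0// ltW.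
have /andP[h1 h2] := truncn_itv y0.
rewrite ler_pdivlMr// in h1; rewrite ltr_pdivrMr// in h2.
by rewrite ler_pdivrMr// ltr_pdivlMr// ![t * _]mulrC h1.
Qed.

Lemma right_step_bounded v c t n s : 0 < s < t ->
  (forall r, 0 <= r -> `|v r| <= c) -> `|right_step v t n s| <= c.
Proof.
move=> /[dup] st /(right_step_cell n)[k kn /[dup] sk].
have t0 : 0 < t by lra.
move/(right_stepE v t0 kn) => -> vc; apply: vc.
by rewrite divr_ge0// mulr_ge0// ltW.
Qed.

Lemma measurable_right_step v t n : measurable_fun setT (right_step v t n).
Proof.
apply: measurable_sum => k; apply: measurable_funM => //.
Qed.

Lemma right_step_cvg c J v t s : jump_path c J v -> 0 < s < t ->
  right_step v t ^~ s @ \oo --> v s.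
Proof.
move=> [Jf vc vJ] st; have [s0 t0] : 0 < s /\ 0 < t by lra.
have [e e0 se] : exists2 e, 0 < e & J `&` `]s, s + e] = set0.
  have [||e1 e10 h] := @finite_right_gap (J `&` `]s, s + 1]) s.
  - by apply: Jf => //; lra.
  - by move=> [_]; rewrite /= in_itv/= ltxx.
  exists (Num.min e1 1); first by rewrite lt_min e10/=.
  rewrite -subset0 => x [Jx]; rewrite /= in_itv/= => /andP[sx xe].
  suff : set0 x by [].
  rewrite -h; have [? ?] : x <= s + e1 /\ x <= s + 1.
    by split; rewrite (le_trans xe)// lerD2l ge_min lexx ?orbT.
  by split; [split => //|]; rewrite /= in_itv/= sx.
apply: cvg_near_cst; near=> n.
have n0 : 0 < n.+1%:R :> R by [].
have [k kn /[dup] sk /(right_stepE v t0 kn) ->] := right_step_cell n st.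
have [h1 h2] := andP sk.
apply: vJ; [by lra|exact: ltW|].
rewrite -subset0 -se; apply: setIS => x; rewrite /= !in_itv/= => /andP[-> xk]/=.
rewrite (le_trans xk)// -natr1 mulrDr mulrDl lerD// mulr1 ler_pdivrMr//.
rewrite mulrC -ler_pdivrMr//.
near: n; exists (Num.truncn (t / e)).+1 => // m /= mn.
rewrite (le_trans (ltW (truncnS_gt _)))// ler_nat; exact: leqW.
Unshelve. all: end_near. Qed.

Lemma measurable_jump_path c J v t : jump_path c J v ->
  measurable_fun `]0, t[ v.
Proof.
move=> Jv; apply: (@measurable_fun_cvg _ _ _ _ (right_step v t)).
  by move=> n; apply: measurable_funTS; exact: measurable_right_step.
by move=> s /=; rewrite in_itv/= => st; exact: right_step_cvg Jv st.
Qed.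

Lemma bounded_itv_integrable (f : R -> R) (K a b : R) :
  measurable_fun `]a, b[ f -> (forall x, a < x < b -> `|f x| <= K) ->
  mu.-integrable `[a, b] (EFin \o f).
Proof.
move=> mf fK.
have mf' : measurable_fun `[a, b] f by apply: measurable_fun_itv_cc mf.
have [ab|ba] := ltP a b; last first.
  apply: (@integrableS _ _ _ mu [set a]) => //.
  - move=> x /=; rewrite in_itv/= => /andP[? ?].
    by apply/eqP; rewrite eq_le; apply/andP; split; lra.
  - apply: measurable_bounded_integrable => //.
    + by rewrite [X in (X < _)%E](_ : _ = 0%E) ?ltry//; exact: lebesgue_measure_set1.
    + exact: measurable_fun_set1.
    + exists `|f a|; split; rewrite ?num_real// => M aM x /= ->; exact: ltW.
apply: measurable_bounded_integrable => //.
  have := lebesgue_measure_itv `[a, b]%R; rewrite /= lte_fin ab -EFinB => mab.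
  by rewrite [X in (X < _)%E](_ : _ = (b - a)%:E) ?ltry.
exists (Num.max K (Num.max `|f a| `|f b|)); split; rewrite ?num_real//.
move=> M; rewrite !gt_max => /and3P[KM aM bM] x /=; rewrite in_itv/= => /andP[].
rewrite le_eqVlt => /predU1P[<- _|ax]; first exact: ltW.
rewrite le_eqVlt => /predU1P[->|xb]; first exact: ltW.
by rewrite (le_trans (fK _ _)) ?ax// ltW.
Qed.

Lemma jump_path_integrable c J v t : jump_path c J v ->
  mu.-integrable `[0, t] (EFin \o v).
Proof.
move=> Jv; apply: (@bounded_itv_integrable _ c).
  exact: measurable_jump_path Jv.
by move=> x /andP[x0 _]; apply: path_bounded Jv _ _; exact: ltW.
Qed.

(** The position is a limit of linear combinations of finitely many velocities
    before time [t], hence measurable with respect to them. *)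
Lemma path_integral_cvg c J v t : 0 <= t -> jump_path c J v ->
  (fun n : nat => \sum_(k < n.+1) v (t * k.+1%:R / n.+1%:R) *
     \int[mu]_(s in `]0, t[)
        \1_(`[t * k%:R / n.+1%:R, t * k.+1%:R / n.+1%:R[) s) @ \oo -->
  \int[mu]_(s in `[0, t]) v s.
Proof.
move=> t0 Jv.
have Iv := jump_path_integrable t Jv.
have Ioo : mu.-integrable `]0, t[ (EFin \o v).
  by apply: integrableS Iv => //; exact: subset_itv_oo_cc.
have -> : \int[mu]_(s in `[0, t]) v s = \int[mu]_(s in `]0, t[) v s.
  rewrite -Rintegral_itv_bndo_bndc; last first.
    by apply: integrableS Iv => //; exact: subset_itv_co_cc.
  by rewrite -Rintegral_itv_obnd_cbnd.
have If m a b : mu.-integrable `]0, t[ (EFin \o (fun s => v m * \1_(`[a, b[) s)).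
  have h : mu.-integrable `[0, t] (EFin \o (fun s => v m * \1_(`[a, b[) s)).
    apply: (@bounded_itv_integrable _ `|v m|).
      by apply: measurable_funTS; apply: measurable_funM => //; exact: measurable_indic.
    by move=> x _; rewrite normrM indicE; case: (_ \in _);
      rewrite ?normr0 ?normr1 ?mulr1 ?mulr0.
  by apply: integrableS h => //; exact: subset_itv_oo_cc.
rewrite (_ : (fun n : nat => _) = (fun n => \int[mu]_(s in `]0, t[) right_step v t n s)).
  apply: fine_cvg.
  have moo : measurable `]0, t[%classic by [].
  rewrite fineK; last first.
    by rewrite integrable_fin_num.
  apply: (@dominated_cvg _ _ _ mu `]0, t[ moo
     (fun n s => (right_step v t n s)%:E) _ (cst c%:E)) => //.
  - move=> n; apply/measurable_EFinP; apply: measurable_funTS.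
    exact: measurable_right_step.
  - move=> s /=; rewrite in_itv/= => st.
    by apply: cvg_EFin; [exact: nearW|exact: right_step_cvg Jv st].
  - apply: integrableS (_ : mu.-integrable `[0, t] _) => //.
      exact: subset_itv_oo_cc.
    by apply: (@bounded_itv_integrable (cst c) `|c|).
  - move=> n s /=; rewrite in_itv/= lee_fin => st.
    by apply: right_step_bounded => //; exact: path_bounded Jv.
apply/funext => n; rewrite /right_step.
have H m : \int[mu]_(s in `]0, t[) (\sum_(k < m) v (t * k.+1%:R / n.+1%:R) *
   \1_(`[(t * k%:R / n.+1%:R), (t * k.+1%:R / n.+1%:R)[) s) =
   \sum_(k < m) v (t * k.+1%:R / n.+1%:R) *
     \int[mu]_(s in `]0, t[)
        \1_(`[t * k%:R / n.+1%:R, t * k.+1%:R / n.+1%:R[) s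
   /\ mu.-integrable `]0, t[ (EFin \o (fun s => \sum_(k < m) v (t * k.+1%:R / n.+1%:R) *
   \1_(`[(t * k%:R / n.+1%:R), (t * k.+1%:R / n.+1%:R)[) s)).
  elim: m => [|m [ih1 ih2]].
    split; first by under eq_Rintegral do rewrite big_ord0; rewrite big_ord0 Rintegral_cst// mul0r.
    by under [X in EFin \o X]eq_fun do rewrite big_ord0; exact: integrable0.
  split.
    under eq_Rintegral do rewrite big_ord_recr/=.
    rewrite RintegralD// ih1 big_ord_recr/=; congr (_ + _).
    rewrite RintegralZl//.
    have h : mu.-integrable `[0, t] (EFin \o (\1_(`[(t * m%:R / n.+1%:R), (t * m.+1%:R / n.+1%:R)[))).
      apply: (@bounded_itv_integrable _ 1).
        by apply: measurable_funTS; exact: measurable_indic.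
      by move=> x _; rewrite indicE; case: (_ \in _); rewrite ?normr0 ?normr1.
    by apply: integrableS h => //; exact: subset_itv_oo_cc.
  under [X in EFin \o X]eq_fun do rewrite big_ord_recr/=.
  under [X in _.-integrable _ X]eq_fun do rewrite /= EFinD.
  apply: (integrableD (mu := mu) _ ih2) => //; exact: If.
by case: (H n.+1).
Qed.

Lemma fine_lebesgue_measure_oc s t : s <= t -> fine (mu `]s, t]) = t - s.
Proof.
have := lebesgue_measure_itv `]s, t]%R; rewrite /= lte_fin => + st.
move=> /(congr1 fine)/= ->; case: ltP => //= ts.
by rewrite (_ : t = s) ?subrr//; lra.
Qed.

Section Increments.
Variables (c : R) (J : set R) (v : R -> R).
Hypothesis Jv : jump_path c J v.
Let X t := \int[mu]_(s in `[0, t]) v s.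

Let itv_integrable s t : 0 <= s -> mu.-integrable `]s, t] (EFin \o v).
Proof.
move=> s0; apply: integrableS (jump_path_integrable t Jv) => //.
by apply: subset_itv; rewrite bnd_simp.
Qed.

Lemma path_incrementE s t : 0 <= s -> s <= t ->
  X t - X s = \int[mu]_(r in `]s, t]) v r.
Proof.
move=> s0 st; rewrite /X Rintegral_itvB//; exact: jump_path_integrable Jv.
Qed.

Lemma path_increment_le s t : 0 <= s -> s <= t -> `|X t - X s| <= c * (t - s).
Proof.
move=> s0 st; rewrite path_incrementE//.
have Ic : mu.-integrable `]s, t] (EFin \o cst c).
  apply: (@integrableS _ _ _ mu `[s, t]) => //; first exact: subset_itv_oc_cc.
  by apply: (@bounded_itv_integrable (cst c) `|c|).
apply: (le_trans (le_normr_Rintegral _ _)) => //; first exact: itv_integrable.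
apply: (@le_trans _ _ (\int[mu]_(r in `]s, t]) c)).
  apply: le_Rintegral => //.
    by apply: integrable_norm; exact: itv_integrable.
  move=> r /=; rewrite in_itv/= => /andP[sr _]; apply: path_bounded Jv _ _; lra.
by rewrite Rintegral_cst// [fine _](fine_lebesgue_measure_oc st).
Qed.

Lemma path_increment_constant s t : 0 <= s -> s <= t -> J `&` `]s, t] = set0 ->
  X t = X s + v s * (t - s).
Proof.
move=> s0 st J0; suff H : X t - X s = v s * (t - s) by rewrite -H addrC subrK.
rewrite path_incrementE//.
rewrite (@eq_Rintegral _ _ _ _ _ (cst (v s))); last first.
  move=> r; rewrite inE/= in_itv/= => /andP[sr rt]; apply: path_constant Jv _ _ _ _ _ => //.
    exact: ltW.
  rewrite -subset0 -J0; apply: setIS => x; rewrite /= !in_itv/= => /andP[-> xr]/=.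
  exact: le_trans rt.
by rewrite Rintegral_cst// [fine _](fine_lebesgue_measure_oc st).
Qed.

End Increments.
End Path.

Lemma measurable_path_integral (R : realType) d (T : measurableType d) (c : R)
    (J : T -> set R) (V : R -> T -> R) (t : R) :
  0 <= t -> (forall w, jump_path c (J w) (V ^~ w)) ->
  (forall r, 0 <= r <= t -> measurable_fun setT (V r)) ->
  measurable_fun setT (fun w => \int[lebesgue_measure]_(s in `[0, t]) V s w).
Proof.
move=> t0 JV mV; apply: (@measurable_fun_cvg _ _ _ _
  (fun n w => \sum_(k < n.+1) V (t * k.+1%:R / n.+1%:R) w *
     \int[lebesgue_measure]_(s in `]0, t[)
        \1_(`[t * k%:R / n.+1%:R, t * k.+1%:R / n.+1%:R[) s)).
  move=> n; apply: measurable_sum => k; apply: measurable_funM => //.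
  apply: mV; rewrite divr_ge0 ?mulr_ge0//= ler_pdivrMr// ler_wpM2l// ler_nat.
  exact: ltn_ord.
by move=> w _; exact: path_integral_cvg (JV w).
Qed.

(** * Compactly supported weights of finite smoothness *)

Section Bump.
Context (R : realType).
Implicit Types (f g : R -> R) (x y : R) (k : nat).

Fixpoint derivable_upto k f : Prop :=
  if k is k'.+1 then (forall x, derivable f x 1) /\ derivable_upto k' (derive1 f)
  else True.

Lemma derivable_uptoW k f : derivable_upto k.+1 f -> derivable_upto k f.
Proof.
elim: k f => [//|k ih] f [df kf]; split; first exact df.
exact: ih.
Qed.

Lemma derivable_upto_derive1n k f n x : derivable_upto k f -> (n < k)%N ->
  derivable (derive1n n f) x 1.
Proof.
elim: k f n => [f n _|k ih f [|n] [df kf] nk]; first by rewrite ltn0.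
- exact (df x).
- by rewrite derive1Sn; exact: ih kf nk.
Qed.

Lemma derivable_uptoD k f g : derivable_upto k f -> derivable_upto k g ->
  derivable_upto k (fun x => f x + g x).
Proof.
elim: k f g => [//|k ih] f g [df kf] [dg kg]; split.
  by move=> x; exact: derivableD.
rewrite (_ : derive1 _ = fun x => derive1 f x + derive1 g x); first exact: ih.
by apply/funext => x; rewrite !derive1E deriveD.
Qed.

Lemma derivable_uptoM k f g : derivable_upto k f -> derivable_upto k g ->
  derivable_upto k (fun x => f x * g x).
Proof.
elim: k f g => [//|k ih] f g /[dup] kf1 [df kf] /[dup] kg1 [dg kg]; split.
  by move=> x; exact: derivableM.
rewrite (_ : derive1 _ = fun x => f x * derive1 g x + g x * derive1 f x).
  by apply: derivable_uptoD; apply: ih => //; exact: derivable_uptoW.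
by apply/funext => x; rewrite !derive1E deriveM.
Qed.

Definition pospow k x : R := Num.max 0 x ^+ k.

Lemma pospow_derive k x : is_derive x 1 (pospow k.+2) (k.+2%:R * pospow k.+1 x).
Proof.
have Dx y : is_derive y 1 (fun z : R => z ^+ k.+2) (k.+2%:R * y ^+ k.+1).
  apply: DeriveDef; first exact: exprn_derivable.
  by rewrite exp_derive scaler1.
have [x0|x0|->] := ltgtP x 0.
- have nx : {near x, (cst 0 : R -> R) =1 pospow k.+2}.
    near=> y; rewrite /pospow max_l ?expr0n//; apply/ltW.
    by near: y; exact: lt_nbhsl.
  have D0 := is_derive_cst (0 : R) x 1.
  rewrite /pospow max_l ?(ltW x0)// expr0n/= mulr0.
  apply: DeriveDef; first exact: (near_eq_derivable nx (@ex_derive _ _ _ _ _ _ _ D0)).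
  by rewrite -(near_eq_derive _ nx) derive_val.
- have nx : {near x, (fun z : R => z ^+ k.+2) =1 pospow k.+2}.
    near=> y; rewrite /pospow max_r//; apply/ltW.
    by near: y; exact: (@cvgr_gt R R (nbhs x) _ id x cvg_id 0 x0).
  have D0 := Dx x.
  rewrite /pospow max_r ?(ltW x0)//.
  apply: DeriveDef; first exact: (near_eq_derivable nx (@ex_derive _ _ _ _ _ _ _ D0)).
  by rewrite -(near_eq_derive _ nx) derive_val.
- rewrite {2}/pospow maxxx expr0n/= mulr0.
  suff H : h^-1 *: ((pospow k.+2 \o shift 0) (h *: 1) - pospow k.+2 0) @[h --> 0^'] --> (0 : R).
    by apply: DeriveDef; [apply/cvg_ex; eexists; exact: H|exact/cvg_lim].
  apply/cvgrPdist_le => e e0; near=> h.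
  have hn0 : h != 0 by near: h; exact: nbhs_dnbhs_neq.
  have he : `|h| <= e by near: h; apply: dnbhs0_le.
  have h1 : `|h| <= 1 by near: h; apply: dnbhs0_le.
  rewrite /= /pospow maxxx expr0n/= subr0 sub0r normrN addr0 scaler1.
  rewrite [_ *: _]/(_ * _) normrM normfV normrX.
  have hp : `|Num.max 0 h| <= `|h| by rewrite /Num.max; case: ifPn => _; rewrite ?normr0.
  rewrite ler_pdivrMl ?normr_gt0//; apply: (@le_trans _ _ (`|h| ^+ k.+2)).
    by rewrite lerXn2r.
  rewrite exprS ler_wpM2l// exprS (le_trans _ he)// ler_piMr//.
  exact: exprn_ile1.
Unshelve. all: end_near. Qed.

Lemma derivable_upto_cst k (C : R) : derivable_upto k (fun=> C).
Proof.
elim: k C => [//|k ih] C; split; first by move=> x; exact: derivable_cst.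
rewrite (_ : derive1 _ = fun=> 0); first exact: ih.
by apply/funext => x; rewrite derive1_cst.
Qed.

Lemma derivable_upto_pospow k (a b : R) :
  derivable_upto k (fun x => pospow k.+1 (a * x + b)).
Proof.
elim: k => [//|k ih].
have D x : is_derive x 1 (fun x => pospow k.+2 (a * x + b))
    (k.+2%:R * pospow k.+1 (a * x + b) * a).
  have Da : is_derive x 1 (fun y : R => a * y + b) a.
    by apply: is_derive_eq; rewrite addr0 scaler1.
  exact: (@is_derive1_comp _ (pospow k.+2) (fun y : R => a * y + b) x _ _
    (pospow_derive k _) Da).
split; first by move=> x; exact: (@ex_derive _ _ _ _ _ _ _ (D x)).
rewrite (_ : derive1 _ = fun x => (a * k.+2%:R) * pospow k.+1 (a * x + b)).
  by apply: derivable_uptoM; [exact: derivable_upto_cst|exact: ih].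
apply/funext => x; rewrite derive1E (@derive_val _ _ _ _ _ _ _ (D x)); ring.
Qed.

(** The weak equation is proved for six times derivable functions, so that a
    piecewise polynomial of class C^6 can serve as a bump. *)
Definition spline_bump (a b : R) x : R := pospow 7 (x - a) * pospow 7 (b - x).

Lemma bump_derivable_upto a b : derivable_upto 6 (spline_bump a b).
Proof.
have E1 : (fun x => pospow 7 (x - a)) = fun x => pospow 7 (1 * x + - a).
  by apply/funext => x; rewrite mul1r.
have E2 : (fun x => pospow 7 (b - x)) = fun x => pospow 7 (-1 * x + b).
  by apply/funext => x; rewrite mulN1r addrC.
apply: derivable_uptoM; rewrite ?E1 ?E2; exact: derivable_upto_pospow.
Qed.

Lemma bump_ge0 a b x : 0 <= spline_bump a b x.
Proof. by rewrite mulr_ge0// exprn_ge0// le_max lexx. Qed.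

Lemma bump_eq0 a b x : ~ (`[a, b]%classic x) -> spline_bump a b x = 0.
Proof.
rewrite /= in_itv/= => /negP; rewrite negb_and -!ltNge /spline_bump /pospow => /orP[h|h].
- by rewrite max_l ?expr0n ?mul0r// subr_le0 ltW.
- by rewrite [X in _ * X ^+ _]max_l ?expr0n ?mulr0// subr_le0 ltW.
Qed.

Lemma bump_lower a b (w : R) x : 0 <= w -> a + w <= x <= b - w ->
  w ^+ 14 <= spline_bump a b x.
Proof.
move=> w0 /andP[ax xb]; rewrite (_ : w ^+ 14 = w ^+ 7 * w ^+ 7); last by rewrite -exprD.
rewrite /spline_bump /pospow !max_r; try lra.
have [h1 h2] : w <= x - a /\ w <= b - x by split; lra.
have w7 : 0 <= w ^+ 7 by exact: exprn_ge0.
have mono y : w <= y -> w ^+ 7 <= y ^+ 7.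
  by move=> wy; rewrite lerXn2r// nnegrE; lra.
by move: (mono _ h1) (mono _ h2) w7; move: (w ^+ 7) => u u1 u2 u0; exact: ler_pM.
Qed.

End Bump.

(** * Integrals depending on a parameter over a segment *)

Section Segment.
Context (R : realType).
Notation mu := (@lebesgue_measure R).
Implicit Types (f g phi : R -> R) (q : R -> R -> R) (a b u v x t : R).

Definition jointly_continuous q (z : R * R) : Prop :=
  {for z, continuous (fun y : R * R => q y.1 y.2)}.

Lemma jointly_continuous_section q x t : jointly_continuous q (x, t) ->
  {for x, continuous (q ^~ t)}.
Proof.
move=> qc; apply: (@cvg_comp _ _ _ (fun y : R => (y, t)) (fun z : R * R => q z.1 z.2)
  (nbhs x) (nbhs (x, t))); last exact: qc.
exact: (cvg_pair (@cvg_id _ (nbhs x)) (@cvg_cst _ t _ (nbhs x) _)).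
Qed.

Lemma jointly_continuous_box_bounded q a b u v :
  (forall x t, a <= x <= b -> u <= t <= v -> jointly_continuous q (x, t)) ->
  exists C, forall x t, a <= x <= b -> u <= t <= v -> `|q x t| <= C.
Proof.
move=> qc.
have cB : compact ((`[a, b] : set R) `*` (`[u, v] : set R)).
  exact (compact_setX (@segment_compact R a b) (@segment_compact R u v)).
have /compact_bounded[M [_ MB]] :
    compact ((fun y : R * R => q y.1 y.2) @` ((`[a, b] : set R) `*` (`[u, v] : set R))).
  apply: continuous_compact cB; apply: continuous_in_subspaceT => -[x t].
  by rewrite inE => -[/=]; rewrite !in_itv/=; exact: qc.
exists (`|M| + 1) => x t xab tuv; apply: (MB (`|M| + 1)).
  by rewrite (le_lt_trans (ler_norm M))// ltrDl.
by exists (x, t) => //; split => /=; rewrite in_itv.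
Qed.

Lemma segment_integrable f a b : (forall x, a <= x <= b -> {for x, continuous f}) ->
  mu.-integrable `[a, b] (EFin \o f).
Proof.
move=> cf; apply: continuous_compact_integrable; first exact: segment_compact.
by apply: continuous_in_subspaceT => x; rewrite inE/= in_itv/=; exact: cf.
Qed.

(** Joint continuity bounds the derivative on the compact product of [[a, b]]
    with a segment around [t], which dominates the difference quotients. *)
Lemma Rintegral_param_derive q phi a b u v : continuous phi ->
  (forall x t, a <= x <= b -> u < t < v ->
     [/\ jointly_continuous q (x, t), derivable (q x) t 1 &
         jointly_continuous (partial_t q) (x, t)]) ->
  forall t, u < t < v ->
  is_derive t 1 (fun t => \int[mu]_(x in `[a, b]) (phi x * q x t))
    (\int[mu]_(x in `[a, b]) (phi x * partial_t q x t)).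
Proof.
move=> cphi qH t /andP[ut tv].
pose u' := (u + t) / 2; pose v' := (t + v) / 2.
have [uu' u't tv' v'v] : [/\ u < u', u' < t, t < v' & v' < v].
  by rewrite /u' /v'; split; lra.
have [C qC] : exists C, forall x s, a <= x <= b -> u' <= s <= v' ->
    `|phi x * partial_t q x s| <= C.
  apply: (@jointly_continuous_box_bounded (fun x s => phi x * partial_t q x s)).
  move=> x s xab /andP[us sv].
  have [_ _ pc] : [/\ jointly_continuous q (x, s), derivable (q x) s 1 &
      jointly_continuous (partial_t q) (x, s)] by apply: qH => //; lra.
  apply: cvgM; last exact: pc.
  by apply: (@cvg_comp _ _ _ fst phi _ (nbhs x)); [exact: cvg_fst|exact: cphi].
have C0 : 0 <= `|C| by [].
have phiq s : u' < s < v' -> forall x, a <= x <= b ->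
    {for x, continuous (fun x => phi x * q x s)}.
  move=> /andP[us sv] x xab; apply: cvgM; first exact: cphi.
  have [qc _ _] : [/\ jointly_continuous q (x, s), derivable (q x) s 1 &
      jointly_continuous (partial_t q) (x, s)] by apply: qH => //; lra.
  exact: jointly_continuous_section qc.
have tI : `]u', v'[%classic t by rewrite /= in_itv/= u't.
have mB : measurable (`[a, b]%classic : set R) by [].
pose F s x := phi x * q x s.
have Fint s : `]u', v'[%classic s -> mu.-integrable `[a, b] (EFin \o F s).
  by rewrite /= in_itv/= => suv; apply: segment_integrable; exact: phiq.
have qd x s : a <= x <= b -> u' < s < v' -> derivable (q x) s 1.
  by move=> xab /andP[us sv]; have [_ d _] := qH x s xab ltac:(lra); exact: d.
have Fd s x : `]u', v'[%classic s -> `[a, b]%classic x -> derivable (F ^~ x) s 1.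
  rewrite /= !in_itv/= => suv xab.
  by apply: derivableM; [exact: derivable_cst|exact: qd].
have dF s x : a <= x <= b -> u' < s < v' ->
    partial1of2 F s x = phi x * partial_t q x s.
  move=> xab suv; rewrite /partial1of2 /partial_t !derive1E.
  have := @deriveM _ _ (cst (phi x)) (q x) s 1 (derivable_cst _ _ _) (qd x s xab suv).
  rewrite /F => ->.
  by rewrite derive_cst scaler0 addr0.
have Gint : mu.-integrable `[a, b] (EFin \o cst `|C|).
  by apply: segment_integrable => x _; exact: cvg_cst.
have G_ub s x : `]u', v'[%classic s -> `[a, b]%classic x ->
    `|partial1of2 F s x| <= cst `|C| x.
  rewrite /= !in_itv/= => /andP[us sv] xab; rewrite dF//; last by rewrite us.
  by apply: le_trans (qC _ _ xab _) (ler_norm C); rewrite !ltW.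
have H := @cvg_differentiation_under_integral _ _ _ mu F `[a, b] mB t u' v' tI
  Fint Fd (cst `|C|) (fun=> C0) Gint G_ub.
have HE : \int[mu]_(x in `[a, b]) partial1of2 F t x =
    \int[mu]_(x in `[a, b]) (phi x * partial_t q x t).
  by apply: eq_Rintegral => x; rewrite inE/= in_itv/= => xab; rewrite dF// u't.
rewrite HE in H.
suff H2 : h^-1 *: (((fun t => \int[mu]_(x in `[a, b]) (phi x * q x t)) \o shift t) (h *: 1)
   - \int[mu]_(x in `[a, b]) (phi x * q x t)) @[h --> 0^'] -->
   \int[mu]_(x in `[a, b]) (phi x * partial_t q x t).
  by apply: DeriveDef; [apply/cvg_ex; eexists; exact: H2|exact/cvg_lim].
under eq_fun do rewrite /= scaler1; exact: H.
Qed.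

Lemma segment_integration_by_parts f g a b : a < b ->
  (forall x, a <= x <= b -> derivable f x 1 /\ {for x, continuous (derive1 f)}) ->
  (forall x, a <= x <= b -> derivable g x 1 /\ {for x, continuous (derive1 g)}) ->
  f a = 0 -> f b = 0 ->
  \int[mu]_(x in `[a, b]) (f x * derive1 g x) =
  - \int[mu]_(x in `[a, b]) (derive1 f x * g x).
Proof.
move=> ab Hf Hg fa fb.
have aab : a <= a <= b by rewrite lexx ltW.
have bab : a <= b <= b by rewrite lexx ltW.
have LR h : (forall x, a <= x <= b -> derivable h x 1 /\ {for x, continuous (derive1 h)}) ->
    derivable_oo_LRcontinuous h a b.
  move=> Hh; have ch x : a <= x <= b -> {for x, continuous h}.
    move=> /Hh[dh _]; apply: differentiable_continuous; exact/derivable1_diffP.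
  split.
  - move=> x; rewrite in_itv/= => /andP[ax xb].
    by have [] := Hh x ltac:(lra).
  - by apply: cvg_at_right_filter; exact: ch.
  - by apply: cvg_at_left_filter; exact: ch.
have W h : (forall x, a <= x <= b -> derivable h x 1 /\ {for x, continuous (derive1 h)}) ->
    {within `[a, b], continuous (derive1 h)}.
  move=> Hh; apply: continuous_in_subspaceT => x; rewrite inE/= in_itv/=.
  by move=> /Hh[].
rewrite (@Rintegration_by_parts _ f g (derive1 f) (derive1 g) a b)//.
- by rewrite fa fb !mul0r subrr sub0r.
- exact: W.
- exact: LR.
- exact: W.
- exact: LR.
Qed.

(** Two integrations by parts, without boundary terms. *)
Lemma segment_transpose_derive2 phi f a b : a < b -> derivable_upto 3 phi ->
  phi a = 0 -> phi b = 0 -> derive1 phi a = 0 -> derive1 phi b = 0 ->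
  (forall x, a <= x <= b -> [/\ derivable f x 1, derivable (derive1 f) x 1 &
     {for x, continuous (derive1 (derive1 f))}]) ->
  \int[mu]_(x in `[a, b]) (derive1 (derive1 phi) x * f x) =
  \int[mu]_(x in `[a, b]) (phi x * derive1 (derive1 f) x).
Proof.
move=> ab [d0 [d1 [d2 _]]] pa pb dpa dpb Hf.
have cont g x : derivable g x 1 -> {for x, continuous g}.
  by move=> dg; apply: differentiable_continuous; exact/derivable1_diffP.
have H1 x : a <= x <= b -> derivable phi x 1 /\ {for x, continuous (derive1 phi)}.
  move=> _; split; [exact (d0 x)|apply: cont; exact (d1 x)].
have H2 x : a <= x <= b ->
    derivable (derive1 phi) x 1 /\ {for x, continuous (derive1 (derive1 phi))}.
  move=> _; split; [exact (d1 x)|apply: cont; exact (d2 x)].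
have H3 x : a <= x <= b -> derivable f x 1 /\ {for x, continuous (derive1 f)}.
  move=> xab; have [df ddf _] := Hf x xab; split; [exact df|apply: cont; exact ddf].
have H4 x : a <= x <= b ->
    derivable (derive1 f) x 1 /\ {for x, continuous (derive1 (derive1 f))}.
  move=> xab; have [_ ddf cf] := Hf x xab; split; [exact ddf|exact cf].
have E1 := segment_integration_by_parts ab H1 H4 pa pb.
have E2 := segment_integration_by_parts ab H2 H3 dpa dpb.
by rewrite E1 E2 opprK.
Qed.

Lemma bump_integral_gt0 f a b (m : R) : a < b -> 0 < m ->
  (forall x, a <= x <= b -> {for x, continuous f}) ->
  (forall x, a <= x <= b -> m <= f x) ->
  0 < \int[mu]_(x in `[a, b]) (spline_bump a b x * f x).
Proof.
move=> ab m0 cf mf.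
pose w := (b - a) / 4; have w0 : 0 < w by rewrite /w; lra.
have mM : measurable (`]a + w, b - w]%classic : set R) by [].
have cb : continuous (spline_bump a b).
  have [db _] := bump_derivable_upto a b.
  by move=> x; apply: differentiable_continuous; exact/derivable1_diffP.
have I1 : mu.-integrable `[a, b] (EFin \o (fun x => w ^+ 14 * m * \1_(`]a + w, b - w]) x)).
  apply: (@bounded_itv_integrable _ _ (w ^+ 14 * m)).
    by apply: measurable_funTS; apply: measurable_funM => //; exact: measurable_indic.
  move=> x _; rewrite indicE normrM ger0_norm; last by rewrite mulr_ge0 ?exprn_ge0 ?ltW.
  by case: (_ \in _); rewrite ?normr1 ?normr0 ?mulr1 ?mulr0// mulr_ge0 ?exprn_ge0 ?ltW.
have I2 : mu.-integrable `[a, b] (EFin \o (fun x => spline_bump a b x * f x)).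
  by apply: segment_integrable => x xab; apply: cvgM; [exact: cb|exact: cf].
apply: (@lt_le_trans _ _ (\int[mu]_(x in `[a, b]) (w ^+ 14 * m * \1_(`]a + w, b - w]) x))).
  rewrite RintegralZl//; last first.
    apply: (@bounded_itv_integrable _ _ 1).
      by apply: measurable_funTS; exact: measurable_indic.
    by move=> x _; rewrite indicE; case: (_ \in _); rewrite ?normr1 ?normr0.
  have wm : 0 < w ^+ 14 * m by apply: mulr_gt0 => //; exact: exprn_gt0.
  apply: mulr_gt0 => //.
  rewrite /Rintegral integral_indic// setIidl; last first.
    by apply: subset_itv; rewrite bnd_simp; rewrite /w; lra.
  by rewrite fine_lebesgue_measure_oc /w; lra.
apply: le_Rintegral => // x; rewrite /= in_itv/= => xab.
have fx := mf x xab; have b0 := bump_ge0 a b x.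
rewrite indicE; have [|_] := boolP (x \in _).
  rewrite inE/= in_itv/= => /andP[x1 x2]; rewrite mulr1.
  have wb : w ^+ 14 <= spline_bump a b x.
    by apply: bump_lower; [exact: ltW|rewrite (ltW x1)].
  have w14 : 0 <= w ^+ 14 by apply: exprn_ge0; exact: ltW.
  by move: (w ^+ 14) wb w14 => y yb y0; apply: ler_pM => //; exact: ltW.
by rewrite mulr0 mulr_ge0// (le_trans _ fx)// ltW.
Qed.

End Segment.

(** * From tested to pointwise equations *)
Lemma segment_avoiding (R : realFieldType) (a b y : R) : a < b ->
  exists a' b', [/\ a <= a', a' < b', b' <= b & ~~ (a' <= y <= b')].
Proof.
move=> ab; have [h|h] := leP y ((a + b) / 2).
- exists ((a + 3 * b) / 4), b; split; [lra|lra|lra|].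
  by apply/negP => /andP[? ?]; lra.
- exists a, ((3 * a + b) / 4); split; [lra|lra|lra|].
  by apply/negP => /andP[? ?]; lra.
Qed.

Lemma pairing_segment (R : realType) (p : R -> R -> R) (phi : R -> R) (a b t : R) :
  (forall x, ~ `[a, b]%classic x -> phi x = 0) ->
  pairing p phi t = \int[lebesgue_measure]_(x in `[a, b]) (phi x * p x t).
Proof.
move=> phi0; rewrite /pairing [RHS]Rintegral_mkcond; apply: eq_Rintegral => x _.
rewrite patchE; case: ifPn => // xab; rewrite phi0 ?mul0r//.
by move=> h; move/negP: xab; apply; rewrite inE.
Qed.

Lemma tested_continuous (R : realType) (p : R -> R -> R) (U : set (R * R)) x t :
  Ck 3 U p -> U (x, t) ->
  [/\ {for x, continuous (partial_t (partial_t (partial_t p)) ^~ t)},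
      {for x, continuous (partial_t (partial_t p) ^~ t)},
      {for x, continuous (partial_t p ^~ t)},
      {for x, continuous (partial_t (partial_x (partial_x p)) ^~ t)} &
      {for x, continuous (partial_x (partial_x p) ^~ t)}].
Proof.
move=> [_ [_ [_ [_ [cpxx [_ _ [cpxxt _]]] _]] [cpt [_ _ [cptt [_ _ [cpttt _]]]]]]] Ux.
split; apply: jointly_continuous_section.
- exact (cpttt _ Ux).
- exact (cptt _ Ux).
- exact (cpt _ Ux).
- exact (cpxxt _ Ux).
- exact (cpxx _ Ux).
Qed.

Section TestIntegrals.
Context (R : realType).
Notation mu := (@lebesgue_measure R).

(** If [D x0 <> 0] then [D x0 * D] is bounded below by a positive constant near
    [x0], which contains a segment avoiding the three excluded points. *)
Lemma eq0_of_bump_integrals (D : R -> R) (x0 e y1 y2 y3 : R) : 0 < e ->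
  (forall x, `|x - x0| < e -> {for x, continuous D}) ->
  (forall a b, a < b -> (forall x, a <= x <= b -> `|x - x0| < e) ->
     ~ `[a, b]%classic y1 -> ~ `[a, b]%classic y2 -> ~ `[a, b]%classic y3 ->
     \int[mu]_(x in `[a, b]) (spline_bump a b x * D x) = 0) ->
  D x0 = 0.
Proof.
move=> e0 cD intD; apply: contrapT => /eqP Dn0.
pose m := D x0 ^+ 2 / 2.
have D20 : 0 < D x0 ^+ 2 by rewrite lt_neqAle sqr_ge0 andbT eq_sym sqrf_eq0.
have m0 : 0 < m by rewrite divr_gt0.
have [e1 e10 e1D] : exists2 e1, 0 < e1 & forall x, `|x - x0| < e1 -> m <= D x0 * D x.
  have cf : D x0 * D x @[x --> x0] --> D x0 * D x0.
    by apply: cvgMl_tmp; apply: cD; rewrite subrr normr0.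
  move: cf => /cvgrPdist_le/(_ _ m0)/nbhs_ballP[e1 /= e10 H].
  exists e1 => // x xe; have := H x; rewrite /ball/= distrC => /(_ xe).
  by rewrite ler_norml => /andP[_]; rewrite -expr2 /m; lra.
pose r := Num.min e e1.
have r0 : 0 < r by rewrite lt_min e0.
have [re re1] : r <= e /\ r <= e1 by rewrite !ge_min !lexx orbT.
(* Any segment close to x0 would do; this one is on its right. *)
have h0 : x0 + r / 4 < x0 + r / 2 by lra.
have [a1 [b1 [q1 q2 q3 q4]]] := segment_avoiding y1 h0.
have [a2 [b2 [q5 q6 q7 q8]]] := segment_avoiding y2 q2.
have [a [b [q9 ab q10 q11]]] := segment_avoiding y3 q6.
have inab x : a <= x <= b -> `|x - x0| < r.
  by move=> /andP[? ?]; rewrite ger0_norm; lra.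
have K1 : ~ `[a, b]%classic y1.
  rewrite /= in_itv/= => /andP[? ?]; move/negP: q4; apply.
  by apply/andP; split; lra.
have K2 : ~ `[a, b]%classic y2.
  rewrite /= in_itv/= => /andP[? ?]; move/negP: q8; apply.
  by apply/andP; split; lra.
have K3 : ~ `[a, b]%classic y3.
  by rewrite /= in_itv/=; exact/negP.
have cDab x : a <= x <= b -> {for x, continuous D}.
  by move=> xab; apply: cD; exact: lt_le_trans (inab x xab) re.
have cphi : continuous (spline_bump a b).
  have [d0 _] := bump_derivable_upto a b.
  by move=> x; apply: differentiable_continuous; exact/derivable1_diffP.
have := @bump_integral_gt0 _ (fun x => D x0 * D x) a b m ab m0.
have -> : \int[mu]_(x in `[a, b]) (spline_bump a b x * (D x0 * D x)) = 0.
  have -> : \int[mu]_(x in `[a, b]) (spline_bump a b x * (D x0 * D x)) =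
      \int[mu]_(x in `[a, b]) (D x0 * (spline_bump a b x * D x)).
    by apply: eq_Rintegral => x _; ring.
  rewrite RintegralZl//.
    rewrite intD ?mulr0// => x xab; exact: lt_le_trans (inab x xab) re.
  by apply: segment_integrable => x xab; apply: cvgM; [exact: cphi|exact: cDab].
rewrite ltxx => F; suff : false by []; apply: F.
  by move=> x xab; apply: cvgMl_tmp; exact: cDab.
by move=> x xab; apply: e1D; exact: lt_le_trans (inab x xab) re1.
Qed.

Lemma Rintegral_combination5 (phi f1 f2 f3 f4 f5 : R -> R) (a b k2 k3 k4 k5 : R) :
  continuous phi ->
  (forall x, a <= x <= b -> [/\ {for x, continuous f1}, {for x, continuous f2},
     {for x, continuous f3}, {for x, continuous f4} & {for x, continuous f5}]) ->
  \int[mu]_(x in `[a, b])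
     (phi x * (f1 x + (k2 * f2 x + (k3 * f3 x + (k4 * f4 x + k5 * f5 x))))) =
  \int[mu]_(x in `[a, b]) (phi x * f1 x)
  + (k2 * \int[mu]_(x in `[a, b]) (phi x * f2 x)
  + (k3 * \int[mu]_(x in `[a, b]) (phi x * f3 x)
  + (k4 * \int[mu]_(x in `[a, b]) (phi x * f4 x)
  + k5 * \int[mu]_(x in `[a, b]) (phi x * f5 x)))).
Proof.
move=> cphi cf; pose good (f : R -> R) := forall x, a <= x <= b -> {for x, continuous f}.
have I (h : R -> R) : good h -> mu.-integrable `[a, b] (EFin \o (fun x => phi x * h x)).
  by move=> ch; apply: segment_integrable => x xab; apply: cvgM; [exact: cphi|exact: ch].
have gZ (h : R -> R) (y : R) : good h -> good (fun x => y * h x).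
  by move=> ch x xab; apply: cvgMl_tmp; exact: ch.
have gD (h h' : R -> R) : good h -> good h' -> good (fun x => h x + h' x).
  by move=> ch ch' x xab; apply: cvgD; [exact: ch|exact: ch'].
have JD (h h' : R -> R) : good h -> good h' ->
    \int[mu]_(x in `[a, b]) (phi x * (h x + h' x)) =
    \int[mu]_(x in `[a, b]) (phi x * h x) + \int[mu]_(x in `[a, b]) (phi x * h' x).
  move=> ch ch'; under eq_Rintegral do rewrite mulrDr.
  by rewrite RintegralD//; exact: I.
have JZ (y : R) (h : R -> R) : good h ->
    \int[mu]_(x in `[a, b]) (phi x * (y * h x)) =
    y * \int[mu]_(x in `[a, b]) (phi x * h x).
  move=> ch; under eq_Rintegral do rewrite mulrCA.
  by rewrite RintegralZl//; exact: I.
have [g1 g2 g3 g4 g5] : [/\ good f1, good f2, good f3, good f4 & good f5].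
  by split => x xab; have [] := cf x xab.
have g45 : good (fun x => k4 * f4 x + k5 * f5 x) by apply: gD; exact: gZ.
have g345 : good (fun x => k3 * f3 x + (k4 * f4 x + k5 * f5 x)).
  by apply: gD => //; exact: gZ.
have g2345 : good (fun x => k2 * f2 x + (k3 * f3 x + (k4 * f4 x + k5 * f5 x))).
  by apply: gD => //; exact: gZ.
rewrite (JD _ _ g1 g2345) (JD _ _ (gZ _ k2 g2) g345) (JD _ _ (gZ _ k3 g3) g45).
by rewrite (JD _ _ (gZ _ k4 g4) (gZ _ k5 g5)) !JZ.
Qed.

Lemma pointwise_of_tested (f1 f2 f3 g1 g2 : R -> R)
    (k2 k3 l1 l2 x0 e y1 y2 y3 : R) : 0 < e ->
  (forall x, `|x - x0| < e -> [/\ {for x, continuous f1}, {for x, continuous f2},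
     {for x, continuous f3}, {for x, continuous g1} & {for x, continuous g2}]) ->
  (forall a b, a < b -> (forall x, a <= x <= b -> `|x - x0| < e) ->
     ~ `[a, b]%classic y1 -> ~ `[a, b]%classic y2 -> ~ `[a, b]%classic y3 ->
     let int f := \int[mu]_(x in `[a, b]) (spline_bump a b x * f x) in
     int f1 + k2 * int f2 + k3 * int f3 = l1 * int g1 + l2 * int g2) ->
  f1 x0 + k2 * f2 x0 + k3 * f3 x0 = l1 * g1 x0 + l2 * g2 x0.
Proof.
move=> e0 C H.
pose D x := f1 x + (k2 * f2 x + (k3 * f3 x + (- l1 * g1 x + - l2 * g2 x))).
suff E0 : D x0 = 0 by apply/eqP; rewrite -subr_eq0 -E0 /D; apply/eqP; ring.
apply: (@eq0_of_bump_integrals D x0 e y1 y2 y3) => //.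
  move=> x /C[c1 c2 c3 c4 c5].
  apply: cvgD; first exact: c1.
  apply: cvgD; first (apply: cvgMl_tmp; exact: c2).
  apply: cvgD; first (apply: cvgMl_tmp; exact: c3).
  by apply: cvgD; apply: cvgMl_tmp; [exact: c4|exact: c5].
move=> a b ab near_ab K1 K2 K3.
have CC x : a <= x <= b -> [/\ {for x, continuous f1}, {for x, continuous f2},
     {for x, continuous f3}, {for x, continuous g1} & {for x, continuous g2}].
  by move=> xab; apply: C; exact: near_ab.
have cphi : continuous (spline_bump a b).
  have [d0 _] := bump_derivable_upto a b.
  by move=> x; apply: differentiable_continuous; exact/derivable1_diffP.
rewrite (Rintegral_combination5 _ _ _ _ cphi CC).
have := H a b ab near_ab K1 K2 K3; rewrite /=.
set i1 := Rintegral _ _ _; set i2 := Rintegral _ _ _; set i3 := Rintegral _ _ _.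
set i4 := Rintegral _ _ _; set i5 := Rintegral _ _ _.
move: i1 i2 i3 i4 i5 => i1 i2 i3 i4 i5 E0.
have -> : i1 = l1 * i4 + l2 * i5 - k2 * i2 - k3 * i3 by rewrite -E0; ring.
by ring.
Qed.

End TestIntegrals.

(** * The cumulative rate *)
Section Rate.
Context (R : realType) (lam : R -> R).
Hypothesis hlam : C1_rate lam.
Notation mu := (@lebesgue_measure R).

Definition rate_integral (s t : R) : R := fine (cumulative_rate lam s t).

Lemma rate_ge0 t : 0 < t -> 0 <= lam t.
Proof. by move=> /hlam[]. Qed.

Lemma rate_continuous t : 0 < t -> {for t, continuous lam}.
Proof.
by move=> /hlam[_ dl _]; apply: differentiable_continuous; exact/derivable1_diffP.
Qed.

Lemma rate_integrable s t : 0 < s -> mu.-integrable `[s, t] (EFin \o lam).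
Proof.
move=> s0; apply: continuous_compact_integrable; first exact: segment_compact.
apply: continuous_in_subspaceT => x; rewrite inE/= in_itv/= => /andP[sx _].
by apply: rate_continuous; exact: lt_le_trans sx.
Qed.

Lemma rate_integrable_oc s t : 0 < s -> mu.-integrable `]s, t] (EFin \o lam).
Proof.
move=> s0; apply: integrableS (rate_integrable t s0) => //.
exact: subset_itv_oc_cc.
Qed.

Lemma cumulative_rate_fin s t : 0 < s -> (cumulative_rate lam s t < +oo)%E.
Proof.
by move=> s0; have := integrable_lty _ (rate_integrable_oc t s0); apply.
Qed.

Lemma rate_integral_ge0 s t : 0 <= s -> 0 <= rate_integral s t.
Proof.
move=> s0; apply/fine_ge0/integral_ge0 => x /=; rewrite in_itv/= => /andP[sx _].
by rewrite lee_fin rate_ge0// (le_lt_trans s0).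
Qed.

Lemma rate_integral_bounds s t m M : 0 < s -> s <= t ->
  (forall x, s <= x <= t -> m <= lam x <= M) ->
  m * (t - s) <= rate_integral s t <= M * (t - s).
Proof.
move=> s0 st mM.
have Ic k : mu.-integrable `]s, t] (EFin \o cst k).
  apply: (@integrableS _ _ _ mu `[s, t]) => //; first exact: subset_itv_oc_cc.
  by apply: (@bounded_itv_integrable _ (cst k) `|k|).
rewrite -[rate_integral s t]/(\int[mu]_(x in `]s, t]) lam x).
have E k : k * (t - s) = \int[mu]_(x in `]s, t]) cst k x.
  by rewrite /= Rintegral_cst// [fine _](fine_lebesgue_measure_oc st).
have H x : `]s, t]%classic x -> m <= lam x <= M.
  by rewrite /= in_itv/= => /andP[sx xt]; apply: mM; rewrite (ltW sx).
rewrite !E; apply/andP; split; apply: le_Rintegral => //.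
all: try exact: rate_integrable_oc.
all: by move=> x /H/andP[].
Qed.

Lemma rate_integral_near t e : 0 < t -> 0 < e -> exists2 r, 0 < r &
  forall s s', t - r <= s -> s <= s' -> s' <= t + r ->
    `|rate_integral s s' - lam t * (s' - s)| <= e * (s' - s).
Proof.
move=> t0 e0; have := rate_continuous t0 => /cvgrPdist_le/(_ _ e0).
move=> /nbhs_ballP[r /= r0 rP].
pose r' := Num.min (r / 2) (t / 2).
have r'0 : 0 < r' by rewrite lt_min !divr_gt0.
have r'r : r' <= r / 2 by rewrite ge_min lexx.
have r't : r' <= t / 2 by rewrite ge_min lexx orbT.
exists r' => // s s' rs ss' s'r; have s0 : 0 < s by lra.
have := @rate_integral_bounds s s' (lam t - e) (lam t + e) s0 ss'.
move=> /(_ _)/andP[].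
  move=> x /andP[sx xs']; have := rP x; rewrite /ball/= ler_norml => H.
  have /H/andP[? ?] : `|t - x| < r by rewrite ltr_norml; apply/andP; split; lra.
  by apply/andP; split; lra.
by move=> H1 H2; rewrite ler_norml; apply/andP; split; lra.
Qed.

Lemma rate_bounded s t : 0 < s -> exists2 M, 0 < M &
  forall x, s <= x <= t -> lam x <= M.
Proof.
move=> s0; have [st|ts] := leP s t; last first.
  exists 1 => // x /andP[sx xt]; lra.
have [|x xst xmax] := @EVT_max R lam s t st.
  apply: continuous_in_subspaceT => x; rewrite inE/= in_itv/= => /andP[sx _].
  by apply: rate_continuous; exact: lt_le_trans sx.
exists (lam x + 1) => [|y yst].
  rewrite in_itv/= in xst; have [sx _] := andP xst.
  by have := @rate_ge0 x (lt_le_trans s0 sx); lra.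
by have := xmax y yst; lra.
Qed.

End Rate.

(** * The motion and its past *)
Section Motion.
Context (R : realType) (d : measure_display) (Omega : measurableType d).
Variables (P : probability Omega R) (c : R) (lam : R -> R) (E : Omega -> set R).
Variables (V0 : {RV P >-> R}) (V : R -> {RV P >-> R}).
Hypotheses (hc : 0 < c) (hlam : C1_rate lam) (hN : poisson_process P lam E)
  (hV : velocity_process c E V0 V).
Implicit Types (s t : R) (w : Omega).
Notation L := (rate_integral lam).
Notation N := (N_eq E).
Notation X := (position V).

Lemma N_eq0E s t : N s t 0 = [set w | E w `&` `]s, t] = set0].
Proof.
apply/seteqP; split=> w; rewrite /N_eq /N_events /counting/=; last first.
  by move=> ->; rewrite asboolT// fset_set0 finmap.cardfs0.
case: asboolP => // fin [] /(mulrIn (oner_neq0 R))/finmap.cardfs0_eq A0.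
by have := fset_setK fin; rewrite A0 set_fset0.
Qed.

Lemma N_eq_disjoint s t : N s t 0 `&` N s t 1 = set0.
Proof.
rewrite -subset0 => w [] /=; rewrite /N_eq/= => -> [].
by move=> /esym/eqP; rewrite oner_eq0.
Qed.

Lemma velocity_jump_path w : jump_path c (E w) (V ^~ w).
Proof.
split.
- by move=> s t; exact: poisson_locally_finite hN w s t.
- move=> t t0; case: (velocity_states hV w t0) => ->.
  + by rewrite gtr0_norm.
  + by rewrite normr0 ltW.
  + by rewrite normrN gtr0_norm.
- by move=> s t; exact: velocity_constant hV s t w.
Qed.

Lemma position_constant s t w : 0 <= s -> s <= t -> N s t 0 w ->
  X t w = X s w + V s w * (t - s).
Proof.
move=> s0 st; rewrite N_eq0E => Ew.
by have := path_increment_constant (velocity_jump_path w) s0 st Ew.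
Qed.

Lemma position_lipschitz s t w : 0 <= s -> s <= t ->
  `|X t w - X s w| <= c * (t - s).
Proof. by move=> s0 st; have := path_increment_le (velocity_jump_path w) s0 st. Qed.

Lemma measurable_N s t k : 0 <= s -> s <= t -> measurable (N s t k).
Proof. exact: poisson_measurable hN s t k. Qed.

Lemma measurable_position t : 0 <= t -> measurable_fun setT (X t).
Proof.
move=> t0; apply: (measurable_path_integral t0 velocity_jump_path).
by move=> r _.
Qed.

(** The information of the velocity and of the events up to time [s]: it is
    independent of the events after [s], whereas [history], to which the
    transition rules refer, contains the whole Poisson process. *)
Definition past s : set (set Omega) :=
  <<s velocities_on V `[0, s] `|` counts_on E `[0, s] >>.

Lemma position_sigma (G : set (set Omega)) s : 0 <= s ->
  velocities_on V `[0, s] `<=` G ->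
  forall B : set R, measurable B -> <<s G >> (X s @^-1` B).
Proof.
move=> s0 VG B mB.
have mV r : 0 <= r <= s ->
    @measurable_fun _ _ (g_sigma_algebraType G) R setT (V r).
  move=> rs _ D mD; rewrite setTI; apply: sub_gen_smallest; apply: VG.
  by exists r; split; [rewrite /= in_itv|exists D].
have := @measurable_path_integral R _ (g_sigma_algebraType G) c E
   (fun r w => V r w) s s0 velocity_jump_path mV.
by move=> /(_ measurableT B mB); rewrite setTI.
Qed.

Lemma position_past s (B : set R) : 0 <= s -> measurable B -> past s (X s @^-1` B).
Proof. by move=> s0 mB; apply: position_sigma. Qed.

Lemma velocity_past s (B : set R) : 0 <= s -> measurable B -> past s (V s @^-1` B).
Proof.
move=> s0 mB; apply: sub_gen_smallest; left; exists s; split.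
  by rewrite /= in_itv/= s0 lexx.
by exists B.
Qed.

Lemma past_history s : 0 <= s -> past s `<=` history V E s.
Proof.
move=> s0; apply: sub_smallest2r; last first.
  apply: setUS => A [r [t [k [rI tI rt AE]]]]; exists r, t, k; split => //.
  - by move: rI; rewrite /= !in_itv/= => /andP[->].
  - by move: tI; rewrite /= !in_itv/= => /andP[->].
exact: smallest_sigma_algebra.
Qed.

Lemma pastI s A B : past s A -> past s B -> past s (A `&` B).
Proof.
move=> pA pB.
exact: (@measurableI _ (g_sigma_algebraType (velocities_on V `[0, s] `|` counts_on E `[0, s])) A B).
Qed.

Lemma measurable_past s A : past s A -> measurable A.
Proof.
have : past s `<=` measurable.
  apply: smallest_sub; first exact: sigma_algebra_measurable.
  move=> B [[r [_ [D [mD ->]]]]|[r [t [k [rI tI rt ->]]]]].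
    by rewrite -[X in measurable X]setTI; exact: measurable_funP.
  by apply: measurable_N => //; move: rI; rewrite /= in_itv/= => /andP[].
exact.
Qed.

Lemma past_indep s t k A : 0 <= s -> s <= t -> past s A ->
  P (A `&` N s t k) = (P A * P (N s t k))%E.
Proof.
move=> s0 st pA; apply: (velocity_adapted hV s0) => //.
apply: sub_gen_smallest; exists s, t, k; split => //; rewrite /= in_itv/= andbT//.
Qed.

Lemma Pr_past_indep s t k A : 0 <= s -> s <= t -> past s A ->
  Pr P (A `&` N s t k) = Pr P A * Pr P (N s t k).
Proof.
move=> s0 st pA; apply: EFin_inj; have mN := measurable_N k s0 st.
have mA := measurable_past pA.
by rewrite EFinM -!PrE//; [exact: past_indep|exact: measurableI].
Qed.

Lemma Pr_N s t k : 0 <= s -> s <= t -> (cumulative_rate lam s t < +oo)%E ->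
  Pr P (N s t k) = L s t ^+ k / k`!%:R * expR (- L s t).
Proof. by move=> s0 st fin; rewrite /Pr (poisson_counts hN k s0 st fin). Qed.

Lemma Pr_N0 s t : 0 < s -> s <= t -> Pr P (N s t 0) = expR (- L s t).
Proof.
move=> s0 st; rewrite Pr_N//; [|exact: ltW|exact: cumulative_rate_fin].
by rewrite expr0 fact0 divr1 mul1r.
Qed.

Lemma Pr_N1 s t : 0 < s -> s <= t -> Pr P (N s t 1) = L s t * expR (- L s t).
Proof.
move=> s0 st; rewrite Pr_N//; [|exact: ltW|exact: cumulative_rate_fin].
by rewrite expr1 divr1.
Qed.

Definition N_ge2 s t : set Omega := ~` (N s t 0 `|` N s t 1).

Lemma measurable_N_ge2 s t : 0 <= s -> s <= t -> measurable (N_ge2 s t).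
Proof.
by move=> s0 st; apply: measurableC; apply: measurableU; exact: measurable_N.
Qed.

(** With l = L s t this is 1 - (1 + l) exp(-l) <= 1 - (1 + l) (1 - l) = l^2. *)
Lemma Pr_N_ge2 s t : 0 < s -> s <= t -> Pr P (N_ge2 s t) <= L s t ^+ 2.
Proof.
move=> s0 st; have s0' := ltW s0.
have mN k := measurable_N k s0' st.
have : Pr P (N_ge2 s t) + (Pr P (N s t 0) + Pr P (N s t 1)) = 1.
  rewrite -PrU// ?N_eq_disjoint// -PrU//.
  - by rewrite /N_ge2 setvU /Pr probability_setT.
  - exact: measurable_N_ge2.
  - exact: measurableU.
  - by rewrite /N_ge2 setIC setICr.
rewrite Pr_N0// Pr_N1//; have := expR_ge1Dx (- L s t).
have := rate_integral_ge0 hlam t s0'; set l := L s t.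
move=> l0 h h2; have : 1 - l ^+ 2 <= (1 + l) * expR (- l).
  rewrite (_ : 1 - l ^+ 2 = (1 + l) * (1 + - l)); last ring.
  by rewrite ler_pM2l//; lra.
lra.
Qed.

Lemma rate_integral_le s t M : 0 < s -> s <= t ->
  (forall x, s <= x <= t -> lam x <= M) -> L s t <= M * (t - s).
Proof.
move=> s0 st lM; have [x /andP[sx xt]|_ //] := andP (@rate_integral_bounds _ _ hlam s t 0 M s0 st _).
by rewrite (rate_ge0 hlam) ?lM ?sx//; exact: lt_le_trans sx.
Qed.

Definition jump_proba (u v : R) : R :=
  if u == 0 then (if v == 0 then 0 else 2^-1) else (if v == 0 then 1 else 0).

Definition is_state (u : R) := [\/ u = c, u = 0 | u = - c].

Lemma negc_neq0 : - c != 0. Proof. by rewrite oppr_eq0 gt_eqF. Qed.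

Lemma measurable_V_eq t u : measurable (V t @^-1` [set u]).
Proof. by rewrite -[X in measurable X]setTI; exact: measurable_funP. Qed.

Lemma split_velocity t B : 0 <= t -> measurable B ->
  Pr P B = Pr P (B `&` V t @^-1` [set c]) + Pr P (B `&` V t @^-1` [set 0])
    + Pr P (B `&` V t @^-1` [set - c]).
Proof.
move=> t0 mB; have mV u := measurable_V_eq t u.
have mI u : measurable (B `&` V t @^-1` [set u]) by exact: measurableI.
have c0 : c <> 0 by move/eqP; rewrite gt_eqF.
have cN : c <> - c by move=> h; lra.
have N0 : 0 <> - c by move=> h; lra.
rewrite -PrU//; last first.
  rewrite -subset0 => w [[_ /= ->] [_ /= ?]]; exact: c0.
rewrite -PrU//; first last.
- rewrite -subset0 => w [[] [_ /= ->] [_ /= ?]]; [exact: cN|exact: N0].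
- exact: measurableU.
congr (Pr P _); apply/seteqP; split => [w Bw|w [[[]|[]]|[]]//].
by case: (velocity_states hV w t0) => ?; [left; left|left; right|right].
Qed.

(** The two rules of the velocity process fix six of the nine probabilities;
    the others vanish because the three probabilities from each state sum to the
    probability of the conditioning event. *)
Lemma transition s t A u v : 0 <= s -> s < t -> history V E s A -> measurable A ->
  is_state u -> is_state v ->
  Pr P (A `&` V s @^-1` [set u] `&` N s t 1 `&` V t @^-1` [set v])
  = jump_proba u v * Pr P (A `&` V s @^-1` [set u] `&` N s t 1).
Proof.
move=> s0 st hA mA su sv; set B := A `&` _ `&` _.
have t0 : 0 <= t by lra.
have mB : measurable B.
  apply: measurableI; last by apply: measurable_N => //; exact: ltW.
  by apply: measurableI => //; exact: measurable_V_eq.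
have mBt x : measurable (B `&` V t @^-1` [set x]).
  by apply: measurableI => //; exact: measurable_V_eq.
have cN0 : (c == 0) = false by rewrite gt_eqF.
have NN0 : (- c == 0) = false by rewrite (negbTE negc_neq0).
have := split_velocity t0 mB.
have from0 x : u = 0 -> (x = c \/ x = - c) ->
    Pr P (B `&` V t @^-1` [set x]) = 2^-1 * Pr P B.
  move=> u0 xc; apply: EFin_inj; rewrite EFinM -!PrE// /B u0.
  exact: velocity_from0 hV _ _ _ _ s0 st hA xc.
have to0 : (u = c \/ u = - c) -> Pr P (B `&` V t @^-1` [set 0]) = Pr P B.
  by move=> uc; apply: EFin_inj; rewrite -!PrE//; exact: velocity_to0 hV _ _ _ _ s0 st hA uc.
have ge0 x := Pr_ge0 P (B `&` V t @^-1` [set x]).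
have := ge0 c; have := ge0 0; have := ge0 (- c).
case: su => uE; rewrite /jump_proba uE ?eqxx ?cN0 ?NN0.
- rewrite (to0 (or_introl uE)).
  by case: sv => ->; rewrite ?eqxx ?cN0 ?NN0 ?(to0 (or_introl uE)); lra.
- rewrite (from0 c uE (or_introl erefl)) (from0 (- c) uE (or_intror erefl)).
  case: sv => ->; rewrite ?eqxx ?cN0 ?NN0;
    rewrite ?(from0 c uE (or_introl erefl)) ?(from0 (- c) uE (or_intror erefl)); lra.
- rewrite (to0 (or_intror uE)).
  by case: sv => ->; rewrite ?eqxx ?cN0 ?NN0 ?(to0 (or_intror uE)); lra.
Qed.


(** * Absolute continuity of the position after an event *)
Lemma N_eq0_cat r s t w : r <= s -> s <= t -> N r s 0 w -> N s t 0 w -> N r t 0 w.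
Proof.
move=> rs st; rewrite !N_eq0E => rs0 st0; rewrite /= -subset0 => x [Ex].
rewrite /= in_itv/= => /andP[rx xt]; suff : @set0 R x by [].
have [xs|sx] := leP x s; [rewrite -rs0|rewrite -st0]; split => //=.
- by rewrite in_itv/= rx.
- by rewrite in_itv/= sx.
Qed.

Lemma Pr_some_event s t M : 0 < s -> s <= t ->
  (forall x, s <= x <= t -> lam x <= M) -> Pr P (~` N s t 0) <= M * (t - s).
Proof.
move=> s0 st lM; have mN := measurable_N 0 (ltW s0) st.
have : Pr P (~` N s t 0) + Pr P (N s t 0) = 1.
  rewrite -PrU//; first by rewrite setvU /Pr probability_setT.
    exact: measurableC.
  by rewrite setIC setICr.
rewrite Pr_N0//; have := expR_ge1Dx (- L s t); have := rate_integral_le s0 st lM; lra.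
Qed.

(** By independence both sides are explicit: one event costs the factor [L s t]
    with respect to no event. *)
Lemma Pr_one_event s t A : 0 < s -> s <= t -> past s A ->
  Pr P (A `&` N s t 1) = L s t * Pr P (A `&` N s t 0).
Proof.
move=> s0 st pA; have s0' := ltW s0.
by rewrite !Pr_past_indep// Pr_N0// Pr_N1//; ring.
Qed.

(** The grid [g j] cuts (s, t] into pieces of length [h], during which the
    position moves by at most [delta].  For the final velocity [v], [W] and [Y]
    are the velocity and the position relative to a particle of velocity [v].
    If the last event occurs in piece [j], then [Y] is constant after this piece,
    so that Y(g j) is within 2 delta of Y(t), whence the enlargement [a'], [b']
    of the interval. *)
Section Occupation.
Variables (s t M v a b h delta : R) (n : nat).
Hypotheses (s0 : 0 < s) (st : s < t) (M0 : 0 < M)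
  (lM : forall x, s <= x <= t -> lam x <= M) (sv : is_state v) (ab : a <= b)
  (hE : h = (t - s) / n.+1%:R) (deltaE : delta = c * h).

Let g (j : nat) := s + j%:R * h.
Let a' := a - v * t - 2 * delta.
Let b' := b - v * t + 2 * delta.
(* The identity clamped to [a' - delta, b' + delta], shifted to be nonnegative:
   the margin delta makes it increase by delta or more over a piece that starts
   in [a', b'] with a nonzero relative velocity. *)
Let Psi x := Num.max (a' - delta) (Num.min x (b' + delta)) - (a' - delta).
Let S := b - a + 6 * delta.
Let W j w := V (g j) w - v.
Let Y j w := X (g j) w - v * g j.
Let Hit j := [set w | V (g j) w <> v] `&` [set w | a' <= Y j w <= b'].

Let h0 : 0 < h.
Proof. by rewrite hE divr_gt0// subr_gt0. Qed.

Let delta0 : 0 < delta. Proof. by rewrite deltaE mulr_gt0. Qed.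

Let g_ge j : s <= g j.
Proof. by rewrite lerDl mulr_ge0// ltW. Qed.

Let g_gt0 j : 0 < g j.
Proof. exact: lt_le_trans (g_ge j). Qed.

Let gS j : g j.+1 = g j + h.
Proof. by rewrite /g -natr1; ring. Qed.

Let gB j : g j.+1 - g j = h.
Proof. by rewrite gS addrAC subrr add0r. Qed.

Let g_last : g n.+1 = t.
Proof. by rewrite /g hE mulrC divfK ?pnatr_eq0// addrC subrK. Qed.

Let g_mono i j : (i <= j)%N -> g i <= g j.
Proof. by move=> ij; rewrite lerD2l ler_pM2r// ler_nat. Qed.

Let g_le j : (j <= n.+1)%N -> g j <= t.
Proof. by move=> jn; rewrite -g_last g_mono. Qed.

Let Psi_ge0 x : 0 <= Psi x.
Proof. by rewrite subr_ge0 le_max lexx. Qed.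

Let Psi_leS x : Psi x <= S.
Proof.
move: ab delta0; rewrite lerBlDr ge_max ge_min /S /a' /b' => ? ?.
apply/andP; split; first lra.
by apply/orP; right; lra.
Qed.

Let S0 : 0 <= S.
Proof. exact: le_trans (Psi_leS 0). Qed.

Let Psi_mono x y : x <= y -> Psi x <= Psi y.
Proof. by move=> xy; rewrite lerD2r; apply: le_max2 => //; apply: le_min2. Qed.

Let Psi_mid x : a' - delta <= x <= b' + delta -> Psi x = x - (a' - delta).
Proof. by move=> /andP[? ?]; rewrite /Psi min_l// max_r. Qed.

Let norm_W j w : `|W j w| <= 2 * c.
Proof.
rewrite /W; have c0 := ltW hc.
by case: (velocity_states hV w (ltW (g_gt0 j))) => ->; case: sv => ->;
  rewrite ler_norml; apply/andP; split; lra.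
Qed.

Let W_gap j w : V (g j) w <> v -> c <= W j w \/ W j w <= - c.
Proof.
rewrite /W; case: (velocity_states hV w (ltW (g_gt0 j))) => ->; case: sv => ->.
all: try by move=> Vv; exfalso; apply: Vv.
all: by have c0 := hc; move=> _; first [left; lra|right; lra].
Qed.

(** Without event the relative velocity is constant and drives [Y] in its own
    direction, so W Psi(Y) does not decrease; an event changes it by at most
    4 c S because [W] is bounded by 2 c and Psi by [S]. *)
Let potential_step j w :
  c * delta * \1_(Hit j `&` N (g j) (g j.+1) 0) w <=
  W j.+1 w * Psi (Y j.+1 w) - W j w * Psi (Y j w)
  + 4 * c * S * \1_(~` N (g j) (g j.+1) 0) w.
Proof.
have gj : g j <= g j.+1 by exact: g_mono.
have [Nw|Nw] := pselect (N (g j) (g j.+1) 0 w); last first.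
  rewrite indicE memNset ?mulr0; last by case.
  rewrite indicE mem_set// mulr1.
  have bound i : `|W i w * Psi (Y i w)| <= 2 * c * S.
    by rewrite normrM (ger0_norm (Psi_ge0 _)) ler_pM.
  have := bound j; have := bound j.+1; rewrite !ler_norml.
  by move=> /andP[? _] /andP[_ ?]; lra.
rewrite [in X in _ <= _ + X]indicE [in X in _ <= _ + X]memNset ?mulr0 ?addr0; last by move=> /(_ Nw).
have Wj : W j.+1 w = W j w.
  rewrite /W (velocity_constant hV (ltW (g_gt0 j)) gj)//.
  by move: Nw; rewrite N_eq0E.
have Yj : Y j.+1 w = Y j w + W j w * h.
  by rewrite /Y (position_constant (ltW (g_gt0 j)) gj Nw) /W gS; ring.
rewrite Wj Yj -mulrBr.
have nonneg : 0 <= W j w * (Psi (Y j w + W j w * h) - Psi (Y j w)).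
  have [Wp|Wn] := leP 0 (W j w).
    by rewrite mulr_ge0// subr_ge0 Psi_mono// lerDl mulr_ge0// ltW.
  rewrite mulr_le0// ?(ltW Wn)// subr_le0 Psi_mono// gerDl mulr_le0_ge0// ltW//.
rewrite indicE; case: (boolP (w \in _)) => [|_]; last by rewrite mulr0.
rewrite inE => -[[Vw Iw] _]; rewrite mulr1.
have [/andP[I1 I2] dp] := (Iw, delta0).
rewrite (@Psi_mid (Y j w)); last by apply/andP; split; lra.
have c0 := hc; have [Wc|Wc] := W_gap Vw.
- have : Psi (Y j w + delta) <= Psi (Y j w + W j w * h).
    by apply: Psi_mono; rewrite lerD2l deltaE ler_pM2r.
  rewrite Psi_mid; last by apply/andP; split; lra.
  by move=> H; apply: ler_pM; lra.
- have : Psi (Y j w + W j w * h) <= Psi (Y j w - delta).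
    by apply: Psi_mono; rewrite lerD2l deltaE -mulNr ler_pM2r.
  rewrite [Psi (_ - _)]Psi_mid; last by apply/andP; split; lra.
  by move=> H; rewrite -mulrNN; apply: ler_pM; lra.
Qed.

Let Hit_past j : past (g j) (Hit j).
Proof.
have gj := ltW (g_gt0 j); apply: pastI.
  have -> : [set w | V (g j) w <> v] = V (g j) @^-1` (~` [set v]) by [].
  by apply: velocity_past => //; exact: measurableC.
have -> : [set w | a' <= Y j w <= b'] =
    X (g j) @^-1` `[a' + v * g j, b' + v * g j].
  by apply/seteqP; split => w /=; rewrite in_itv/= /Y lerBrDr lerBlDr.
by apply: position_past.
Qed.

Let mHit j : measurable (Hit j).
Proof. by apply: measurable_past; exact: Hit_past. Qed.

Let piece j := (ltW (g_gt0 j), g_mono (leqnSn j)).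

Let mN j k : measurable (N (g j) (g j.+1) k).
Proof. by case: (piece j) => ? ?; exact: measurable_N. Qed.

Let lM_piece j : (j < n.+1)%N -> forall x, g j <= x <= g j.+1 -> lam x <= M.
Proof.
move=> jn x /andP[x1 x2]; apply: lM; rewrite (le_trans (g_ge j))//=.
by rewrite (le_trans x2)// g_le.
Qed.

Let sum_h : \sum_(j < n.+1) h = t - s.
Proof. by rewrite sumr_const card_ord -[LHS]mulr_natr hE divfK ?pnatr_eq0. Qed.

(** Sum of [potential_step] over the pieces: the left side telescopes, and the
    expected number of pieces with an event is at most M (t - s). *)
Lemma occupation_bound :
  delta * \sum_(j < n.+1) Pr P (Hit j `&` N (g j) (g j.+1) 0)
  <= 4 * S * (1 + M * (t - s)).
Proof.
have c0 := hc.
rewrite -(ler_pM2l c0) mulrA.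
have bHN j : bmeas (\1_(Hit j `&` N (g j) (g j.+1) 0) : Omega -> R).
  by apply: bmeas_indic; exact: measurableI.
have bN j : bmeas (\1_(~` N (g j) (g j.+1) 0) : Omega -> R).
  by apply: bmeas_indic; exact: measurableC.
have -> : c * delta * \sum_(j < n.+1) Pr P (Hit j `&` N (g j) (g j.+1) 0) =
    Ex P (fun w => \sum_(j < n.+1) c * delta * \1_(Hit j `&` N (g j) (g j.+1) 0) w).
  rewrite (@Ex_sum _ _ _ P n.+1 (fun j w => c * delta * \1_(Hit j `&` N (g j) (g j.+1) 0) w)).
    rewrite mulr_sumr; apply: eq_bigr => j _.
    by rewrite ExZ ?Ex_indic//; exact: measurableI.
  by move=> j; exact: bmeasZ.
apply: (@le_trans _ _ (Ex P (fun w => 4 * c * S + 4 * c * S *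
    \sum_(j < n.+1) \1_(~` N (g j) (g j.+1) 0) w))).
  apply: le_Ex.
  - apply: (@bmeas_sum _ _ _ n.+1 (fun j w => c * delta * \1_(Hit j `&` N (g j) (g j.+1) 0) w)).
    by move=> j; exact: bmeasZ.
  - apply: bmeasD; first exact: bmeas_cst.
    by apply: bmeasZ; apply: (@bmeas_sum _ _ _ n.+1 (fun j => \1_(~` N (g j) (g j.+1) 0))).
  - move=> w; apply: (@le_trans _ _ (\sum_(j < n.+1)
      (W j.+1 w * Psi (Y j.+1 w) - W j w * Psi (Y j w)
       + 4 * c * S * \1_(~` N (g j) (g j.+1) 0) w))).
      by apply: ler_sum => j _; exact: potential_step.
    rewrite big_split/= -mulr_sumr lerD2r.
    rewrite -(big_mkord xpredT (fun j => W j.+1 w * Psi (Y j.+1 w) - W j w * Psi (Y j w))).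
    rewrite telescope_sumr//.
    have bound i : `|W i w * Psi (Y i w)| <= 2 * c * S.
      by rewrite normrM (ger0_norm (Psi_ge0 _)) ler_pM.
    by have := bound 0%N; have := bound n.+1; rewrite !ler_norml =>
      /andP[_ ?] /andP[? _]; lra.
rewrite ExD; last 2 first.
- exact: bmeas_cst.
- by apply: bmeasZ; apply: (@bmeas_sum _ _ _ n.+1 (fun j => \1_(~` N (g j) (g j.+1) 0))).
rewrite Ex_cst ExZ; last by apply: (@bmeas_sum _ _ _ n.+1 (fun j => \1_(~` N (g j) (g j.+1) 0))).
rewrite (@Ex_sum _ _ _ P n.+1 (fun j => \1_(~` N (g j) (g j.+1) 0)))//.
rewrite -[X in X + _]mulr1 -mulrDr !mulrA (mulrC c 4) ler_wpM2l//.
  by rewrite !mulr_ge0// ltW.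
rewrite lerD2l -sum_h mulr_sumr; apply: ler_sum => j _.
rewrite Ex_indic; last exact: measurableC.
have := Pr_some_event (g_gt0 j) (g_mono (leqnSn j)) (lM_piece (ltn_ord j)).
by rewrite gB.
Qed.

Let Null j := V (g j) @^-1` [set v] `&` N (g j) (g j.+1) 1 `&` V (g j.+1) @^-1` [set v].

Let Pr_Null j : Pr P (Null j) = 0.
Proof.
have := @transition (g j) (g j.+1) setT v v (ltW (g_gt0 j)) _ _ measurableT sv sv.
rewrite gS ltrDl h0 !setTI /Null gS => -> //.
  by rewrite /jump_proba; case: eqP => _; rewrite mul0r.
exact: (@measurableT _ (g_sigma_algebraType _)).
Qed.

(** Going back from [t] piece by piece as long as there is no event, the first
    piece with an event carries several events, or one event and a transition
    from [v] to [v], which has probability 0, or a transition from another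
    state. *)
Let last_event w : V t w = v -> a <= X t w <= b -> ~ N s t 0 w ->
  exists2 j : nat, (j < n.+1)%N &
    [\/ N_ge2 (g j) (g j.+1) w, Null j w | (Hit j `&` N (g j) (g j.+1) 1) w].
Proof.
move=> Vt Xt Nst; apply: contrapT => noj.
suff H k : (k <= n.+1)%N -> N (g (n.+1 - k)) t 0 w.
  by apply: Nst; have := H n.+1 (leqnn _); rewrite subnn /g mul0r addr0.
elim: k => [_|k ih kn].
  by rewrite subn0 g_last N_eq0E/= set_itvoc0 setI0.
have {ih} := ih (ltnW kn); set j := (n.+1 - k.+1)%N.
have jS : (n.+1 - k)%N = j.+1 by rewrite /j -subSn.
have jn : (j < n.+1)%N by rewrite -jS leq_subr.
rewrite jS => Njt.
have [gj0 gjS] := piece j; have gjt := g_le jn.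
have gjS0 := ltW (g_gt0 j.+1).
have [N0|N0] := pselect (N (g j) (g j.+1) 0 w); first exact: N_eq0_cat Njt.
exfalso; apply: noj; exists j => //.
have VS : V (g j.+1) w = v.
  rewrite -Vt (velocity_constant hV gjS0 gjt)//.
  by move: Njt; rewrite N_eq0E.
have [N1|N1] := pselect (N (g j) (g j.+1) 1 w); last first.
  by apply: Or31 => -[].
have [Vj|Vj] := pselect (V (g j) w = v); first by apply: Or32; split.
apply: Or33; split => //; split => //=.
have := position_constant gjS0 gjt Njt; rewrite VS => Xt'.
have := position_lipschitz w gj0 gjS.
rewrite gB ler_norml => /andP[l1 l2].
rewrite /Y /a' /b'; have [x1 x2] := andP Xt.
have vh : `|v * h| <= delta.
  rewrite normrM (gtr0_norm h0) deltaE ler_pM2r//.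
  by case: sv => ->; rewrite ?normr0 ?normrN ?gtr0_norm// ltW.
move: vh; rewrite ler_norml => /andP[v1 v2].
have E1 : v * (t - g j.+1) = v * t - v * g j - v * h by rewrite gS; ring.
rewrite E1 in Xt'; rewrite -deltaE in l1 l2.
by apply/andP; split; lra.
Qed.

(** The pieces with several events contribute O(h) in total.  For a single event,
    [Pr_one_event] converts the probability into the rate times a probability
    of no event, to which [occupation_bound] applies; the length [h] of a piece
    cancels against delta = c h. *)
Lemma Pr_last_event :
  Pr P ([set w | V t w = v] `&` X t @^-1` `[a, b] `&` ~` N s t 0) <=
  M ^+ 2 * (t - s) * h + 4 * M / c * S * (1 + M * (t - s)).
Proof.
have t0 : 0 <= t by rewrite ltW// (lt_trans s0).
set A := _ `&` _.
have mA : measurable A.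
  apply: measurableI; last by apply: measurableC; apply: measurable_N; exact: ltW.
  apply: measurableI; first exact: measurable_V_eq.
  by rewrite -[X in measurable X]setTI; exact: measurable_position.
have mNull j : measurable (Null j).
  by apply: measurableI; [apply: measurableI|]; rewrite ?measurable_V_eq//; exact: measurable_V_eq.
have mHN j : measurable (Hit j `&` N (g j) (g j.+1) 1) by exact: measurableI.
have mN2 j : measurable (N_ge2 (g j) (g j.+1)).
  by case: (piece j) => *; exact: measurable_N_ge2.
pose F j w : R := \1_(N_ge2 (g j) (g j.+1)) w + \1_(Null j) w
  + \1_(Hit j `&` N (g j) (g j.+1) 1) w.
have bF j : bmeas (F j).
  by apply: bmeasD; [apply: bmeasD|]; exact: bmeas_indic.
have : Pr P A <= \sum_(j < n.+1) Ex P (F j).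
  rewrite -Ex_sum// -Ex_indic//; apply: le_Ex; first exact: bmeas_indic.
    exact: (@bmeas_sum _ _ _ n.+1 F).
  have F0 j w : 0 <= F j w by rewrite /F !indicE !addr_ge0.
  move=> w; rewrite indicE; case: (boolP (w \in A)) => [|_]; last exact: sumr_ge0.
  rewrite inE => -[[/= Vt]]; rewrite in_itv/= => Xt Nst.
  have [j jn Hj] := last_event Vt Xt Nst.
  rewrite (bigD1 (Ordinal jn))//= -[leLHS]addr0 lerD//; last exact: sumr_ge0.
  rewrite /F !indicE -!natrD ler1n.
  by case: Hj => /mem_set ->; rewrite ?addnS ?addSn.
move=> /le_trans; apply.
apply: (@le_trans _ _ (\sum_(j < n.+1) ((M * h) ^+ 2 +
    M * h * Pr P (Hit j `&` N (g j) (g j.+1) 0)))).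
  apply: ler_sum => j _; rewrite /F.
  have bNull : bmeas (\1_(Null j) : Omega -> R) by exact: bmeas_indic.
  have bN2 : bmeas (\1_(N_ge2 (g j) (g j.+1)) : Omega -> R) by exact: bmeas_indic.
  have bHN : bmeas (\1_(Hit j `&` N (g j) (g j.+1) 1) : Omega -> R) by exact: bmeas_indic.
  rewrite ExD//; last exact: bmeasD.
  rewrite ExD// !Ex_indic// Pr_Null addr0.
  have [gj0 gjS] := piece j.
  have Lj : L (g j) (g j.+1) <= M * h.
    by have := rate_integral_le (g_gt0 j) gjS (lM_piece (ltn_ord j)); rewrite gB.
  have L0 := rate_integral_ge0 hlam (g j.+1) gj0.
  apply: lerD.
    apply: (@le_trans _ _ (L (g j) (g j.+1) ^+ 2)); first exact: Pr_N_ge2.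
    have Mh0 : 0 <= M * h by rewrite mulr_ge0// ltW.
    by rewrite lerXn2r.
  rewrite (Pr_one_event (g_gt0 j) gjS (@Hit_past j)).
  by rewrite ler_wpM2r// Pr_ge0.
rewrite big_split/=; apply: lerD.
  have -> : \sum_(j < n.+1) (M * h) ^+ 2 = M ^+ 2 * h * \sum_(j < n.+1) h.
    by rewrite mulr_sumr; apply: eq_bigr => j _; ring.
  by rewrite sum_h mulrAC.
rewrite -mulr_sumr; have := occupation_bound; set Sg := \sum_(j < _) _ => ob.
have -> : M * h * Sg = M / c * (delta * Sg).
  by rewrite deltaE; field; rewrite gt_eqF.
have -> : 4 * M / c * S * (1 + M * (t - s)) = M / c * (4 * S * (1 + M * (t - s))).
  by field; rewrite gt_eqF.
by rewrite ler_wpM2l// divr_ge0// ltW.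
Qed.


End Occupation.

(** The mesh tends to 0 in [Pr_last_event]. *)
Lemma Pr_position_itv s t : 0 < s -> s < t -> exists K : R, forall a b, a <= b ->
  Pr P (X t @^-1` `[a, b] `&` ~` N s t 0) <= K * (b - a).
Proof.
move=> s0 st; have t0 : 0 < t := lt_trans s0 st.
have [M M0 lM] := rate_bounded hlam t s0.
pose K := 4 * M / c * (1 + M * (t - s)).
have mN0 : measurable (~` N s t 0).
  by apply: measurableC; apply: measurable_N; exact: ltW.
have K_state v a b : is_state v -> a <= b ->
    Pr P ([set w | V t w = v] `&` X t @^-1` `[a, b] `&` ~` N s t 0) <= K * (b - a).
  move=> sv ab; apply/ler_addgt0Pl => e e0.
  pose C := (M ^+ 2 * (t - s) + 6 * K * c) * (t - s).
  have C0 : 0 <= C.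
    rewrite mulr_ge0 ?subr_ge0 1?ltW// addr_gt0// !mulr_gt0 ?exprn_gt0 ?subr_gt0 ?invr_gt0//.
    by rewrite addr_gt0// mulr_gt0// subr_gt0.
  pose n := Num.truncn (C / e).
  have nC : C / n.+1%:R <= e.
    by rewrite ler_pdivrMr// mulrC -ler_pdivrMr// ltW// truncnS_gt.
  have := @Pr_last_event s t M v a b _ _ n s0 st M0 lM sv ab erefl erefl.
  move=> /le_trans; apply.
  rewrite (_ : _ + _ = C / n.+1%:R + K * (b - a)); first by rewrite lerD2r.
  have : n.+1%:R != 0 :> R by rewrite pnatr_eq0.
  have : c != 0 by rewrite gt_eqF.
  by rewrite /C /K; move: n.+1%:R => q cz qz; field; rewrite cz qz.
exists (3 * K) => a b ab.
have mX : measurable (X t @^-1` `[a, b] `&` ~` N s t 0).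
  apply: measurableI => //.
  by rewrite -[X in measurable X]setTI; apply: measurable_position => //; exact: ltW.
rewrite (split_velocity (ltW t0) mX).
have E0 v : X t @^-1` `[a, b] `&` ~` N s t 0 `&` V t @^-1` [set v] =
    [set w | V t w = v] `&` X t @^-1` `[a, b] `&` ~` N s t 0.
  by rewrite setIC setIA.
rewrite !E0.
have := K_state c a b (Or31 _ _ erefl) ab.
have := K_state 0 a b (Or32 _ _ erefl) ab.
have := K_state (- c) a b (Or33 _ _ erefl) ab.
lra.
Qed.

(** A null set is covered by intervals of small total length, each of which has
    a probability proportional to its length. *)
Lemma Pr_position_null_after s t (Z : set R) : 0 < s -> s < t ->
  measurable Z -> lebesgue_measure Z = 0%E ->
  Pr P (X t @^-1` Z `&` ~` N s t 0) = 0.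
Proof.
move=> s0 st mZ Z0; have t0 : 0 <= t := ltW (lt_trans s0 st).
have [K KP] := Pr_position_itv s0 st.
have mN0 : measurable (~` N s t 0).
  by apply: measurableC; apply: measurable_N; exact: ltW.
have mX (B : set R) : measurable B -> measurable (X t @^-1` B `&` ~` N s t 0).
  move=> mB; apply: measurableI => //.
  by rewrite -[X in measurable X]setTI; exact: measurable_position.
have K0 : 0 <= K.
  by have := KP 0 1 ler01; rewrite subr0 mulr1; apply: le_trans; exact: Pr_ge0.
apply/eqP; rewrite eq_le Pr_ge0 andbT; apply/ler_addgt0Pl => e e0; rewrite addr0.
have Ke : 0 < e / (K + 1) by rewrite divr_gt0// ltr_wpDl.
have : (ereal_inf [set (\sum_(k <oo) (@wlength R idfun) (F k))%E | F in open_itv_cover Z]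
   < (e / (K + 1))%:E)%E.
  by rewrite -outer_measure_open_itv_cover [X in (X < _)%E](_ : _ = 0%E) ?lte_fin.
move=> /ereal_inf_lt[_ /= [F [Fitv ZF] <-] Fe].
have mF k : measurable (F k) by have [ab ->] := Fitv k.
rewrite -lee_fin -PrE; last exact: mX.
apply: (@le_trans _ _ (\sum_(k <oo) P (X t @^-1` (F k) `&` ~` N s t 0))%E).
  apply: measure_sigma_subadditive => //.
  - by move=> k; exact: mX.
  - exact: mX.
  - by move=> w [/ZF[k _ Fk] Nw]; exists k.
apply: (@le_trans _ _ (\sum_(k <oo) (K%:E * (@wlength R idfun) (F k)))%E).
  apply: lee_nneseries => // k _.
  have [[a b] /= Fab] := Fitv k; rewrite Fab wlength_itv/= lte_fin.
  rewrite PrE; last exact: mX.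
  case: ifPn => [ab|]; last first.
    rewrite -leNgt => ba; rewrite set_itv_ge ?preimage_set0 ?set0I; last by rewrite bnd_simp -leNgt.
    by rewrite /Pr measure0 mule0.
  rewrite -EFinB -EFinM lee_fin (le_trans _ (KP a b (ltW ab)))//.
  apply: le_Pr; [exact: mX|exact: mX|apply: setSI].
  by apply: preimage_subset; exact: subset_itv_oo_cc.
rewrite nneseriesZl//.
apply: (@le_trans _ _ (K%:E * (e / (K + 1))%:E)%E).
  by rewrite lee_wpmul2l ?lee_fin// ltW.
by rewrite -EFinM lee_fin mulrA ler_pdivrMr ?ltr_wpDl// mulrC ler_pM2l// lerDl.
Qed.

(** The rate may have an infinite integral at 0, so that (0, t] is reached
    through the intervals (t / n, t]. *)
Lemma Pr_position_null t (Z : set R) : 0 < t ->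
  measurable Z -> lebesgue_measure Z = 0%E ->
  Pr P (X t @^-1` Z `&` ~` N 0 t 0) = 0.
Proof.
move=> t0 mZ Z0.
have mX s : 0 <= s -> s <= t -> measurable (X t @^-1` Z `&` ~` N s t 0).
  move=> s0 st; apply: measurableI => //.
    by rewrite -[X in measurable X]setTI; apply: measurable_position => //; exact: ltW.
  by apply: measurableC; exact: measurable_N.
have ts n : 0 < t / n.+2%:R < t.
  by rewrite divr_gt0//= ltr_pdivrMr// ltr_pMr// ltr1n.
suff : (P (X t @^-1` Z `&` ~` N 0 t 0) <= 0)%E.
  rewrite PrE; last by apply: mX => //; exact: ltW.
  by rewrite lee_fin => ?; apply/eqP; rewrite eq_le Pr_ge0 andbT.
apply: (@le_trans _ _ (\sum_(n <oo) P (X t @^-1` Z `&` ~` N (t / n.+2%:R) t 0))%E).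
  apply: measure_sigma_subadditive.
  - by move=> n; have /andP[? ?] := ts n; apply: mX; exact: ltW.
  - by apply: mX => //; exact: ltW.
  - move=> w [Zw]; rewrite N_eq0E/= => /eqP/set0P[x [Ex]].
    rewrite /= in_itv/= => /andP[x0 xt].
    exists (Num.truncn (t / x)) => //; split => //; rewrite N_eq0E/=.
    apply/eqP/set0P; exists x; split => //=; rewrite in_itv/= xt andbT.
    rewrite ltr_pdivrMr// mulrC -ltr_pdivrMr//.
    by rewrite (lt_le_trans (truncnS_gt _))// ler_nat.
rewrite eseries0// => n _ _.
have /andP[? ?] := ts n; rewrite PrE; last by apply: mX; exact: ltW.
by rewrite Pr_position_null_after.
Qed.

(** * Moments of the velocity along a test function *)

Definition states : seq R := [:: c; 0; - c].

Definition moment (g psi : R -> R) (t : R) : R :=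
  Ex P (fun w => psi (X t w) * g (V t w)).

Definition jump_mean (g : R -> R) (u : R) : R :=
  \sum_(v <- states) jump_proba u v * g v.

Lemma state_sum (g : R -> R) t w : 0 <= t ->
  g (V t w) = \sum_(v <- states) g v * \1_(V t @^-1` [set v]) w.
Proof.
move=> t0; have c0 := hc; rewrite !big_cons big_nil addr0 !indicE.
have mem v : (w \in V t @^-1` [set v]) = (V t w == v).
  by apply/idP/eqP => [|Vv]; rewrite inE.
rewrite !mem; case: (velocity_states hV w t0) => ->; rewrite eqxx.
- by rewrite (gt_eqF c0) [c == - c]gt_eqF ?mulr1 ?mulr0 ?addr0//; lra.
- by rewrite (lt_eqF c0) [0 == - c]gt_eqF ?mulr1 ?mulr0 ?addr0 ?add0r//; lra.
- by rewrite [- c == c]lt_eqF ?[- c == 0]lt_eqF ?mulr1 ?mulr0 ?addr0 ?add0r//; lra.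
Qed.

Lemma bmeas_velocity (g : R -> R) t : 0 <= t -> bmeas (fun w => g (V t w)).
Proof.
move=> t0; rewrite (_ : (fun w => _) =
    fun w => \sum_(v <- states) g v * \1_(V t @^-1` [set v]) w); last first.
  by apply/funext => w; exact: state_sum.
elim: states => [|v l ih].
  by under eq_fun do rewrite big_nil; exact: bmeas_cst.
under eq_fun do rewrite big_cons; apply: bmeasD => //; apply: bmeasZ.
by apply: bmeas_indic; exact: measurable_V_eq.
Qed.

Lemma bmeas_position (psi : R -> R) t : 0 <= t -> bmeas psi ->
  bmeas (fun w => psi (X t w)).
Proof. by move=> t0 bp; apply: bmeas_comp => //; exact: measurable_position. Qed.

Lemma Ex_sum_seq (l : seq R) (F : R -> Omega -> R) : (forall v, bmeas (F v)) ->
  Ex P (fun w => \sum_(v <- l) F v w) = \sum_(v <- l) Ex P (F v)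
  /\ bmeas (fun w => \sum_(v <- l) F v w).
Proof.
move=> bF; elim: l => [|v l [ih1 ih2]].
  under eq_fun do rewrite big_nil; rewrite big_nil.
  by split; [exact: Ex_cst|exact: bmeas_cst].
under eq_fun do rewrite big_cons; split; last exact: bmeasD.
by rewrite ExD// ih1 big_cons.
Qed.

Lemma state_in v : v \in states -> is_state v.
Proof.
by rewrite !inE => /or3P[] /eqP ->; [exact: Or31|exact: Or32|exact: Or33].
Qed.

(** The number of events after [s] is independent of the position and velocity
    at time [s]. *)
Lemma moment_N (g psi : R -> R) s t k : 0 <= s -> s <= t -> bmeas psi ->
  Ex P (fun w => psi (X s w) * g (V s w) * \1_(N s t k) w) =
  Pr P (N s t k) * moment g psi s.
Proof.
move=> s0 st bp; have mN := measurable_N k s0 st.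
have mV v := measurable_V_eq s v.
have bF D v : measurable D ->
    bmeas (fun w => g v * (psi (X s w) * \1_D w)).
  move=> mD; apply: bmeasZ; apply: bmeasM; first exact: bmeas_position.
  exact: bmeas_indic.
rewrite /moment.
transitivity (Ex P (fun w => \sum_(v <- states)
    g v * (psi (X s w) * \1_(V s @^-1` [set v] `&` N s t k) w))).
  congr Ex; apply/funext => w; rewrite (state_sum g w s0) mulr_sumr mulr_suml.
  by apply: eq_bigr => v _; rewrite indicI/=; ring.
transitivity (Pr P (N s t k) * Ex P (fun w => \sum_(v <- states)
    g v * (psi (X s w) * \1_(V s @^-1` [set v]) w))); last first.
  congr (_ * Ex _ _); apply/funext => w; rewrite (state_sum g w s0) mulr_sumr.
  by apply: eq_bigr => v _; ring.
rewrite (Ex_sum_seq _ (fun v => bF _ v (measurableI _ _ (mV v) mN))).1.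
rewrite (Ex_sum_seq _ (fun v => bF _ v (mV v))).1 mulr_sumr.
apply: eq_bigr => v _; rewrite !ExZ//; first last.
- by apply: bmeasM; [exact: bmeas_position|apply: bmeas_indic; exact: measurableI].
- by apply: bmeasM; [exact: bmeas_position|exact: bmeas_indic].
rewrite mulrCA; congr (_ * _).
apply: Ex_transfer => //; [exact: measurable_position|exact: measurableI|].
move=> B mB; rewrite setIA -PrE// muleC; apply: past_indep => //.
by apply: pastI; [exact: position_past|exact: velocity_past].
Qed.

(** The transition rule, averaged over the states at times [s] and [t]. *)
Lemma moment_N1 (g psi : R -> R) s t : 0 <= s -> s < t -> bmeas psi ->
  Ex P (fun w => psi (X s w) * g (V t w) * \1_(N s t 1) w) =
  Pr P (N s t 1) * moment (jump_mean g) psi s.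
Proof.
move=> s0 st bp; have mN := measurable_N 1 s0 (ltW st).
have t0 : 0 <= t by lra.
pose D u v := V s @^-1` [set u] `&` N s t 1 `&` V t @^-1` [set v].
have mVs v := measurable_V_eq s v; have mVt v := measurable_V_eq t v.
have mD u v : measurable (D u v) by apply: measurableI => //; exact: measurableI.
have bpD A : measurable A -> bmeas (fun w => psi (X s w) * \1_A w).
  by move=> mA; apply: bmeasM; [exact: bmeas_position|exact: bmeas_indic].
have one w : (1 : R) = \sum_(u <- states) \1_(V s @^-1` [set u]) w.
  have := state_sum (cst 1) w s0; rewrite /= => {1}->.
  by apply: eq_bigr => v _; rewrite mul1r.
transitivity (Ex P (fun w => \sum_(u <- states) \sum_(v <- states)
    g v * (psi (X s w) * \1_(D u v) w))).
  congr Ex; apply/funext => w.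
  rewrite -[LHS]mulr1 (one w) mulr_sumr; apply: eq_bigr => u _.
  rewrite (state_sum g w t0) mulr_sumr !mulr_suml.
  by apply: eq_bigr => v _; rewrite /D !indicI/=; ring.
have b1 u v : bmeas (fun w => g v * (psi (X s w) * \1_(D u v) w)).
  by apply: bmeasZ; exact: bpD.
have b2 u : bmeas (fun w => \sum_(v <- states) g v * (psi (X s w) * \1_(D u v) w)).
  exact: (Ex_sum_seq states (b1 u)).2.
rewrite (Ex_sum_seq _ b2).1 /moment.
transitivity (Pr P (N s t 1) * Ex P (fun w => \sum_(u <- states)
    jump_mean g u * (psi (X s w) * \1_(V s @^-1` [set u]) w))); last first.
  congr (_ * Ex _ _); apply/funext => w.
  rewrite (state_sum (jump_mean g) w s0) mulr_sumr.
  by apply: eq_bigr => v _; ring.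
have b3 u : bmeas (fun w => jump_mean g u * (psi (X s w) * \1_(V s @^-1` [set u]) w)).
  by apply: bmeasZ; exact: bpD.
rewrite (Ex_sum_seq _ b3).1 mulr_sumr; apply: eq_big_seq => u us.
rewrite (Ex_sum_seq _ (b1 u)).1 ExZ; last exact: bpD.
rewrite /jump_mean mulr_suml mulr_sumr; apply: eq_big_seq => v vs.
rewrite ExZ; last exact: bpD.
rewrite (_ : Ex P _ = jump_proba u v * Pr P (N s t 1) *
    Ex P (fun w => psi (X s w) * \1_(V s @^-1` [set u]) w)); first ring.
apply: Ex_transfer => //; first exact: measurable_position.
move=> B mB.
have pA : past s (X s @^-1` B) by exact: position_past.
have mA : measurable (X s @^-1` B) by apply: measurable_past; exact: pA.
have mAV : measurable (X s @^-1` B `&` V s @^-1` [set u]) by exact: measurableI.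
rewrite !setIA !PrE//; last first.
  by apply: measurableI => //; exact: measurableI.
rewrite transition//; [|by apply: past_history|exact: state_in|exact: state_in].
rewrite -EFinM; congr (_%:E); rewrite -mulrA; congr (_ * _).
have pAV : past s (X s @^-1` B `&` V s @^-1` [set u]).
  by apply: pastI => //; exact: velocity_past.
by rewrite (@Pr_past_indep s t 1 _ s0 (ltW st) pAV) mulrC.
Qed.

Lemma jump_mean_le (g : R -> R) (G : R) : (forall v, is_state v -> `|g v| <= G) ->
  forall u, is_state u -> `|jump_mean g u| <= G.
Proof.
move=> gG u su.
have gc := gG c (Or31 _ _ erefl); have g0 := gG 0 (Or32 _ _ erefl).
have gN := gG (- c) (Or33 _ _ erefl).
have c0 : (c == 0) = false by rewrite gt_eqF.
have cN : (- c == 0) = false by rewrite oppr_eq0 gt_eqF.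
rewrite /jump_mean /states !big_cons big_nil addr0 /jump_proba eqxx c0 cN.
move: gc g0 gN; rewrite !ler_norml => /andP[? ?] /andP[? ?] /andP[? ?].
by case: su => ->; rewrite ?eqxx ?c0 ?cN; apply/andP; split; lra.
Qed.

Lemma normr_moment_le (g psi : R -> R) K G t : 0 <= t -> bmeas psi ->
  bounded_by K psi -> (forall v, is_state v -> `|g v| <= G) ->
  `|moment g psi t| <= K * G.
Proof.
move=> t0 bp pK gG; apply: normr_Ex_cst.
  by apply: bmeasM; [exact: bmeas_position|exact: bmeas_velocity].
move=> w; rewrite normrM ler_pM//.
by apply: gG; have := velocity_states hV w t0.
Qed.

(** Split according to the number of events in (s, t].  Without event, Taylor's
    formula applies along the straight line; with one event, the displacement
    is bounded by c (t - s) and [moment_N1] gives the mean of [g] after the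
    jump; several events have probability at most L^2.  The probabilities
    exp(-L) and L exp(-L) are replaced by 1 - L and L up to O(L^2). *)
Lemma moment_increment (g psi dpsi : R -> R) K G s t M :
  0 < s -> s <= t -> (forall x, s <= x <= t -> lam x <= M) ->
  C2_bounded K psi dpsi -> (forall v, is_state v -> `|g v| <= G) ->
  `|moment g psi t - moment g psi s
    - (t - s) * moment (fun v => v * g v) dpsi s
    - L s t * (moment (jump_mean g) psi s - moment g psi s)|
  <= 3 * (K * G) * (c * (t - s) + L s t) ^+ 2.
Proof.
move=> s0 st lM Kpsi gG.
have [<-{t st lM}|ts] := eqVneq s t.
  have -> : L s s = 0.
    by rewrite /rate_integral /cumulative_rate set_itvoc0 integral_set0.
  by rewrite !subrr !mul0r !subr0 normr0 mulr0 addr0 expr0n mulr0.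
have {}st : s < t by rewrite lt_neqAle ts.
have [bp bd pK dK lipK taylK] := Kpsi.
have s0' := ltW s0; have st' := ltW st; have t0 : 0 <= t by lra.
have K0 : 0 <= K by rewrite (le_trans _ (pK 0)).
have G0 : 0 <= G by rewrite (le_trans _ (gG c (Or31 _ _ erefl))).
have c0 := ltW hc; set h := t - s; have h0 : 0 <= h by rewrite subr_ge0.
set l := L s t; have l0 : 0 <= l by exact: rate_integral_ge0.
have mN k := measurable_N k s0' st'.
have mN2 := measurable_N_ge2 s0' st'.
have bN k : bmeas (\1_(N s t k) : Omega -> R) by exact: bmeas_indic.
have bN2 : bmeas (\1_(N_ge2 s t) : Omega -> R) by exact: bmeas_indic.
have bX r (phi : R -> R) : 0 <= r -> bmeas phi -> bmeas (fun w => phi (X r w)) by move=> *; exact: bmeas_position.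
have bV r (f : R -> R) : 0 <= r -> bmeas (fun w => f (V r w)) by move=> *; exact: bmeas_velocity.
have gV r w : 0 <= r -> `|g (V r w)| <= G.
  by move=> r0; apply: gG; have := velocity_states hV w r0.
have bT : bmeas (fun w => psi (X t w) * g (V t w)).
  by apply: bmeasM; [exact: bX|exact: (bV _ g)].
have bS1 : bmeas (fun w => psi (X s w) * g (V s w)).
  by apply: bmeasM; [exact: bX|exact: (bV _ g)].
have bS2 : bmeas (fun w => dpsi (X s w) * (V s w * g (V s w))).
  by apply: bmeasM; [exact: bX|exact: (bV _ (fun v => v * g v))].
have bS3 : bmeas (fun w => psi (X s w) * g (V t w)).
  by apply: bmeasM; [exact: bX|exact: (bV _ g)].
set m := moment g psi s; set m' := moment _ dpsi s; set j := moment _ psi s.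
have e0 : `|Ex P (fun w => (psi (X t w) * g (V t w)) * \1_(N s t 0) w)
    - expR (- l) * (m + h * m')| <= K * G * (c * h) ^+ 2.
  rewrite mulrDr (mulrCA _ h) -Pr_N0// -/h -!moment_N//.
  rewrite -ExZ; last by apply: bmeasM.
  rewrite -ExD; first last.
  - by apply: bmeasZ; apply: bmeasM.
  - by apply: bmeasM.
  rewrite -ExB; first last.
  - by apply: bmeasD; [|apply: bmeasZ]; apply: bmeasM.
  - by apply: bmeasM.
  apply: normr_Ex_cst.
    by apply: bmeasB; [|apply: bmeasD; [|apply: bmeasZ]]; apply: bmeasM.
  move=> w; rewrite indicE; have [Nw|Nw] := boolP (w \in N s t 0); last first.
    by rewrite !mulr0 addr0 subr0 normr0 !mulr_ge0// exprn_ge0// mulr_ge0.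
  rewrite !mulr1; move: Nw; rewrite inE => Nw.
  have Vt : V t w = V s w.
    by rewrite (velocity_constant hV s0' st')//; move: Nw; rewrite N_eq0E.
  rewrite Vt (_ : _ - _ = (psi (X t w) - psi (X s w)
     - (X t w - X s w) * dpsi (X s w)) * g (V s w)); last first.
    by rewrite (position_constant s0' st' Nw) -/h; ring.
  rewrite normrM [leRHS]mulrAC; apply: ler_pM => //; last exact: gV.
  apply: le_trans (taylK _ _) _; rewrite ler_wpM2l//.
  rewrite -[leLHS]real_normK ?num_real// lerXn2r ?nnegrE ?mulr_ge0//.
  exact: position_lipschitz.
have e1 : `|Ex P (fun w => (psi (X t w) * g (V t w)) * \1_(N s t 1) w)
    - l * expR (- l) * j| <= K * G * (c * h) * l.
  rewrite -Pr_N1// -moment_N1// -ExB; try by apply: bmeasM.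
  apply: (@le_trans _ _ (K * G * (c * h) * Pr P (N s t 1))).
    apply: normr_Ex_indic => //; first by apply: bmeasB; apply: bmeasM.
    move=> w; rewrite -mulrBl normrM [X in _ * X]ger0_norm ?indicE//.
    rewrite ler_wpM2r// -mulrBl normrM [leRHS]mulrAC; apply: ler_pM => //; last exact: gV.
    apply: le_trans (lipK _ _) _; rewrite ler_wpM2l//.
    exact: position_lipschitz.
  rewrite ler_wpM2l ?mulr_ge0// Pr_N1// ler_piMr//.
  by rewrite expR_le1 oppr_le0.
have e2 : `|Ex P (fun w => (psi (X t w) * g (V t w)) * \1_(N_ge2 s t) w)|
    <= K * G * l ^+ 2.
  apply: (@le_trans _ _ (K * G * Pr P (N_ge2 s t))).
    apply: normr_Ex_indic => //; first by apply: bmeasM.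
    move=> w; rewrite !normrM [X in _ * X]ger0_norm ?indicE//.
    by rewrite ler_wpM2r//; apply: ler_pM => //; exact: gV.
  by rewrite ler_wpM2l ?mulr_ge0//; exact: Pr_N_ge2.
have -> : moment g psi t =
    Ex P (fun w => (psi (X t w) * g (V t w)) * \1_(N s t 0) w) +
    Ex P (fun w => (psi (X t w) * g (V t w)) * \1_(N s t 1) w) +
    Ex P (fun w => (psi (X t w) * g (V t w)) * \1_(N_ge2 s t) w).
  rewrite -ExD; try by apply: bmeasM.
  rewrite -ExD; [|by apply: bmeasD; apply: bmeasM|by apply: bmeasM].
  congr Ex; apply/funext => w; rewrite -!mulrDr -[LHS]mulr1; congr (_ * _).
  rewrite !indicE /N_ge2 in_setC in_setU.
  have := N_eq_disjoint s t; rewrite -subset0 => /(_ w).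
  have [] := boolP (w \in N s t 0); have [] := boolP (w \in N s t 1);
    rewrite ?inE /= => n1 n2 H; rewrite ?addr0 ?add0r//.
  by exfalso; apply: H.
have [x1 x2] := expRN_bounds l0.
have mle : `|m| <= K * G by exact: normr_moment_le.
have jle : `|j| <= K * G.
  by apply: normr_moment_le => // v sv; exact: jump_mean_le sv.
have m'le : `|m'| <= K * G * c.
  rewrite -mulrA; apply: normr_moment_le => // v sv.
  rewrite normrM mulrC ler_pM//; first exact: gG.
  by case: sv => ->; rewrite ?normr0 ?normrN ?ger0_norm.
set y := expR (- l) in e0 e1 x1 x2 *.
set E0 := Ex P _ in e0 *; set E1 := Ex P _ in e1 *; set E2 := Ex P _ in e2 *.
rewrite (_ : _ - _ = (E0 - y * (m + h * m')) + (E1 - l * y * j) + E2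
   + (y - 1 + l) * m + (y - 1) * (h * m') + (y - 1) * (l * j)); last by ring.
have KG0 : 0 <= K * G by exact: mulr_ge0.
have f1 : `|(y - 1 + l) * m| <= K * G * l ^+ 2.
  by rewrite normrM mulrC ler_pM.
have f2 : `|(y - 1) * (h * m')| <= K * G * (c * h) * l.
  rewrite !normrM (ger0_norm h0) [leLHS]mulrC; apply: ler_pM => //.
    by rewrite mulr_ge0.
  by rewrite mulrA mulrC ler_wpM2r.
have f3 : `|(y - 1) * (l * j)| <= K * G * l ^+ 2.
  rewrite !normrM (ger0_norm l0) expr2 mulrA [leLHS]mulrC; apply: ler_pM => //.
    by rewrite mulr_ge0.
  by rewrite (mulrC l) ler_wpM2r.
apply: (@le_trans _ _ (K * G * (c * h) ^+ 2 + K * G * (c * h) * l + K * G * l ^+ 2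
   + K * G * l ^+ 2 + K * G * (c * h) * l + K * G * l ^+ 2)).
  by do 5 (apply: le_trans (ler_normD _ _) _; apply: lerD => //).
have : 0 <= K * G * (2 * (c * h) ^+ 2 + 4 * (c * h) * l).
  rewrite mulr_ge0// addr_ge0// ?mulr_ge0// ?exprn_ge0 ?mulr_ge0//.
rewrite -subr_ge0 => H; rewrite -subr_ge0; apply: le_trans H _.
by rewrite le_eqVlt; apply/orP; left; apply/eqP; ring.
Qed.

Lemma state_bound (g : R -> R) : exists2 G, 0 <= G & forall v, is_state v -> `|g v| <= G.
Proof.
exists (`|g c| + `|g 0| + `|g (- c)|); first by rewrite !addr_ge0.
move=> v [] ->; have := normr_ge0 (g c); have := normr_ge0 (g 0);
  have := normr_ge0 (g (- c)); lra.
Qed.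

(** Makes the coefficients of [moment_increment] regular enough for
    [is_derive_of_increments]. *)
Lemma moment_lipschitz (g psi dpsi : R -> R) K r s M :
  0 < r -> 0 <= M -> (forall x, r <= x <= s -> lam x <= M) -> C2_bounded K psi dpsi ->
  exists2 C, 0 <= C & forall t t', r <= t -> t <= t' -> t' <= s ->
    `|moment g psi t' - moment g psi t| <= C * (t' - t).
Proof.
move=> r0 M0 lM Kpsi; have [bp bd pK dK _ _] := Kpsi.
have K0 : 0 <= K by rewrite (le_trans _ (pK 0)).
have [G G0 gG] := state_bound g.
have [G' G'0 gG'] := state_bound (fun v => v * g v).
have [G'' G''0 gG''] := state_bound (jump_mean g).
have c0 := hc.
pose C := K * G' + M * (K * G'' + K * G) + 3 * (K * G) * (c + M) ^+ 2 * `|s - r|.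
have KG0 : 0 <= K * G by exact: mulr_ge0.
have KG'0 : 0 <= K * G' by exact: mulr_ge0.
have KG''0 : 0 <= K * G'' by exact: mulr_ge0.
exists C.
  have cM0 : 0 <= c + M by lra.
  by rewrite /C !addr_ge0// ?mulr_ge0// ?exprn_ge0// addr_ge0.
move=> t t' rt tt' t's.
have lM' x : t <= x <= t' -> lam x <= M by move=> /andP[? ?]; apply: lM; lra.
have t0 : 0 < t by lra.
have := @moment_increment g psi dpsi K G t t' M t0 tt' lM' Kpsi gG.
have := @normr_moment_le (fun v => v * g v) dpsi K G' t (ltW t0) bd dK gG'.
have := @normr_moment_le g psi K G t (ltW t0) bp pK gG.
have := @normr_moment_le (jump_mean g) psi K G'' t (ltW t0) bp pK gG''.
have LM := rate_integral_le t0 tt' lM'.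
have L0 := rate_integral_ge0 hlam t' (ltW t0).
set h := t' - t in LM *; set l := L t t' in LM L0 *.
set m := moment _ _ t; set j := moment _ _ t; set a := moment _ _ t; set m' := moment _ _ t'.
move=> H1 H2 H3 H4.
have h0 : 0 <= h by rewrite subr_ge0.
rewrite (_ : m' - j = (m' - j - h * a - l * (m - j)) + h * a + l * (m - j)); last ring.
apply: (@le_trans _ _ (3 * (K * G) * (c * h + l) ^+ 2 + h * (K * G') + (M * h) * (K * G'' + K * G))).
  apply: le_trans (ler_normD _ _) _; apply: lerD.
    apply: le_trans (ler_normD _ _) _; apply: lerD => //.
    by rewrite normrM ger0_norm// ler_wpM2l.
  rewrite normrM (ger0_norm L0); apply: ler_pM => //.
  by apply: le_trans (ler_normB _ _) _; apply: lerD.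
have hs : h <= `|s - r| by rewrite ger0_norm /h; lra.
have : (c * h + l) ^+ 2 <= (c + M) ^+ 2 * `|s - r| * h.
  apply: (@le_trans _ _ (((c + M) * h) ^+ 2)).
    have a1 : 0 <= c * h + l by rewrite addr_ge0// mulr_ge0// ltW.
    have a2 : 0 <= (c + M) * h by rewrite mulr_ge0// addr_ge0// ltW.
    by rewrite lerXn2r// mulrDl lerD2l.
  have cM0 : 0 <= c + M by lra.
  rewrite exprMn -mulrA ler_wpM2l ?exprn_ge0//.
  by rewrite expr2 ler_wpM2r.
move=> H5; have : 3 * (K * G) * (c * h + l) ^+ 2 <= 3 * (K * G) * ((c + M) ^+ 2 * `|s - r| * h).
  by rewrite ler_wpM2l// mulr_ge0.
rewrite /C; lra.
Qed.

(** The forward equation of the joint law of position and velocity, tested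
    against [psi] and [g]. *)
Lemma moment_is_derive (g psi dpsi ddpsi : R -> R) K K' t : 0 < t ->
  C2_bounded K psi dpsi -> C2_bounded K' dpsi ddpsi ->
  is_derive t 1 (moment g psi) (moment (fun v => v * g v) dpsi t
    + lam t * (moment (jump_mean g) psi t - moment g psi t)).
Proof.
move=> t0 Kpsi Kdpsi; have [bp bd pK dK _ _] := Kpsi.
have K0 : 0 <= K by rewrite (le_trans _ (pK 0)).
have t2 : 0 < t / 2 by rewrite divr_gt0.
have [M M0 lM] := rate_bounded hlam (t + t / 2) t2.
have M0' := ltW M0.
have [C1 C10 h1] := moment_lipschitz (fun v => v * g v) t2 M0' lM Kdpsi.
have [C2 C20 h2] := moment_lipschitz (jump_mean g) t2 M0' lM Kpsi.
have [C3 C30 h3] := moment_lipschitz g t2 M0' lM Kpsi.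
have [G G0 gG] := state_bound g.
pose B s := moment (jump_mean g) psi s - moment g psi s.
have c0 := hc.
pose Kb := 3 * (K * G) * (c + M) ^+ 2 + C1 + (C2 + C3) + M + `|B t|.
have T0 : 0 <= 3 * (K * G) * (c + M) ^+ 2.
  have cM0 : 0 <= c + M by lra.
  by rewrite mulr_ge0 ?exprn_ge0// !mulr_ge0.
have Bt0 := normr_ge0 (B t).
apply: (@is_derive_of_increments _ (moment g psi) (moment (fun v => v * g v) dpsi)
  B L t (t / 2) Kb (lam t)) => //.
- by rewrite /Kb; lra.
- move=> s s' rs ss' s'r.
  have rs' : t / 2 <= s by lra.
  have s0 : 0 < s by lra.
  have lM' x : s <= x <= s' -> lam x <= M by move=> /andP[? ?]; apply: lM; lra.
  have hh : 0 <= s' - s by lra.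
  have LM := rate_integral_le s0 ss' lM'.
  have L0 := rate_integral_ge0 hlam s' (ltW s0).
  have sq : (c * (s' - s) + L s s') ^+ 2 <= (c + M) ^+ 2 * (s' - s) ^+ 2.
    have a1 : 0 <= c * (s' - s) + L s s' by rewrite addr_ge0// mulr_ge0// ltW.
    have a2 : 0 <= (c + M) * (s' - s) by rewrite mulr_ge0// addr_ge0// ltW.
    by rewrite -exprMn lerXn2r// mulrDl lerD2l.
  split.
  + apply: le_trans (@moment_increment g psi dpsi K G s s' M s0 ss' lM' Kpsi gG) _.
    apply: (@le_trans _ _ (3 * (K * G) * ((c + M) ^+ 2 * (s' - s) ^+ 2))).
      by rewrite ler_wpM2l// !mulr_ge0.
    by rewrite mulrA ler_wpM2r ?exprn_ge0// /Kb; lra.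
  + by apply: le_trans (h1 _ _ rs' ss' s'r) _; rewrite ler_wpM2r// /Kb; lra.
  + rewrite (_ : B s' - B s = (moment (jump_mean g) psi s' - moment (jump_mean g) psi s)
       - (moment g psi s' - moment g psi s)); last by rewrite /B; ring.
    apply: (@le_trans _ _ (C2 * (s' - s) + C3 * (s' - s))).
      by apply: le_trans (ler_normB _ _) _; apply: lerD; [exact: h2|exact: h3].
    by rewrite -mulrDl ler_wpM2r// /Kb; lra.
  + by rewrite ger0_norm//; apply: le_trans LM _; rewrite ler_wpM2r// /Kb; lra.
- by rewrite /Kb; lra.
- move=> e e0; have [r r0 rP] := rate_integral_near hlam t0 e0.
  by exists r => // s s' rs ss' s'r; exact: rP.
Qed.

Definition vmoment (k : nat) (psi : R -> R) (t : R) : R :=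
  moment (fun v => v ^+ k) psi t.

Lemma eq_moment (g g' psi : R -> R) t : 0 <= t ->
  (forall v, is_state v -> g v = g' v) -> moment g psi t = moment g' psi t.
Proof.
move=> t0 gg'; congr Ex; apply/funext => w; congr (_ * _).
by apply: gg'; have := velocity_states hV w t0.
Qed.

Lemma jump_meanE (g : R -> R) :
  [/\ jump_mean g 0 = (g c + g (- c)) / 2, jump_mean g c = g 0 &
      jump_mean g (- c) = g 0].
Proof.
have c0 : (c == 0) = false by rewrite gt_eqF.
have cN : (- c == 0) = false by rewrite oppr_eq0 gt_eqF.
by split; rewrite /jump_mean !big_cons big_nil /jump_proba ?eqxx ?c0 ?cN ?eqxx; ring.
Qed.

(** The forward equation for the powers of the velocity closes up at order two,
    because v^3 = c^2 v on the states. *)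
Section VelocityMoments.
Variables (psi dpsi ddpsi : R -> R) (K K' t : R).
Hypotheses (t0 : 0 < t) (Kpsi : C2_bounded K psi dpsi)
  (Kdpsi : C2_bounded K' dpsi ddpsi).

Let bpsi : bmeas psi := C2_bmeas Kpsi.

Let momentD (g g' : R -> R) (a b : R) :
  moment (fun v => a * g v + b * g' v) psi t = a * moment g psi t + b * moment g' psi t.
Proof.
have t0' := ltW t0.
have bX g0 : bmeas (fun w => psi (X t w) * g0 (V t w)).
  by apply: bmeasM; [exact: bmeas_position|exact: bmeas_velocity].
rewrite /moment -!ExZ//; try exact: bX.
rewrite -ExD; try by apply: bmeasZ; exact: bX.
by congr Ex; apply/funext => w; ring.
Qed.

Lemma vmoment0_derive : is_derive t 1 (vmoment 0 psi) (vmoment 1 dpsi t).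
Proof.
apply: is_derive_eq.
  exact: (@moment_is_derive (fun v => v ^+ 0) psi dpsi ddpsi K K' t t0 Kpsi Kdpsi).
have t0' := ltW t0; have [j0 jc jN] := jump_meanE (fun v => v ^+ 0).
rewrite (@eq_moment (jump_mean _) (fun v => v ^+ 0))// ?subrr ?mulr0 ?addr0.
  by apply: eq_moment => // v _; rewrite expr0 mulr1 expr1.
by move=> v [] ->; rewrite ?j0 ?jc ?jN !expr0; field.
Qed.

Lemma vmoment1_derive :
  is_derive t 1 (vmoment 1 psi) (vmoment 2 dpsi t - lam t * vmoment 1 psi t).
Proof.
apply: is_derive_eq.
  exact: (@moment_is_derive (fun v => v ^+ 1) psi dpsi ddpsi K K' t t0 Kpsi Kdpsi).
have t0' := ltW t0; have [j0 jc jN] := jump_meanE (fun v => v ^+ 1).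
rewrite (@eq_moment (jump_mean _) (fun v => 0 * v + 0 * v))//.
  rewrite (momentD id id) /vmoment.
  rewrite (@eq_moment (fun v => v * v ^+ 1) (fun v => v ^+ 2))//; ring.
by move=> v [] ->; rewrite ?j0 ?jc ?jN !expr1; field.
Qed.

Lemma vmoment2_derive : is_derive t 1 (vmoment 2 psi)
  (c ^+ 2 * vmoment 1 dpsi t
   + lam t * (c ^+ 2 * vmoment 0 psi t - 2 * vmoment 2 psi t)).
Proof.
apply: is_derive_eq.
  exact: (@moment_is_derive (fun v => v ^+ 2) psi dpsi ddpsi K K' t t0 Kpsi Kdpsi).
have t0' := ltW t0; have [j0 jc jN] := jump_meanE (fun v => v ^+ 2).
have bd : bmeas dpsi := C2_bmeas Kdpsi.
rewrite (@eq_moment (jump_mean _) (fun v => c ^+ 2 * v ^+ 0 + (- 1) * v ^+ 2))//.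
  rewrite momentD (@eq_moment (fun v => v * v ^+ 2) (fun v => c ^+ 2 * v))//.
    rewrite /vmoment (_ : moment (fun v => c ^+ 2 * v) dpsi t =
      c ^+ 2 * moment (fun v => v ^+ 1) dpsi t).
      by ring.
    rewrite /moment -ExZ; first by congr Ex; apply/funext => w; ring.
    by apply: bmeasM; [exact: bmeas_position|exact: (@bmeas_velocity (fun v => v ^+ 1))].
  by move=> v [] ->; ring.
by move=> v [] ->; rewrite ?j0 ?jc ?jN ?expr0; field.
Qed.

End VelocityMoments.

(** * The weak equation *)
Lemma position0 w : X 0 w = 0.
Proof. by rewrite /position set_itv1 Rintegral_set1. Qed.

Lemma position_no_event t w : 0 <= t -> N 0 t 0 w -> X t w = V 0 w * t.
Proof.
by move=> t0 Nw; rewrite (position_constant (lexx 0) t0 Nw) position0 add0r subr0.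
Qed.

(** The singular part of the law is carried by a null set, hence by the paths
    without event, for which the position is V(0) t; there [psi] vanishes. *)
Lemma pairing_vmoment (p : R -> R -> R) (psi : R -> R) t : 0 < t ->
  ac_density (pushforward P (X t)) (fun x => p x t) -> bmeas psi ->
  psi 0 = 0 -> psi (c * t) = 0 -> psi (- (c * t)) = 0 ->
  pairing p psi t = vmoment 0 psi t.
Proof.
move=> t0 hp bp p0 pc pN; have t0' := ltW t0; have mX := measurable_position t0'.
have [Z [mZ Z0 HZ]] := density_pairing mX hp; rewrite /pairing HZ//.
have mXZ : measurable (X t @^-1` ~` Z).
  by rewrite -[X in measurable X]setTI; apply: mX => //; exact: measurableC.
have mA : measurable (X t @^-1` Z `&` ~` N 0 t 0).
  apply: measurableI; first by rewrite -[X in measurable X]setTI; exact: mX.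
  by apply: measurableC; exact: measurable_N.
have bpX : bmeas (fun w => psi (X t w)) by exact: bmeas_position.
have b1 : bmeas (fun w => psi (X t w) * \1_(X t @^-1` ~` Z) w).
  by apply: bmeasM => //; exact: bmeas_indic.
rewrite /vmoment /moment.
have -> : (fun w => psi (X t w) * V t w ^+ 0) = (fun w => psi (X t w)).
  by apply/funext => w; rewrite expr0 mulr1.
apply/eqP; rewrite -subr_eq0 -normr_le0 -ExB//.
have [C bC] := bp.2.
rewrite -(mulr0 C) -(Pr_position_null t0 mZ Z0).
apply: normr_Ex_indic => //; first exact: bmeasB.
move=> w; rewrite !indicE -[X in `|_ - X|]mulr1 -mulrBr.
have C0 : 0 <= C by rewrite (le_trans _ (bC 0)).
case: (boolP (w \in X t @^-1` ~` Z)) => wZ.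
  by rewrite subrr mulr0 normr0 mulr_ge0.
rewrite sub0r mulrN1 normrN.
have {}wZ : Z (X t w).
  by apply: contrapT => h; move/negP : wZ; apply; rewrite inE.
have [Nw|Nw] := pselect (N 0 t 0 w); last first.
  by rewrite mem_set ?mulr1//; split.
rewrite position_no_event//.
have -> : psi (V 0 w * t) = 0.
  case: (velocity_states hV w (lexx 0)) => ->; rewrite ?mul0r//.
  by rewrite mulNr.
by rewrite normr0 mulr_ge0.
Qed.

(** Only finitely many derivatives of the test function are used, which makes
    the result applicable to [spline_bump] as well as to test functions. *)
Section WeakEquation.
Variables (p : R -> R -> R) (phi : R -> R) (K : set R).
Hypotheses
  (hp : forall t, 0 < t -> ac_density (pushforward P (X t)) (fun x => p x t))
  (dphi : forall n x, (n < 6)%N -> derivable (derive1n n phi) x 1)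
  (cK : compact K) (phiK : forall x, ~ K x -> phi x = 0).

Let oK : open (~` K).
Proof. by apply: closed_openC; exact: compact_closed. Qed.

Let Dphi k := derive1n k phi.

Let Dphi0 k x : ~ K x -> Dphi k x = 0.
Proof.
elim: k x => [|k ih] x Kx; first exact: phiK.
by rewrite /Dphi derive1nS; exact: derive1_eq0 oK ih Kx.
Qed.

Let DphiS k : Dphi k.+1 = derive1 (Dphi k).
Proof. by rewrite /Dphi derive1nS. Qed.

Let Dphi_C2 k : (k < 4)%N -> exists C, C2_bounded C (Dphi k) (Dphi k.+1).
Proof.
move=> k4; rewrite DphiS; apply: (C2_bounded_compact cK (@Dphi0 k)) => n x n3.
have -> : derive1n n (Dphi k) = Dphi (n + k) by rewrite /Dphi /derive1n iterD.
by apply: dphi; lia.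
Qed.

(* The times at which the atoms are outside of K, so that the pairing is the
   moment; they form a neighbourhood of t. *)
Let U : set R := [set s | [/\ 0 < s, ~ K (c * s) & ~ K (- (c * s))]].

Let oU : open U.
Proof.
have -> : U = `]0, +oo[ `&` (fun s => c * s) @^-1` (~` K)
              `&` (fun s => - (c * s)) @^-1` (~` K).
  apply/seteqP; split => s /=; rewrite in_itv/= andbT; first by move=> [? ? ?].
  by move=> [[? ?] ?].
apply: openI; first (apply: openI; first exact: interval_open).
- apply: open_comp => // x _; exact: mulrl_continuous.
- by apply: open_comp => // x _; apply: continuousN; exact: mulrl_continuous.
Qed.

Let pairing_vmoment_U k s : (k < 4)%N -> ~ K 0 -> U s ->
  pairing p (Dphi k) s = vmoment 0 (Dphi k) s.
Proof.
move=> k4 K0 [s0 Kc KN]; have [C bC] := Dphi_C2 k4.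
by apply: pairing_vmoment => //; [exact: hp|exact: C2_bmeas bC|exact: Dphi0..].
Qed.

Lemma weak_equation t : 0 < t -> ~ K 0 -> ~ K (c * t) -> ~ K (- (c * t)) ->
  let u := pairing p phi in
  let uxx := pairing p (derive1n 2 phi) in
  [/\ forall n, (n < 3)%N -> derivable (derive1n n u) t 1,
      derivable uxx t 1 &
      derive1n 3 u t + 3 * lam t * derive1n 2 u t
      + (2 * lam t ^+ 2 + derive1 lam t) * derive1 u t
      = c ^+ 2 * derive1 uxx t + c ^+ 2 * lam t * uxx t].
Proof.
move=> t0 K0 Kc KN u uxx; have Ut : U t by split.
have [C0 b0] := Dphi_C2 (isT : (0 < 4)%N).
have [C1 b1] := Dphi_C2 (isT : (1 < 4)%N).
have [C2 b2] := Dphi_C2 (isT : (2 < 4)%N).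
have [C3 b3] := Dphi_C2 (isT : (3 < 4)%N).
have lam_derive s : U s -> is_derive s 1 lam (derive1 lam s).
  by move=> [s0 _ _]; have [_ ds _] := hlam s0; rewrite derive1E; exact/derivableP.
pose m k j := vmoment k (Dphi j).
have m00 s : U s -> is_derive s 1 (m 0%N 0%N) (m 1%N 1%N s).
  by move=> [s0 _ _]; exact: vmoment0_derive s0 b0 b1.
have m11 s : U s -> is_derive s 1 (m 1%N 1%N) (m 2%N 2%N s - lam s * m 1%N 1%N s).
  by move=> [s0 _ _]; exact: vmoment1_derive s0 b1 b2.
have m22 s : U s -> is_derive s 1 (m 2%N 2%N) (c ^+ 2 * m 1%N 3%N s
    + lam s * (c ^+ 2 * m 0%N 2%N s - 2 * m 2%N 2%N s)).
  by move=> [s0 _ _]; exact: vmoment2_derive s0 b2 b3.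
have m02 s : U s -> is_derive s 1 (m 0%N 2%N) (m 1%N 3%N s).
  by move=> [s0 _ _]; exact: vmoment0_derive s0 b2 b3.
pose u2 s := m 2%N 2%N s - lam s * m 1%N 1%N s.
pose u3 s := (c ^+ 2 * m 1%N 3%N s
    + lam s * (c ^+ 2 * m 0%N 2%N s - 2 * m 2%N 2%N s))
  - (lam s * u2 s + m 1%N 1%N s * derive1 lam s).
have m2 s : U s -> is_derive s 1 u2 (u3 s).
  move=> Us; have d1 := m22 s Us; have d2 := m11 s Us; have d3 := lam_derive s Us.
  by apply: is_derive_eq.
have uE s : U s -> u s = m 0%N 0%N s by move=> Us; exact: (@pairing_vmoment_U 0).
have uxxE s : U s -> uxx s = m 0%N 2%N s by move=> Us; exact: (@pairing_vmoment_U 2).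
clearbody u uxx.
have u1E s : U s -> derive1 u s = m 1%N 1%N s.
  by move=> Us; exact: (derive_agree oU uE m00 Us).2.
have u2E s : U s -> derive1n 2 u s = u2 s.
  by move=> Us; exact: (derive_agree oU u1E m11 Us).2.
have [du0 _] := derive_agree oU uE m00 Ut.
have [du1 _] := derive_agree oU u1E m11 Ut.
have [du2 u3E] := derive_agree oU u2E m2 Ut.
have [dux uxE] := derive_agree oU uxxE m02 Ut.
split; [exact (derivable_lt3 du0 du1 du2)|exact dux|].
rewrite derive1nS u3E (u2E _ Ut) (u1E _ Ut) uxE (uxxE _ Ut).
rewrite /u3 /u2; move: (m 1%N 3%N t) (m 0%N 2%N t) (m 2%N 2%N t) (m 1%N 1%N t).
by move: (lam t) (derive1 lam t) => l l' a1 a2 a3 a4; clear; ring.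
Qed.

End WeakEquation.

(** * The classical equation *)

(** On a box where [p] is regular, the derivatives of the pairings in the weak
    equation are pairings of the derivatives of [p], and the second derivative
    of the test function is transposed to [p]. *)
Section ClassicalEquation.
Variable p : R -> R -> R.
Hypothesis hp :
  forall t, 0 < t -> ac_density (pushforward P (X t)) (fun x => p x t).
Variables (phi : R -> R) (a b t0 e : R).
Hypotheses (ab : a < b) (t00 : 0 < t0) (e0 : 0 < e)
  (dphi : derivable_upto 6 phi)
  (phi0 : forall x, ~ `[a, b]%classic x -> phi x = 0)
  (K0 : ~ `[a, b]%classic 0) (Kc : ~ `[a, b]%classic (c * t0))
  (KN : ~ `[a, b]%classic (- (c * t0))).

Variable U : set (R * R).
Hypotheses (Cp : Ck 3 U p)
  (boxU : forall x t, a <= x <= b -> t0 - e < t < t0 + e -> U (x, t)).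

Let pt := partial_t p.
Let ptt := partial_t pt.
Let pttt := partial_t ptt.
Let pxx := partial_x (partial_x p).
Let pxxt := partial_t pxx.

Let int (f : R -> R) : R :=
  \int[lebesgue_measure]_(x in `[a, b]) (phi x * f x).

Lemma tested_equation :
  int (pttt ^~ t0) + 3 * lam t0 * int (ptt ^~ t0)
    + (2 * lam t0 ^+ 2 + derive1 lam t0) * int (pt ^~ t0)
  = c ^+ 2 * int (pxxt ^~ t0) + c ^+ 2 * lam t0 * int (pxx ^~ t0).
Proof.
have [cp [dp [cpx [dpx [cpxx [dpxx _ [cpxxt _]]] _]] [cpt [dpt _ [cptt [dptt _ [cpttt _]]]]]]] := Cp.
have t0I : t0 - e < t0 < t0 + e by rewrite ltrBlDr ltrDl e0.
have cphi : continuous phi.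
  have [d0 _] := dphi.
  by move=> x; apply: differentiable_continuous; exact/derivable1_diffP.
pose O : set R := `]t0 - e, t0 + e[.
have oO : open O by exact: interval_open.
have Ot0 : O t0 by rewrite /O /= in_itv.
have derive_int (q : R -> R -> R) :
    (forall z, U z -> {for z, continuous (fun y : R * R => q y.1 y.2)}) ->
    (forall z, U z -> derivable (q ^~ z.2) z.1 1 /\ derivable (q z.1) z.2 1) ->
    (forall z, U z -> {for z, continuous (fun y : R * R => partial_t q y.1 y.2)}) ->
    forall s, O s -> is_derive s 1 (fun t => int (q ^~ t)) (int (partial_t q ^~ s)).
  move=> cq dq cqt s; rewrite /O /= in_itv/= => Os.
  apply: (@Rintegral_param_derive _ q phi a b (t0 - e) (t0 + e) cphi _ s Os).
  move=> x t xab tI; have Uxt := boxU xab tI.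
  by split; [exact (cq _ Uxt)|exact (dq _ Uxt).2|exact (cqt _ Uxt)].
have m0 := derive_int p cp dp cpt.
have m1 := derive_int pt cpt dpt cptt.
have m2 := derive_int ptt cptt dptt cpttt.
have mx := derive_int pxx cpxx dpxx cpxxt.
have D0 : forall n x, (n < 6)%N -> derivable (derive1n n phi) x 1.
  by move=> n x; exact: derivable_upto_derive1n dphi.
have cK : compact (`[a, b] : set R) by exact: segment_compact.
have [] := weak_equation hp D0 cK phi0 t00 K0 Kc KN.
set u := pairing p phi; set uxx := pairing p _ => _ _.
have uE s : O s -> u s = int (p ^~ s) by move=> _; exact: pairing_segment.
have oK : open (~` (`[a, b] : set R)).
  by apply: closed_openC; exact: compact_closed.
have phi1 x : ~ `[a, b]%classic x -> derive1 phi x = 0.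
  by move=> Kx; exact: derive1_eq0 oK phi0 Kx.
have phi2 x : ~ `[a, b]%classic x -> derive1 (derive1 phi) x = 0.
  by move=> Kx; exact: derive1_eq0 oK phi1 Kx.
have [cphi0 cphi1] : continuous phi /\ continuous (derive1 phi).
  have [d0 [d1 _]] := dphi.
  by split => x; apply: differentiable_continuous; exact/derivable1_diffP.
have bnd (f : R -> R) : continuous f -> (forall x, ~ `[a, b]%classic x -> f x = 0) -> f a = 0 /\ f b = 0.
  move=> cf f0; split.
  - have : f @ a^'- --> f a by apply: cvg_at_left_filter; exact: cf.
    have H : f @ a^'- --> (0 : R).
      apply: cvg_near_cst; near=> y; apply: f0; rewrite /= in_itv/= => /andP[ay _].
      by move: ay; rewrite leNgt => /negP; apply; near: y; exact: nbhs_left_lt.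
    by move=> /(cvg_unique _ H) <-.
  - have : f @ b^'+ --> f b by apply: cvg_at_right_filter; exact: cf.
    have H : f @ b^'+ --> (0 : R).
      apply: cvg_near_cst; near=> y; apply: f0; rewrite /= in_itv/= => /andP[_ yb].
      by move: yb; rewrite leNgt => /negP; apply; near: y; exact: nbhs_right_gt.
    by move=> /(cvg_unique _ H) <-.
have [pa pb] := bnd _ cphi0 phi0; have [dpa dpb] := bnd _ cphi1 phi1.
have uxxE s : O s -> uxx s = int (pxx ^~ s).
  rewrite /O /= in_itv/= => Os.
  rewrite /uxx (pairing_segment _ _ phi2) /int.
  have dphi3 : derivable_upto 3 phi by do 3 apply: derivable_uptoW.
  have H x : a <= x <= b -> [/\ derivable (p ^~ s) x 1,
      derivable (derive1 (p ^~ s)) x 1 &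
      {for x, continuous (derive1 (derive1 (p ^~ s)))}].
    move=> xab; have Ux := boxU xab Os.
    split; [exact (dp _ Ux).1|exact (dpx _ Ux).1|].
    have H := cpxx _ Ux; exact: (jointly_continuous_section H).
  exact: (segment_transpose_derive2 ab dphi3 pa pb dpa dpb H).
clearbody u uxx.
have u1E s : O s -> derive1 u s = int (pt ^~ s).
  by move=> Os; exact: (derive_agree oO uE m0 Os).2.
have u2E s : O s -> derive1n 2 u s = int (ptt ^~ s).
  by move=> Os; exact: (derive_agree oO u1E m1 Os).2.
have [_ u3E] := derive_agree oO u2E m2 Ot0.
have [_ uxE] := derive_agree oO uxxE mx Ot0.
rewrite derive1nS u3E (u2E _ Ot0) (u1E _ Ot0) uxE (uxxE _ Ot0).
exact.
Unshelve. all: end_near. Qed.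

End ClassicalEquation.

Lemma classical_equation (p : R -> R -> R) :
  (forall t, 0 < t -> ac_density (pushforward P (X t)) (fun x => p x t)) ->
  classical_solution c lam p.
Proof.
move=> hp U oU Upos Cp x0 t0 Ux0.
have t00 : 0 < t0 by exact (Upos _ Ux0).
have [e e0 eU] : exists2 e, 0 < e &
    forall x t, `|x - x0| < e -> `|t - t0| < e -> U (x, t).
  have := open_nbhs_nbhs (conj oU Ux0) => /nbhs_ballP[e /= e0 eU].
  exists e => // x t xe te; apply: eU.
  by split; rewrite /= /ball/= distrC.
apply: (@pointwise_of_tested R
  (fun x => partial_t (partial_t (partial_t p)) x t0)
  (fun x => partial_t (partial_t p) x t0) (fun x => partial_t p x t0)
  (fun x => partial_t (partial_x (partial_x p)) x t0)
  (fun x => partial_x (partial_x p) x t0)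
  (3 * lam t0) (2 * lam t0 ^+ 2 + derive1 lam t0) (c ^+ 2) (c ^+ 2 * lam t0)
  x0 e 0 (c * t0) (- (c * t0)) e0).
- move=> x xe; apply: (tested_continuous Cp); apply: eU xe _.
  by rewrite subrr normr0.
- move=> a b ab near_ab K0 Kc KN.
  apply: (tested_equation hp ab t00 e0 (bump_derivable_upto a b) (@bump_eq0 _ a b)
    K0 Kc KN Cp).
  move=> x t xab tI; apply: eU; first exact: near_ab.
  by rewrite ltr_distl.
Qed.

(** * The atoms *)

(** The position v t is reached without event from the initial velocity [v];
    it has probability 0 once an event has occurred, a singleton being a null
    set. *)
Lemma Pr_atom (v : R) t (q : R) : is_state v -> 0 < t ->
  (cumulative_rate lam 0 t < +oo)%E ->
  P (V0 @^-1` [set v]) = q%:E ->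
  indep_sigma P (rv_events V0) <<s counts_on E `[0, +oo[ >> ->
  P [set w | X t w = v * t] = (q * expR (- L 0 t))%:E.
Proof.
move=> sv t0 fin PV0 indep; have t0' := ltW t0.
have mX : measurable [set w | X t w = v * t].
  have -> : [set w | X t w = v * t] = X t @^-1` [set v * t] by [].
  by rewrite -[X in measurable X]setTI; exact: measurable_position.
have mV : measurable (V0 @^-1` [set v]).
  by rewrite -[X in measurable X]setTI; exact: measurable_funP.
have mN := measurable_N 0 (lexx 0) t0'.
have -> : [set w | X t w = v * t] = (V0 @^-1` [set v] `&` N 0 t 0) `|`
    (X t @^-1` [set v * t] `&` ~` N 0 t 0).
  apply/seteqP; split => [w /= Xw|w [[/= Vw Nw]|[]//]].
    have [Nw|Nw] := pselect (N 0 t 0 w); [left|right]; split => //=.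
    move: Xw; rewrite position_no_event// => /(mulIf (lt0r_neq0 t0)).
    by rewrite (velocity_init hV).
  by rewrite /= position_no_event// (velocity_init hV) Vw.
have mA : measurable (V0 @^-1` [set v] `&` N 0 t 0) by exact: measurableI.
have mB : measurable (X t @^-1` [set v * t] `&` ~` N 0 t 0).
  apply: measurableI; last exact: measurableC.
  exact: mX.
rewrite measureU//; last by rewrite -subset0 => w [[_ Nw] [_ /(_ Nw)]].
rewrite [X in (_ + X)%E]PrE// Pr_position_null//; last first.
  exact: lebesgue_measure_set1.
rewrite adde0.
have sN : <<s counts_on E `[0, +oo[ >> (N 0 t 0).
  apply: sub_gen_smallest; exists 0, t, 0%N; split => //; rewrite /= in_itv/= ?lexx//.
  by rewrite t0'.
have sV : rv_events V0 (V0 @^-1` [set v]) by exists [set v].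
rewrite [LHS](indep _ _ sV sN).
by rewrite PV0 [X in (_ * X)%E]PrE// Pr_N// expr0 fact0 divr1 mul1r -EFinM.
Qed.

End Motion.

Unset Implicit Arguments.

Theorem theorem2p3 (R : realType) (d : measure_display)
    (Omega : measurableType d) (P : probability Omega R)
    (c : R) (lam : R -> R) (E : Omega -> set R)
    (V0 : {RV P >-> R}) (V : R -> {RV P >-> R}) (p : R -> R -> R)
    (hc : 0 < c)
    (hlam : C1_rate lam)
    (hN : poisson_process P lam E)
    (hV0N : indep_sigma P (rv_events V0) <<s counts_on E `[0, +oo[ >>)
    (hV0c : P (V0 @^-1` [set c]) = (4^-1)%:E)
    (hV00 : P (V0 @^-1` [set 0]) = (2^-1)%:E)
    (hV0Nc : P (V0 @^-1` [set (- c)]) = (4^-1)%:E)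
    (hV : velocity_process c E V0 V)
    (hp : forall t : R, 0 < t ->
       ac_density (pushforward P (position V t)) (fun x => p x t)) :
  weak_solution c lam p /\ classical_solution c lam p /\
  (forall t : R, 0 < t -> (cumulative_rate lam 0 t < +oo)%E ->
     let atom := (expR (- fine (cumulative_rate lam 0 t)) / 4)%:E in
     [/\ P [set w | position V t w = c * t] = atom,
         P [set w | position V t w = - (c * t)] = atom &
         ((2^-1)%:E * P [set w | position V t w = 0%R])%E = atom]).
Proof.
split; [|split].
- move=> phi t [dphi cphi] t0 n0 nc nN.
  have phi0 x : ~ support_of phi x -> phi x = 0.
    move=> sx; apply/eqP/negPn/negP => px; apply: sx.
    by apply: subset_closure.
  have D n x : (n < 6)%N -> derivable (derive1n n phi) x 1 by move=> _; exact (dphi n x).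
  exact (weak_equation hc hlam hN hV hp D cphi phi0 t0 n0 nc nN).
- exact: (classical_equation hc hlam hN hV hp).
- move=> t t0 fin atom.
  have A v q sv Pv := @Pr_atom _ _ _ P c lam E V0 V hc hlam hN hV v t q sv t0 fin Pv hV0N.
  split.
  + by rewrite (A c _ (Or31 _ _ erefl) hV0c) /atom mulrC.
  + by rewrite -mulNr (A (- c) _ (Or33 _ _ erefl) hV0Nc) /atom mulrC.
  + have := A 0 _ (Or32 _ _ erefl) hV00; rewrite mul0r => ->.
    by rewrite -EFinM /atom; congr (_%:E); rewrite /rate_integral; field.
Qed.
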